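(* Let $A$ be a noetherian Krull domain, put $B:=A[[t]]$, and let $\pi\colon B\to A$ be the canonical projection $t\mapsto 0$. For a $B$-module $M$ write $M_t:=\{m\in M : tm=0\}$. If $M$ is a pseudo-null $B$-module, then $M_t$ and $M/tM$ are finitely generated torsion $A$-modules and \[ Ch_A(M_t)=Ch_A(M/tM). \] Moreover, for any finitely generated torsion $B$-module $N$, \[ Ch_A(N_t)\,\pi(Ch_B(N)) = Ch_A(N/tN). \]
   Context: A Krull domain is an integral domain $R$ such that $R=\bigcap R_{\mathfrak p}$ over all height 1 primes $\mathfrak p$, each such $R_{\mathfrak p}$ is a discrete valuation ring, and every nonzero $x\in R$ is a unit in $R_{\mathfrak p}$ for almost all $\mathfrak p$. If $A$ is a noetherian Krull domain, then so is $B=A[[t]]$. Let $R$ be a noetherian Krull domain. A finitely generated torsion $R$-module is pseudo-null if its annihilator has height at least 2 (equivalently, its localizations at all height 1 primes vanish); the zero module is pseudo-null. A pseudo-isomorphism is a morphism with pseudo-null kernel and cokernel. For every finitely generated torsion $R$-module $M$ there is a pseudo-isomorphism $M\to\bigoplus_{i=1}^n R/\mathfrak p_i^{e_i}$ with $\mathfrak p_i$ height 1 primes (not necessarily distinct); the $\mathfrak p_i$, $e_i$ and $n$ are uniquely determined by $M$. Characteristic ideal of a finitely generated $R$-module $M$: $Ch_R(M):=0$ if $M$ is not torsion, and $Ch_R(M):=\prod_{i=1}^n\mathfrak p_i^{e_i}$ if $M$ is torsion and pseudo-isomorphic to $\bigoplus_{i=1}^n R/\mathfrak p_i^{e_i}$.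 The exponent of a height 1 prime $\mathfrak p$ in $Ch_R(M)$ is the length of $M\otimes_R R_{\mathfrak p}$. In particular $M$ is pseudo-null if and only if $Ch_R(M)=R$.
   Formalization: The second formula is proved as an equality of divisorial closures of the two sides (same exponent at every height 1 prime); as a literal equality of ideals it fails, e.g. for A=k[[x,y,z]]/(xy-z^2), N=B/(x+t). *)

(* Defs.v *)
From HB Require Import structures.
From mathcomp Require Import all_boot all_order all_algebra.
From mathcomp Require Import boolp classical_sets cardinality.

Set Implicit Arguments.
Unset Strict Implicit.
Unset Printing Implicit Defensive.

Import Order.TTheory GRing.Theory Num.Theory.
Local Open Scope ring_scope.
Local Open Scope quotient_scope.

(* A wrapper record, because functions [nat -> A] already carry the pointwise
   ring structure. *)
Record fps (A : Type) := FPS { fps_coef : nat -> A }.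

HB.instance Definition _ (A : Type) := gen_eqMixin (fps A).
HB.instance Definition _ (A : Type) := gen_choiceMixin (fps A).

Lemma fpsP (A : Type) (f g : fps A) :
  (forall n, fps_coef f n = fps_coef g n) -> f = g.
Proof. by case: f => f; case: g => g /= /funext ->. Qed.

Section FpsRing.
Variable A : comNzRingType.
Implicit Types f g h : fps A.

Definition fps_zero : fps A := FPS (fun=> 0).
Definition fps_opp f : fps A := FPS (fun n => - fps_coef f n).
Definition fps_add f g : fps A := FPS (fun n => fps_coef f n + fps_coef g n).
Definition fps_one : fps A := FPS (fun n => (n == 0)%:R).
Definition fps_mul f g : fps A :=
  FPS (fun n => \sum_(i < n.+1) fps_coef f i * fps_coef g (n - i)).

Let fps_addA : associative fps_add.
Proof. by move=> f g h; apply: fpsP => n /=; rewrite addrA. Qed.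
Let fps_addC : commutative fps_add.
Proof. by move=> f g; apply: fpsP => n /=; rewrite addrC. Qed.
Let fps_add0 : left_id fps_zero fps_add.
Proof. by move=> f; apply: fpsP => n /=; rewrite add0r. Qed.
Let fps_addN : left_inverse fps_zero fps_opp fps_add.
Proof. by move=> f; apply: fpsP => n /=; rewrite addNr. Qed.

HB.instance Definition _ :=
  GRing.isZmodule.Build (fps A) fps_addA fps_addC fps_add0 fps_addN.

Let trunc n f : {poly A} := \poly_(i < n.+1) fps_coef f i.

Let coef_trunc n f i : (i <= n)%N -> (trunc n f)`_i = fps_coef f i.
Proof. by move=> lin; rewrite coef_poly ltnS lin. Qed.

Let coef_mulE n f g (p q : {poly A}) :
    (forall i, (i <= n)%N -> p`_i = fps_coef f i) ->
    (forall i, (i <= n)%N -> q`_i = fps_coef g i) ->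
  forall i, (i <= n)%N -> (p * q)`_i = fps_coef (fps_mul f g) i.
Proof.
move=> pf qg i lin; rewrite coefM; apply: eq_bigr => j _.
rewrite pf ?qg // ?(leq_trans (leq_subr _ _)) //.
by rewrite (leq_trans _ lin) // -ltnS.
Qed.

Let fps_mulA : associative fps_mul.
Proof.
move=> f g h; apply: fpsP => n.
have tE := @coef_trunc n.
rewrite -(coef_mulE (tE f) (coef_mulE (tE g) (tE h))) //.
by rewrite -(coef_mulE (coef_mulE (tE f) (tE g)) (tE h)) // mulrA.
Qed.
Let fps_mulC : commutative fps_mul.
Proof.
move=> f g; apply: fpsP => n; have tE := @coef_trunc n.
by rewrite -(coef_mulE (tE f) (tE g)) // mulrC (coef_mulE (tE g) (tE f)).
Qed.
Let fps_mul1 : left_id fps_one fps_mul.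
Proof.
move=> f; apply: fpsP => n /=; rewrite big_ord_recl /= subn0 mul1r.
by rewrite big1 ?addr0 // => i _; rewrite /bump /= mul0r.
Qed.
Let fps_mulDl : left_distributive fps_mul fps_add.
Proof.
move=> f g h; apply: fpsP => n /=; rewrite -big_split /=.
by apply: eq_bigr => i _; rewrite mulrDl.
Qed.
Let fps_one_neq0 : fps_one != fps_zero.
Proof.
apply/eqP => /(congr1 (fun f => fps_coef f 0)) /= /eqP.
by rewrite oner_eq0.
Qed.

HB.instance Definition _ := GRing.Zmodule_isComNzRing.Build (fps A)
  fps_mulA fps_mulC fps_mul1 fps_mulDl fps_one_neq0.

Definition fps_unit : pred (fps A) := fun f => `[< exists g, g * f = 1 >].
Definition fps_inv f : fps A :=
  if pselect (exists g, g * f = 1) is left e then projT1 (cid e) else f.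

Let fps_mulV : {in fps_unit, left_inverse 1 fps_inv *%R}.
Proof.
by move=> f /asboolP ef; rewrite /fps_inv; case: pselect => // e; case: cid.
Qed.
Let fps_unitPl f g : g * f = 1 -> fps_unit f.
Proof. by move=> gf; apply/asboolP; exists g. Qed.
Let fps_inv_out : {in [predC fps_unit], fps_inv =1 id}.
Proof.
move=> f; rewrite inE => /asboolPn nf.
by rewrite /fps_inv; case: pselect.
Qed.

HB.instance Definition _ := GRing.ComNzRing_hasMulInverse.Build (fps A)
  fps_mulV fps_unitPl fps_inv_out.

Definition fps_const (a : A) : fps A := FPS (fun n => if n is 0 then a else 0).
Definition fps_t : fps A := FPS (fun n => (n == 1)%:R).
Definition fps_pi f : A := fps_coef f 0.

Lemma fps_const_is_zmod_morphism : zmod_morphism fps_const.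
Proof. by move=> a b; apply: fpsP => -[|n] /=; rewrite ?subr0. Qed.
Lemma fps_const_is_monoid_morphism : monoid_morphism fps_const.
Proof.
split=> [|a b]; first by apply: fpsP => -[].
apply: fpsP => n /=; rewrite big_ord_recl /= subn0 big1 ?addr0.
  by case: n => [|n]; rewrite ?mulr0.
by move=> i _; rewrite mul0r.
Qed.
HB.instance Definition _ :=
  GRing.isZmodMorphism.Build A (fps A) fps_const fps_const_is_zmod_morphism.
HB.instance Definition _ :=
  GRing.isMonoidMorphism.Build A (fps A) fps_const fps_const_is_monoid_morphism.

End FpsRing.

Section FpsDomain.
Variable A : idomainType.

Let fps_order (f : fps A) : f != 0 ->
  exists n, fps_coef f n != 0 /\ forall m, (m < n)%N -> fps_coef f m = 0.
Proof.
move=> f0; have ex : exists n, fps_coef f n != 0.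
  apply: contra_notP (negP f0) => nex; apply/eqP/fpsP => n /=.
  by apply: contra_notP nex => /eqP; exists n.
exists (ex_minn ex); case: ex_minnP => n fn0 nmin; split=> // m ltmn.
by apply/eqP; apply: contraTT ltmn => /nmin; rewrite -leqNgt.
Qed.

Let fps_idomain (f g : fps A) : f * g = 0 -> (f == 0) || (g == 0).
Proof.
move=> fg0; apply: contraT; rewrite negb_or => /andP[f0 g0].
have [m [fm fmin]] := fps_order f0; have [n [gn gmin]] := fps_order g0.
move: fg0 => /(congr1 (fun h => fps_coef h (m + n)%N)) /=.
have lm : (m < (m + n).+1)%N by rewrite ltnS leq_addr.
rewrite (bigD1 (Ordinal lm)) //= addKn big1 ?addr0 => [/eqP|i].
  by rewrite mulf_eq0 (negPf fm) (negPf gn).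
rewrite -val_eqE /= => neim.
have [/fmin->|lemi] := ltnP i m; first by rewrite mul0r.
rewrite (gmin (m + n - i)%N) ?mulr0 //.
have ltmi : (m < i)%N by rewrite ltn_neqAle eq_sym neim.
have lei : (i <= m + n)%N by rewrite -ltnS.
by rewrite ltn_subLR // ltn_add2r.
Qed.

HB.instance Definition _ :=
  GRing.ComUnitRing_isIntegral.Build (fps A) fps_idomain.
End FpsDomain.

Section SubQuotient.
Variables (R : comNzRingType) (M : lmodType R) (U : submodClosed M).

Record submod := SubMod { submod_val : M; _ : submod_val \in U }.

HB.instance Definition _ := [isSub for submod_val].
HB.instance Definition _ := [Choice of submod by <:].

Definition submod_mem : {pred M} := fun x => x \in U.

Let submod_mem_closed : submod_closed submod_mem.
Proof.
split=> [|a x y Ux Uy]; first exact: rpred0.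
by apply: rpredD => //; apply: rpredZ.
Qed.

HB.instance Definition _ := GRing.isSubmodClosed.Build R M submod_mem
  (GRing.submod_closed_semi submod_mem_closed).

HB.instance Definition _ := GRing.SubChoice_isSubLmodule.Build R M
  submod_mem submod (GRing.submod_closed_semi submod_mem_closed).

Definition quotmod : Type := Quotient.quot submod_mem.

HB.instance Definition _ := GRing.Zmodule.on quotmod.

Definition quotmod_proj (x : M) : quotmod :=
  \pi_(Quotient.quot submod_mem) x.

Definition quotmod_scale (a : R) (x : quotmod) : quotmod :=
  quotmod_proj (a *: repr (x : Quotient.quot submod_mem)).

Lemma quotmod_projP (x y : M) :
  reflect (quotmod_proj x = quotmod_proj y) (x - y \in U).
Proof.
have -> : (x - y \in U) = Quotient.equiv submod_mem x y by [].
exact: eqmodP.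
Qed.

Lemma quotmod_projK (x : quotmod) :
  quotmod_proj (repr (x : Quotient.quot submod_mem)) = x.
Proof. exact: reprK. Qed.

Lemma quotmod_scaleE a x :
  quotmod_scale a (quotmod_proj x) = quotmod_proj (a *: x).
Proof.
by apply/quotmod_projP; rewrite -scalerBr rpredZ //; apply/quotmod_projP;
  rewrite quotmod_projK.
Qed.

Lemma quotmod_projD : {morph quotmod_proj : x y / x + y}.
Proof. by move=> x y; rewrite /quotmod_proj raddfD. Qed.

Let quotmod_scaleA a b x :
  quotmod_scale a (quotmod_scale b x) = quotmod_scale (a * b) x.
Proof. by rewrite -[x]quotmod_projK !quotmod_scaleE scalerA. Qed.
Let quotmod_scale1 : left_id 1 quotmod_scale.
Proof. by move=> x; rewrite -[x]quotmod_projK quotmod_scaleE scale1r. Qed.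
Let quotmod_scaleDr : right_distributive quotmod_scale +%R.
Proof.
move=> a x y; rewrite -[x]quotmod_projK -[y]quotmod_projK -quotmod_projD.
by rewrite !quotmod_scaleE scalerDr quotmod_projD.
Qed.
Let quotmod_scaleDl x : {morph quotmod_scale^~ x : a b / a + b}.
Proof.
move=> a b /=; rewrite -[x]quotmod_projK !quotmod_scaleE.
by rewrite scalerDl quotmod_projD.
Qed.

HB.instance Definition _ := GRing.Zmodule_isLmodule.Build R quotmod
  quotmod_scaleA quotmod_scale1 quotmod_scaleDr quotmod_scaleDl.

Lemma quotmod_proj_is_linear : linear quotmod_proj.
Proof. by move=> a x y; rewrite quotmod_projD -quotmod_scaleE. Qed.
HB.instance Definition _ := GRing.isLinear.Build R M quotmod _ quotmod_proj
  quotmod_proj_is_linear.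

End SubQuotient.

Section KernelImage.
Variables (R : comNzRingType) (M N : lmodType R) (f : {linear M -> N}).

Definition kerm : {pred M} := [pred x | f x == 0].
Definition imm : {pred N} := [pred y | `[< exists x, f x = y >]].

Let kerm_closed : submod_closed kerm.
Proof.
split=> [|a x y]; rewrite !inE ?linear0 // => /eqP fx /eqP fy.
by rewrite linearP fx fy scaler0 addr0.
Qed.
HB.instance Definition _ := GRing.isSubmodClosed.Build R M kerm
  (GRing.submod_closed_semi kerm_closed).

Let imm_closed : submod_closed imm.
Proof.
split=> [|a x y]; first by apply/asboolP; exists 0; rewrite linear0.
move=> /asboolP[u <-] /asboolP[v <-]; apply/asboolP.
by exists (a *: u + v); rewrite linearP.
Qed.
HB.instance Definition _ := GRing.isSubmodClosed.Build R N imm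
  (GRing.submod_closed_semi imm_closed).

End KernelImage.

Section DirectSum.
Variables (R : comNzRingType) (n : nat) (V : 'I_n -> lmodType R).

Record dsum := DSum { dsum_proj : forall i, V i }.

HB.instance Definition _ := gen_eqMixin dsum.
HB.instance Definition _ := gen_choiceMixin dsum.

Lemma dsumP (x y : dsum) : (forall i, dsum_proj x i = dsum_proj y i) -> x = y.
Proof.
case: x => x; case: y => y /= exy; congr DSum.
exact: functional_extensionality_dep.
Qed.

Definition dsum_add (x y : dsum) := DSum (fun i => dsum_proj x i + dsum_proj y i).
Definition dsum_zero := DSum (fun i => 0 : V i).
Definition dsum_opp (x : dsum) := DSum (fun i => - dsum_proj x i).
Definition dsum_scale (a : R) (x : dsum) := DSum (fun i => a *: dsum_proj x i).

Let addA : associative dsum_add.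
Proof. by move=> x y z; apply: dsumP => i /=; rewrite addrA. Qed.
Let addC : commutative dsum_add.
Proof. by move=> x y; apply: dsumP => i /=; rewrite addrC. Qed.
Let add0 : left_id dsum_zero dsum_add.
Proof. by move=> x; apply: dsumP => i /=; rewrite add0r. Qed.
Let addN : left_inverse dsum_zero dsum_opp dsum_add.
Proof. by move=> x; apply: dsumP => i /=; rewrite addNr. Qed.
HB.instance Definition _ := GRing.isZmodule.Build dsum addA addC add0 addN.

Let scaleA a b x : dsum_scale a (dsum_scale b x) = dsum_scale (a * b) x.
Proof. by apply: dsumP => i /=; rewrite scalerA. Qed.
Let scale1 : left_id 1 dsum_scale.
Proof. by move=> x; apply: dsumP => i /=; rewrite scale1r. Qed.
Let scaleDr : right_distributive dsum_scale +%R.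
Proof. by move=> a x y; apply: dsumP => i /=; rewrite scalerDr. Qed.
Let scaleDl x : {morph dsum_scale^~ x : a b / a + b}.
Proof. by move=> a b; apply: dsumP => i /=; rewrite scalerDl. Qed.
HB.instance Definition _ := GRing.Zmodule_isLmodule.Build R dsum
  scaleA scale1 scaleDr scaleDl.

End DirectSum.

Section Ideals.
Variable R : comNzRingType.
Implicit Types I J p q : {pred R}.

Definition ideal_mul I J : {pred R} := [pred x | `[<
  exists n (r a b : 'I_n -> R),
    (forall k, a k \in I /\ b k \in J) /\ x = \sum_k r k * (a k * b k) >]].

Fixpoint ideal_exp I (e : nat) : {pred R} :=
  if e is e'.+1 then ideal_mul I (ideal_exp I e') else predT.

Definition ideal_prod n (I : 'I_n -> {pred R}) : {pred R} :=
  \big[ideal_mul/(predT : {pred R})]_(i < n) I i.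

Lemma ideal_exp_closed I e : submod_closed (ideal_exp I e : {pred R^o}).
Proof.
case: e => [|e] //=; split=> [|c x y].
  apply/asboolP; exists 0, (fun=> 0), (fun=> 0), (fun=> 0).
  by rewrite big_ord0; split=> // -[].
move=> /asboolP[n [r [a [b [ab ->]]]]] /asboolP[m [s [u [v [uv ->]]]]].
apply/asboolP; pose g (w : 'I_n -> R) (z : 'I_m -> R) k :=
  match split k with inl i => w i | inr j => z j end.
exists (n + m)%N, (g (fun i => c * r i) s), (g a u), (g b v); split=> [k|].
  by rewrite /g; case: split.
rewrite big_split_ord /= scaler_sumr; congr (_ + _); apply: eq_bigr => i _.
  by rewrite /g (unsplitK (inl i)) /GRing.scale /= !mulrA.
by rewrite /g (unsplitK (inr i)).
Qed.

HB.instance Definition _ I e := GRing.isSubmodClosed.Build R R^o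
  (ideal_exp I e : {pred R^o})
  (GRing.submod_closed_semi (ideal_exp_closed I e)).

Definition prime_ideal p : Prop := idealr_closed p /\ prime_idealr_closed p.

(* [height_ge n p]: there is a chain p_0 < ... < p_n = p of primes *)
Fixpoint height_ge n p : Prop :=
  prime_ideal p /\
  if n is n'.+1 then
    exists q, [/\ {subset q <= p}, ~ {subset p <= q} & height_ge n' q]
  else True.

Definition height1 p : Prop := height_ge 1 p /\ ~ height_ge 2 p.

(* The unit ideal has infinite height. *)
Definition ideal_height_ge n I : Prop :=
  forall p, prime_ideal p -> {subset I <= p} -> height_ge n p.

Definition noetherian : Prop :=
  forall I, submod_closed (I : {pred R^o}) ->
    exists n (g : 'I_n -> R), forall x,
      x \in I <-> exists c : 'I_n -> R, x = \sum_i c i * g i.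

(* The intersection of the principal fractional ideals (b / a) R containing I;
   allowing b = 0 makes the closure of the zero ideal zero, also over a field.

   The formula Ch(N_t) pi(Ch(N)) = Ch(N/tN) is an equality of divisors, that is
   of ideals up to this closure: for A = k[[x,y,z]]/(xy - z^2), P = (x, z) and
   N = A[[t]]/(x + t), one has N_t = 0, pi(Ch(N)) = (x) and N/tN = A/(x), whose
   characteristic ideal is P^2 = x(x, y, z), with closure (x). *)
Definition divisorial_closure I : {pred R} := [pred x | `[<
  forall a b : R, a != 0 ->
    (forall y, y \in I -> exists c, a * y = b * c) ->
    exists c, a * x = b * c >]].

End Ideals.

Section Krull.
Variable R : idomainType.
Local Notation K := {fraction R}.

Definition localization (p : {pred R}) : {pred K} := [pred x | `[<
  exists a b : R, b \notin p /\ x = FracField.tofrac a / FracField.tofrac b >]].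

(* V is the valuation ring of a normalized discrete valuation of K; the value
   v 0 is irrelevant. *)
Definition is_dvr (V : {pred K}) : Prop :=
  exists v : K -> int,
    [/\ forall x y, x != 0 -> y != 0 -> v (x * y) = v x + v y,
        forall x y, x != 0 -> y != 0 -> x + y != 0 ->
          Num.min (v x) (v y) <= v (x + y),
        forall k, exists x, x != 0 /\ v x = k
      & forall x, x \in V <-> x = 0 \/ 0 <= v x].

Definition krull_domain : Prop :=
  [/\ forall x : K, (forall p, height1 p -> x \in localization p) ->
        exists r, x = FracField.tofrac r,
      forall p : {pred R}, height1 p -> is_dvr (localization p)
    & forall x : R, x != 0 -> finite_set
        [set p : {pred R} |
          height1 p /\ (FracField.tofrac x)^-1 \notin localization p]%classic].

End Krull.

Section Modules.
Variable R : idomainType.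
Implicit Types M N : lmodType R.

Definition fin_gen M : Prop :=
  exists n (g : 'I_n -> M), forall m,
    exists c : 'I_n -> R, m = \sum_i c i *: g i.

Definition torsion M : Prop := forall m : M, exists2 r : R, r != 0 & r *: m = 0.

Definition annihilator M : {pred R} := [pred r | `[< forall m : M, r *: m = 0 >]].

Definition pseudo_null M : Prop :=
  [/\ fin_gen M, torsion M & ideal_height_ge 2 (annihilator M)].

Definition pseudo_iso M N (f : {linear M -> N}) : Prop :=
  pseudo_null (submod (kerm f)) /\ pseudo_null (quotmod (imm f)).

Definition elementary n (p : 'I_n -> {pred R}) (e : 'I_n -> nat) : lmodType R :=
  dsum (fun i => quotmod (ideal_exp (p i) (e i) : {pred R^o})).

Definition is_char_ideal M (I : R -> bool) : Prop :=
  exists n (p : 'I_n -> {pred R}) (e : 'I_n -> nat)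
         (f : {linear M -> elementary p e}),
    [/\ forall i, height1 (p i), forall i, (0 < e i)%N, pseudo_iso f
      & I = ideal_prod (fun i => ideal_exp (p i) (e i))].

(* The default pred0 is never reached when M is finitely generated torsion over
   a noetherian Krull domain. *)
Definition Ch M : {pred R} :=
  if `[< torsion M >] then xget (pred0 : R -> bool) (is_char_ideal M)
  else pred1 0.

End Modules.

Section PowerSeriesModule.
Variables (A : idomainType) (M : lmodType (fps A)).

(* M viewed as an A-module through the constant series *)
Definition restr : Type := M.
HB.instance Definition _ := GRing.Zmodule.on restr.

Definition restr_scale (a : A) (x : restr) : restr := fps_const a *: (x : M).
Let scaleA a b x : restr_scale a (restr_scale b x) = restr_scale (a * b) x.
Proof. by rewrite /restr_scale scalerA rmorphM. Qed.
Let scale1 : left_id 1 restr_scale.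
Proof. by move=> x; rewrite /restr_scale rmorph1 scale1r. Qed.
Let scaleDr : right_distributive restr_scale +%R.
Proof. by move=> a x y; rewrite /restr_scale scalerDr. Qed.
Let scaleDl x : {morph restr_scale^~ x : a b / a + b}.
Proof. by move=> a b; rewrite /restr_scale rmorphD scalerDl. Qed.
HB.instance Definition _ := GRing.Zmodule_isLmodule.Build A restr
  scaleA scale1 scaleDr scaleDl.

Definition tmul (x : restr) : restr := fps_t A *: (x : M).

Let tmul_linear : linear tmul.
Proof.
move=> a x y; rewrite /tmul.
have -> : (a *: x + y : restr) = fps_const a *: (x : M) + (y : M) by [].
by rewrite scalerDr scalerA mulrC -scalerA.
Qed.
HB.instance Definition _ :=
  GRing.isLinear.Build A restr restr _ tmul tmul_linear.

(* M_t and M / tM *)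
Definition ttorsion : lmodType A := submod (kerm tmul).
Definition tquotient : lmodType A := quotmod (imm tmul).

End PowerSeriesModule.

Definition pi_ideal (A : idomainType) (I : {pred fps A}) : {pred A} :=
  [pred a | `[< exists2 f, f \in I & fps_pi f = a >]].

(* Main.v *)
(* Put B = A[[t]] and, for a height 1 prime p of A, let l_p be the length after
   localization at p. On B-modules M killed by some f with f(0) <> 0, both M_t
   and M/tM have finite l_p, and chi_p(M) = l_p(M/tM) - l_p(M_t) is additive by
   the snake lemma. Devissage to the cyclic modules B/q, with q a nonzero prime,
   gives
     chi_p(M) = sum over the height 1 primes q of B of l_q(M) v_p(pi(q)).
   Indeed chi_p(B/q) = 0 if t is in q, and otherwise (B/q)_t = 0 and chi_p(B/q) is
   the length v_p(pi(q)) of A/pi(q) at p; this vanishes when q has height at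
   least 2, since a prime of B contained in (p, t) and avoiding t is locally
   principal by Nakayama's lemma, hence of height at most 1. Pseudo-null modules
   have l_q = 0 for all q, which is the first claim. In general v_p(pi(Ch N)) is
   the right hand side, and an ideal is determined up to divisorial closure by
   its valuations at height 1 primes. If Ann(N) is contained in (t), both sides
   are zero.

   That the characteristic ideals exist over A and B is the structure theorem for
   noetherian completely integrally closed domains, and both properties pass from
   A to A[[t]]. *)

From HB Require Import structures.
Require Import Defs.
From mathcomp Require Import all_boot all_order all_algebra.
From mathcomp Require Import perm.
From mathcomp Require Import boolp classical_sets.
From mathcomp Require Import zify.
From Stdlib Require Import Ring.

Set Implicit Arguments.
Unset Strict Implicit.
Unset Printing Implicit Defensive.

Import Order.TTheory GRing.Theory Num.Theory.
Local Open Scope classical_set_scope.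
Local Open Scope ring_scope.

(** * Submodules and devissage *)

(** Localizations are never formed. The length of U / W at p is read off from chains of submodules
    of the original module, where a step counts as strict when some element has no multiple by an s
    outside p in the smaller submodule. Quotients are kept as pairs of nested submodules, so that
    devissage and length counts take place inside one module. What is carried from A to B is
    complete integral closedness and not the Krull axioms: together with the noetherian condition it
    yields the valuations at height 1 primes, and it passes to A[[t]] by coefficientwise division,
    without any knowledge of the height 1 primes of A[[t]]. A characteristic ideal is chosen among
    the products given by all pseudo-isomorphisms. It is handled through the list of its prime
    factors, whose multiplicities are lengths and so do not depend on the choice. One devissage of N
    over B supplies both these lengths and chi_p, which are thus compared on a single list. *)

Section Submodules.
Variables (R : comNzRingType) (M : lmodType R).
Implicit Types (U V W X : set M) (x y : M) (l : seq M).

Definition isub U := U 0 /\ forall a x y, U x -> U y -> U (a *: x + y).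

Lemma isub0 U : isub U -> U 0. Proof. by case. Qed.
Lemma isubP U a x y : isub U -> U x -> U y -> U (a *: x + y).
Proof. by case=> _; apply. Qed.
Lemma isubD U x y : isub U -> U x -> U y -> U (x + y).
Proof. by move=> sU Ux Uy; rewrite -[x]scale1r; apply: isubP. Qed.
Lemma isubZ U a x : isub U -> U x -> U (a *: x).
Proof. by move=> sU Ux; rewrite -[_ *: _]addr0; apply: isubP => //; case: sU. Qed.
Lemma isubN U x : isub U -> U x -> U (- x).
Proof. by move=> sU Ux; rewrite -scaleN1r; apply: isubZ. Qed.
Lemma isubB U x y : isub U -> U x -> U y -> U (x - y).
Proof. by move=> sU Ux Uy; apply: isubD => //; apply: isubN. Qed.
Lemma isubDr U x y : isub U -> U y -> U (x + y) -> U x.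
Proof. by move=> sU Uy Uxy; rewrite -(addrK y x); apply: isubB. Qed.
Lemma isub_sum U I (r : seq I) (P : pred I) (F : I -> M) :
  isub U -> (forall i, P i -> U (F i)) -> U (\sum_(i <- r | P i) F i).
Proof.
move=> sU UF; elim/big_ind: _ => // [|x y]; [exact: isub0|exact: isubD].
Qed.

Lemma isubT : isub setT. Proof. by []. Qed.
Lemma isub_zero : isub [set 0].
Proof. by split=> // a x y /= -> ->; rewrite scaler0 addr0. Qed.
Lemma isubI U V : isub U -> isub V -> isub (U `&` V).
Proof.
move=> sU sV; split=> [|a x y [Ux Vx] [Uy Vy]]; first by split; apply: isub0.
by split; apply: isubP.
Qed.

Definition sadd U V : set M := [set x | exists2 y, U y & V (x - y)].

Lemma isub_sadd U V : isub U -> isub V -> isub (sadd U V).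
Proof.
move=> sU sV; split=> [|a x y [u Uu Vu] [v Uv Vv]].
  by exists 0; rewrite ?subr0; apply: isub0.
exists (a *: u + v); first exact: isubP.
have -> : a *: x + y - (a *: u + v) = a *: (x - u) + (y - v).
  by rewrite scalerBr opprD addrACA.
exact: isubP.
Qed.
Lemma sadd_subl U V : isub V -> U `<=` sadd U V.
Proof. by move=> sV x Ux; exists x => //; rewrite subrr; apply: isub0. Qed.
Lemma sadd_subr U V : isub U -> V `<=` sadd U V.
Proof. by move=> sU x Vx; exists 0; rewrite ?subr0 //; apply: isub0. Qed.
Lemma sadd_min U V X : isub X -> U `<=` X -> V `<=` X -> sadd U V `<=` X.
Proof.
move=> sX UX VX x [u Uu Vu]; rewrite -(subrK u x).
by apply: isubD => //; [apply: VX|apply: UX].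
Qed.
Lemma saddS U V U' V' : U `<=` U' -> V `<=` V' -> sadd U V `<=` sadd U' V'.
Proof. by move=> UU VV x [u Uu Vu]; exists u; [exact: UU|exact: VV]. Qed.
Lemma sadd_idl U V : isub U -> isub V -> V `<=` U -> sadd U V = U.
Proof.
move=> sU sV VU; apply/seteqP; split; last exact: sadd_subl.
exact: sadd_min.
Qed.

(** Peeling off one generator at a time allows inductions on the list of generators. *)
Fixpoint span l : set M :=
  if l is g :: l' then [set x | exists a, span l' (x - a *: g)] else [set 0].

Lemma isub_span l : isub (span l).
Proof.
elim: l => [|g l sl] /=; first exact: isub_zero.
split=> [|a x y [b xb] [c yc]]; first by exists 0; rewrite scale0r subr0; case: sl.
exists (a * b + c).
have -> : a *: x + y - (a * b + c) *: g = a *: (x - b *: g) + (y - c *: g).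
  by rewrite scalerBr scalerDl scalerA opprD addrACA.
exact: isubP.
Qed.

Lemma span_cons_sub g l : span l `<=` span (g :: l).
Proof. by move=> x lx; exists 0; rewrite scale0r subr0. Qed.

Lemma mem_span l x : x \in l -> span l x.
Proof.
elim: l => //= g l IHl; rewrite inE => /predU1P[->|/IHl]; last exact: span_cons_sub.
by exists 1; rewrite scale1r subrr; case: (isub_span l).
Qed.

Lemma span_min l U : isub U -> (forall x, x \in l -> U x) -> span l `<=` U.
Proof.
move=> sU; elim: l => [_ x -> |g l IHl lU x [a xa]]; first by case: sU.
rewrite -(subrK (a *: g) x); apply: isubD => //.
  by apply: IHl => // y yl; apply: lU; rewrite inE yl orbT.
by apply: isubZ => //; apply: lU; rewrite mem_head.
Qed.

Lemma span_cat l l' : span (l ++ l') = sadd (span l) (span l').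
Proof.
apply/seteqP; split.
  apply: span_min => [|x]; first by apply: isub_sadd; apply: isub_span.
  rewrite mem_cat => /orP[] /mem_span.
    exact/sadd_subl/isub_span.
  exact/sadd_subr/isub_span.
by apply: sadd_min; [exact: isub_span|apply: span_min..];
  try exact: isub_span; move=> x xl; apply: mem_span; rewrite mem_cat xl ?orbT.
Qed.

Lemma span_codomP n (g : 'I_n -> M) x :
  span (codom g) x <-> exists c : 'I_n -> R, x = \sum_i c i *: g i.
Proof.
split=> [|[c ->]]; last first.
  apply: isub_sum => [|i _]; first exact: isub_span.
  by apply: isubZ; [exact: isub_span|apply: mem_span; apply: codom_f].
move: x; apply: span_min => [|_ /codomP[i ->]].
  split=> [|a _ _ [c ->] [d ->]].
    by exists (fun=> 0); rewrite big1 // => i _; rewrite scale0r.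
  exists (fun i => a * c i + d i); rewrite scaler_sumr -big_split /=.
  by apply: eq_bigr => i _; rewrite scalerDl scalerA.
exists (fun j => (j == i)%:R); rewrite (bigD1 i) //= eqxx scale1r big1 ?addr0 //.
by move=> j /negPf->; rewrite scale0r.
Qed.

Definition sub_fg U := exists l, U = span l.

End Submodules.

Lemma fin_genP (R : idomainType) (M : lmodType R) :
  fin_gen M <-> sub_fg [set: M].
Proof.
split=> [[n [g gP]]|[l lE]].
  by exists (codom g); apply/seteqP; split=> // x _; apply/span_codomP/gP.
exists (size l), (tnth (in_tuple l)) => m.
apply/span_codomP; have : span l m by rewrite -lE.
by rewrite codomE map_tnth_enum.
Qed.

Section Noetherian.
Variables (R : comNzRingType) (noethR : noetherian R).
Implicit Types (M : lmodType R).

Lemma noeth_fg (I : set R^o) : isub I -> sub_fg I.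
Proof.
move=> [I0 IP]; have [] := noethR (I := [pred x | `[< I x >]]).
  by split=> [|a x y]; rewrite !inE /= ?asboolE //; apply: IP.
move=> n [g gP]; exists (codom g); apply/seteqP; split=> x.
  move=> Ix; apply/span_codomP; apply/gP; exact/asboolP.
by move/span_codomP/gP => /asboolP.
Qed.

(** From an ideal where [P] fails, the step yields a strictly larger one where it fails too. The
    union of the chain built by choice is finitely generated, and its generators all lie in one
    member of the chain, which cannot then grow. *)
Lemma noeth_ind (P : set R^o -> Prop) :
  (forall I, isub I -> (forall J, isub J -> I `<=` J -> I <> J -> P J) -> P I) ->
  forall I, isub I -> P I.
Proof.
move=> step I0 sI0; apply: contrapT => nP0.
pose T := {I : set R^o | isub I /\ ~ P I}.
have next (I : T) : {J : T | sval I `<=` sval J /\ sval I <> sval J}.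
  apply: cid; case: I => I [sI nPI] /=; apply: contrapT => nex; apply: nPI.
  apply: step => // J sJ IJ nIJ; apply: contrapT => nPJ; apply: nex.
  by exists (exist _ J (conj sJ nPJ)).
pose f n := iter n (fun I => sval (next I)) (exist _ I0 (conj sI0 nP0) : T).
have fS n : sval (f n) `<=` sval (f n.+1) /\ sval (f n) <> sval (f n.+1).
  exact: (svalP (next (f n))).
have fmono m n : (m <= n)%N -> sval (f m) `<=` sval (f n).
  move=> /subnK<-; elim: (n - m)%N => // k IHk x /IHk.
  by rewrite addSn; apply: (fS _).1.
pose U : set R^o := [set x | exists n, sval (f n) x].
have sU : isub U.
  split=> [|a x y [m xm] [n yn]]; first by exists 0; case: (svalP (f 0)) => -[].
  exists (maxn m n); apply: isubP; first by case: (svalP (f (maxn m n))).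
    exact: fmono (leq_maxl _ _) _ xm.
  exact: fmono (leq_maxr _ _) _ yn.
have [l lE] := noeth_fg sU.
have [n ln] : exists n, forall x, x \in l -> sval (f n) x.
  have : forall x, x \in l -> U x by move=> x xl; rewrite lE; apply: mem_span.
  elim: l {lE} => [|g l IHl] lU; first by exists 0.
  have [|n ln] := IHl; first by move=> x xl; apply: lU; rewrite inE xl orbT.
  have [m gm] := lU g (mem_head _ _).
  exists (maxn m n) => x; rewrite inE => /predU1P[->|/ln].
    exact: fmono (leq_maxl _ _) _ gm.
  exact: fmono (leq_maxr _ _) _.
have [_ []] := fS n; apply/seteqP; split; first exact: (fS n).1.
move=> x xn; apply: (span_min _ ln); first by case: (svalP (f n)).
by rewrite -lE; exists n.+1.
Qed.

(** The coefficients at [g] of the elements of [U] form an ideal. Elements of [U] lifting its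
    generators, together with generators of the part of [U] inside the span of the remaining list,
    generate [U]. *)
Lemma noeth_sub M (U : set M) l : isub U -> U `<=` span l -> sub_fg U.
Proof.
elim: l U => [|g l IHl] U sU Ul.
  exists [::]; apply/seteqP; split=> // x /= ->; exact: isub0.
pose I : set R^o := [set a | exists2 y, span l y & U (a *: g + y)].
have sI : isub I.
  split=> [|c a b [y ly Uy] [z lz Uz]].
    by exists 0; rewrite ?scale0r ?addr0; apply: isub0 => //; apply: isub_span.
  exists (c *: y + z); first by apply: isubP => //; apply: isub_span.
  have -> : (c * a + b) *: g + (c *: y + z) = c *: (a *: g + y) + (b *: g + z).
    by rewrite scalerDr scalerDl scalerA addrACA.
  exact: isubP.
have [la laE] := noeth_fg sI.
have [lx [lxU lxE]] : exists lx : seq M, (forall x, x \in lx -> U x) /\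
   forall a, span la a -> exists2 x, span lx x & span l (x - a *: g).
  have : forall a, a \in la -> I a by move=> a; rewrite laE; apply: mem_span.
  elim: la {laE} => [|a la IHla] laI.
    exists [::]; split=> // a ->; exists 0; rewrite // scale0r subr0.
    exact: isub0 (isub_span _).
  have [|lx [lxU lxE]] := IHla; first by move=> b bl; apply: laI; rewrite inE bl orbT.
  have [y ly Uy] := laI a (mem_head _ _).
  exists (a *: g + y :: lx); split=> [x|b [c /lxE[x lx0 lxb]]].
    by rewrite inE => /predU1P[->|/lxU].
  exists (c *: (a *: g + y) + x) => /=.
    by exists c; rewrite addrC addKr.
  have -> : c *: (a *: g + y) + x - b *: g = c *: y + (x - (b - c *: a) *: g).
    have -> : c *: a = c * a by [].
    rewrite scalerDr scalerBl scalerA opprB -!addrA addrCA.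
    by congr (_ + _); rewrite addrCA.
  by apply: isubP => //; apply: isub_span.
have [l' l'E] : sub_fg (U `&` span l).
  by apply: IHl; [apply: isubI => //; apply: isub_span|move=> x []].
exists (lx ++ l'); rewrite span_cat -l'E; apply/seteqP; split=> [x Ux|].
  have [a xa] := Ul x Ux.
  have Ia : span la a.
    rewrite -laE; exists (x - a *: g) => //.
    by rewrite addrC subrK.
  have [z lz zl] := lxE _ Ia; exists z => //; split.
    apply: isubB => //; exact: (span_min sU lxU).
  have -> : x - z = (x - a *: g) - (z - a *: g) by rewrite opprB addrA subrK.
  by apply: isubB => //; apply: isub_span.
by apply: (sadd_min sU (span_min sU lxU)) => x [].
Qed.

End Noetherian.

(** The annihilator of the class of [x] in the quotient by [W]. *)
Definition colon (R : comNzRingType) (M : lmodType R) (W : set M) (x : M) :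
  set R^o := [set a | W (a *: x)].

Definition pred_of (T : Type) (A : set T) : {pred T} := [pred x | `[< A x >]].
Lemma pred_ofP (T : Type) (A : set T) (x : T) :
  reflect (A x) (x \in pred_of A).
Proof. exact: asboolP. Qed.

Lemma isub_colon (R : comNzRingType) (M : lmodType R) (W : set M) x :
  isub W -> isub (colon W x).
Proof.
move=> sW; split=> [|c a b Wa Wb]; first by rewrite /colon /= scale0r; case: sW.
by rewrite /colon /= scalerDl -scalerA; apply: isubP.
Qed.

Section Devissage.
Variables (R : comNzRingType) (noethR : noetherian R) (M : lmodType R).
Variable P : set M -> set M -> Prop.
Hypothesis Pid : forall W, isub W -> P W W.
Hypothesis Pext : forall W V U, isub W -> isub V -> isub U ->
  W `<=` V -> V `<=` U -> P W V -> P V U -> P W U.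
Hypothesis Pprime : forall W x, isub W -> prime_ideal (pred_of (colon W x)) ->
  P W (sadd W (span [:: x])).

(** Noetherian induction on [colon W x]. If a b lies in this ideal while a and b do not, insert V =
    W + R a x: the two cyclic quotients obtained have strictly larger annihilators, which contain b
    and a respectively. *)
Lemma devissage_cyclic W x : isub W -> P W (sadd W (span [:: x])).
Proof.
move=> sW; have [I eI] : exists I, colon W x = I by exists (colon W x).
have sI : isub I by rewrite -eI; apply: isub_colon.
elim/(noeth_ind noethR): I / sI W x sW eI => I sI IH W x sW eI.
have [Wx|nWx] := pselect (W x).
  suff -> : sadd W (span [:: x]) = W by apply: Pid.
  by apply: sadd_idl => //; [exact: isub_span|apply: span_min => // y /[!inE] /eqP->].
have sX := isub_sadd sW (isub_span [:: x]).
have [pI|npI] := pselect (prime_ideal (pred_of (colon W x))); first exact: Pprime.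
have [a [b [Iab [nIa nIb]]]] : exists a b, I (a * b) /\ ~ I a /\ ~ I b.
  apply: contrapT => nex; apply: npI; rewrite eI; split; first split.
  - by apply/pred_ofP; case: sI.
  - by apply/pred_ofP; rewrite -eI /colon /= scale1r.
  - by move=> c u v /pred_ofP Iu /pred_ofP Iv; apply/pred_ofP; case: sI => _; apply.
  move=> u v /pred_ofP Iuv; apply: contrapT => /negP.
  by rewrite negb_or => /andP[/pred_ofP Iu /pred_ofP Iv]; apply: nex; exists u, v.
pose V := sadd W (span [:: a *: x]).
have sV : isub V by apply: isub_sadd => //; apply: isub_span.
have WV : W `<=` V by apply: sadd_subl; apply: isub_span.
have VU : V `<=` sadd W (span [:: x]).
  apply: saddS; first by [].
  apply: (@span_min _ _ [:: a *: x]); first exact: isub_span.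
  by move=> y /[!inE]/eqP->; exists a; rewrite subrr.
have -> : sadd W (span [:: x]) = sadd V (span [:: x]).
  apply/seteqP; split; first by apply: saddS.
  by apply: sadd_min => //; apply: sadd_subr.
apply: (Pext (V := V)) => //; first exact: isub_sadd sV (isub_span _).
- by apply: sadd_subl; apply: isub_span.
- apply: (IH (colon W (a *: x))) => //; first exact: isub_colon.
    by rewrite -eI => c; rewrite /colon /= scalerA mulrC -scalerA; apply: isubZ.
  move=> eq; apply: nIb; rewrite eq /colon /= scalerA mulrC.
  by rewrite -eI in Iab.
- apply: (IH (colon V x)) => //; first exact: isub_colon.
    by rewrite -eI => c /WV.
  move=> eq; apply: nIa; rewrite eq; apply: sadd_subr => //.
  by exists 1; rewrite scale1r subrr.
Qed.

Lemma devissage W l : isub W -> P W (sadd W (span l)).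
Proof.
move=> sW; elim: l => [|g l IHl].
  rewrite sadd_idl //; [exact: Pid|exact: isub_span|].
  by move=> x /= ->; apply: isub0.
have sV := isub_sadd sW (isub_span l).
have -> : sadd W (span (g :: l)) = sadd (sadd W (span l)) (span [:: g]).
  apply/seteqP; split.
    move=> x [w Ww [a xa]]; exists (x - a *: g).
      by exists w; rewrite // addrAC.
    by exists a; rewrite subKr subrr.
  apply: sadd_min; first exact: isub_sadd (isub_span _).
    by apply: saddS => //; apply: span_cons_sub.
  move=> x xg; apply: sadd_subr => //.
  apply: (span_min _ _ xg); first exact: isub_span.
  by move=> y; rewrite inE => /eqP->; apply: mem_span; apply: mem_head.
apply: (Pext (V := sadd W (span l))) => //.
- exact: isub_sadd (isub_span _).
- exact: sadd_subl (isub_span _).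
- exact: sadd_subl (isub_span _).
- exact: devissage_cyclic.
Qed.

End Devissage.

(** * Lengths at a prime *)

Section PrimeIdeals.
Variables (R : comNzRingType) (p : {pred R}) (pp : prime_ideal p).
Implicit Types x y s : R.

Lemma prime0 : 0 \in p. Proof. by case: pp => -[]. Qed.
Lemma primeN1 : 1 \notin p. Proof. by case: pp => -[]. Qed.
Lemma primeP a x y : x \in p -> y \in p -> a * x + y \in p.
Proof. by case: pp => -[_ _ h] _; apply: h. Qed.
Lemma primeMl a x : x \in p -> a * x \in p.
Proof. by move=> px; rewrite -[_ * _]addr0 primeP ?prime0. Qed.
Lemma primeMr a x : x \in p -> x * a \in p.
Proof. by rewrite mulrC; apply: primeMl. Qed.
Lemma primeB x y : x \in p -> y \in p -> x - y \in p.
Proof. by move=> px py; rewrite addrC -mulN1r primeP. Qed.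
Lemma primeMn x y : x \notin p -> y \notin p -> x * y \notin p.
Proof.
move=> px py; apply/negP; case: pp => _ h /h.
by rewrite (negPf px) (negPf py).
Qed.
Lemma primeM x y : (x * y \in p) = (x \in p) || (y \in p).
Proof.
apply/idP/idP; first by case: pp => _; apply.
by case/orP; [apply: primeMr|apply: primeMl].
Qed.
Lemma prime_prodn I (r : seq I) (P : pred I) (F : I -> R) :
  (forall i, P i -> F i \notin p) -> \prod_(i <- r | P i) F i \notin p.
Proof.
by move=> h; elim/big_ind: _ => //; [exact: primeN1|exact: primeMn].
Qed.
Lemma prime_expn x n : x \notin p -> x ^+ n \notin p.
Proof.
by move=> px; elim: n => [|n IHn]; rewrite ?primeN1 // exprS primeMn.
Qed.
Lemma prime_neq0 x : x \notin p -> x != 0.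
Proof. by apply: contraNneq => ->; apply: prime0. Qed.
Lemma prime_isub : isub ([set x | x \in p] : set R^o).
Proof. by split=> [|a x y]; [exact: prime0|exact: primeP]. Qed.

End PrimeIdeals.

Section Chains.
Variables (R : comNzRingType) (p : {pred R}).
Implicit Types (M N : lmodType R).

(* The length of the localization of U / W at p is at least n: a chain of
   submodules from W to U whose n steps stay strict after localization. *)
Fixpoint chain M n (W U : set M) : Prop :=
  if n is n'.+1 then exists V x,
    [/\ isub V, V `<=` U, U x, forall s, s \notin p -> ~ V (s *: x)
      & chain n' W V]
  else W `<=` U.

(** A relation and not a function, since a length may be infinite. *)
Definition len M (W U : set M) n := chain n W U /\ ~ chain n.+1 W U.

Lemma chain_sub M n (W U : set M) : chain n W U -> W `<=` U.
Proof.
by elim: n U => //= n IHn U [V [x [_ VU _ _ /IHn WV]]] y /WV/VU.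
Qed.

Lemma chain_mono M n (W U U' : set M) : U `<=` U' -> chain n W U -> chain n W U'.
Proof.
case: n => [UU WU x /WU/UU //|n UU [V [x [sV VU Ux nVx cV]]]].
by exists V, x; split=> // [y /VU/UU //|]; apply: UU.
Qed.

Lemma chain_le M m n (W U : set M) : (m <= n)%N -> chain n W U -> chain m W U.
Proof.
move=> /subnK<-; elim: (n - m)%N => // k IHk [V [x [_ VU _ _ cV]]].
exact: IHk (chain_mono VU cV).
Qed.

Lemma chain_glue M a b (W V U : set M) :
  chain a V U -> chain b W V -> chain (a + b) W U.
Proof.
elim: a U => [U VU cV|a IHa U [X [x [sX XU Ux nX cX]]] cV] /=.
  exact: chain_mono VU cV.
by exists X, x; split=> //; apply: IHa.
Qed.

(* G is the graph of an isomorphism between U / W and U' / W'. *)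
Lemma chain_corr M (N : lmodType R) (G : M -> N -> Prop) n (W U : set M) (W' U' : set N) :
    (forall a x x' y y', G x y -> G x' y' -> G (a *: x + x') (a *: y + y')) ->
    isub W -> isub U -> isub W' -> isub U' -> W' `<=` U' ->
    (forall x, U x -> exists2 y, U' y & G x y) ->
    (forall y, U' y -> exists2 x, U x & G x y) ->
    (forall x y, U x -> U' y -> G x y -> W x <-> W' y) ->
  chain n W U -> chain n W' U'.
Proof.
move=> GP sW sU sW' sU' WU' tot onto; elim: n U U' sU sU' WU' tot onto => //.
move=> n IHn U U' sU sU' WU' tot onto GW [V [x [sV VU Ux nVx cV]]].
have WV := chain_sub cV.
have [y U'y Gxy] := tot x Ux.
pose V' : set N := [set y | U' y /\ exists2 x, V x & G x y].
have sV' : isub V'.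
  split=> [|a z z' [Uz [w Vw Gw]] [Uz' [w' Vw' Gw']]].
    split; first exact: isub0.
    have [z Uz Gz] := onto _ (isub0 sU').
    exists z => //; apply: WV; apply/(GW _ _ Uz (isub0 sU') Gz); exact: isub0.
  split; first exact: isubP.
  exists (a *: w + w'); [exact: isubP|exact: GP].
exists V', y; split=> // [z []//|s ps [_ [z Vz Gz]]|].
  have Gzs : G (- s *: x + z) 0.
    by rewrite -(addNr (s *: y)) -[in G _ _]scaleNr; apply: GP.
  have Uzs : U (- s *: x + z) by apply: isubP => //; apply: VU.
  have : V (- s *: x + z).
    by apply/WV/(GW _ _ Uzs (isub0 sU') Gzs); apply: isub0.
  move=> Vzs; apply: (nVx _ ps); rewrite -[s]opprK scaleNr; apply: isubN => //.
  exact: isubDr sV Vz Vzs.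
apply: (IHn V V') => // [z W'z|z Vz|z [_ //]|z z' Vz [Uz' _]].
- split; first exact: WU'.
  have [w Uw Gw] := onto _ (WU' _ W'z).
  by exists w => //; apply/WV/(GW _ _ Uw (WU' _ W'z) Gw).
- have [w Uw Gw] := tot z (VU _ Vz).
  by exists w => //; split => //; exists z.
by apply: GW => //; apply: VU.
Qed.

Lemma len_corr M (N : lmodType R) (G : M -> N -> Prop) n (W U : set M) (W' U' : set N) :
    (forall a x x' y y', G x y -> G x' y' -> G (a *: x + x') (a *: y + y')) ->
    isub W -> isub U -> isub W' -> isub U' -> W `<=` U -> W' `<=` U' ->
    (forall x, U x -> exists2 y, U' y & G x y) ->
    (forall y, U' y -> exists2 x, U x & G x y) ->
    (forall x y, U x -> U' y -> G x y -> W x <-> W' y) ->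
  len W U n -> len W' U' n.
Proof.
move=> GP sW sU sW' sU' WU WU' tot onto GW [c nc].
split; first exact: (chain_corr GP sW sU sW' sU').
move=> c'; apply: nc.
apply: (chain_corr (G := fun y x => G x y) _ sW' sU') c' => // [|x y Ux Uy Gxy].
  by move=> a x x' y y' G1 G2; apply: GP.
by have [h1 h2] := GW _ _ Uy Ux Gxy; split.
Qed.

(** The second isomorphism theorem; the graph is congruence modulo [C]. *)
Lemma len_sadd M n (V C : set M) : isub V -> isub C ->
  len (V `&` C) V n <-> len C (sadd V C) n.
Proof.
move=> sV sC; have sI := isubI sV sC; have sS := isub_sadd sV sC.
have GP : forall a (x x' y y' : M), C (x - y) -> C (x' - y') ->
    C (a *: x + x' - (a *: y + y')).
  move=> a x x' y y' h h'; have -> : a *: x + x' - (a *: y + y') =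
    a *: (x - y) + (x' - y') by rewrite scalerBr opprD addrACA.
  exact: isubP.
split.
  apply: (@len_corr _ _ (fun x y => C (y - x))) => //.
  - by move=> a x x' y y'; apply: GP.
  - exact: sadd_subr.
  - move=> x Vx.
    by exists x; [apply: sadd_subl|rewrite subrr; apply: isub0].
  move=> x y Vx _ Cyx.
  split=> [[_ Cx]|Cy]; first by rewrite -(subrK x y); apply: isubD.
  by split=> //; rewrite -[x](subKr y); apply: isubB.
apply: (@len_corr _ _ (fun x y => C (x - y))) => //.
- exact: sadd_subr.
- by move=> y Vy; exists y; [apply: sadd_subl|rewrite subrr; apply: isub0].
move=> x y _ Vy Cyx.
split=> [Cx|[_ Cy]]; last by rewrite -(subrK y x); apply: isubD.
by split=> //; rewrite -[y](subKr x); apply: isubB.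
Qed.

Lemma len_uniq M (W U : set M) a b : len W U a -> len W U b -> a = b.
Proof.
move=> [ca na] [cb nb]; apply/eqP; rewrite eqn_leq; apply/andP.
split; rewrite leqNgt; apply/negP => h; [apply: nb|apply: na].
  exact: chain_le ca.
exact: chain_le cb.
Qed.

Hypothesis pp : prime_ideal p.

(** The chain is intersected with [V] on one side and enlarged by [V] on the other, and each step
    stays strict on one of them. If no element of X and V witnesses it for the intersections, [x]
    does so for the sums: when s x = y + v with y in [Y], the element v of X and V has a multiple in
    [Y] by some s' outside p, hence so has x. *)
Lemma chain_split M n (W V X : set M) : isub W -> isub V -> isub X ->
    W `<=` V -> chain n W X ->
  exists a b, [/\ (a + b = n)%N, chain a V (sadd X V) & chain b W (X `&` V)].
Proof.
move=> sW sV; elim: n X => [X sX WV WX|n IHn X sX WV [Y [x [sY YX Xx nYx cY]]]].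
  exists 0%N, 0%N; split=> // [y Vy|y Wy]; first exact: sadd_subr.
  by split; [exact: WX|exact: WV].
have [a [b [ab ca cb]]] := IHn Y sY WV cY.
have [[y [Xy Vy nYy]]|nex] := pselect (exists y,
    [/\ X y, V y & forall s, s \notin p -> ~ Y (s *: y)]).
  exists a, b.+1; split; first by rewrite addnS ab.
    by apply: chain_mono ca; apply: saddS.
  exists (Y `&` V), y; split=> //; first exact: isubI.
    by move=> z [/YX].
  by move=> s /nYy nY [].
exists a.+1, b; split; first by rewrite addSn ab.
  exists (sadd Y V), x; split=> //.
  - exact: isub_sadd.
  - exact: saddS.
  - exact: sadd_subl.
  move=> s ps [y Yy Vxy]; apply: nex; exists (s *: x - y); split=> //.
    by apply: isubB => //; [apply: isubZ|apply: YX].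
  move=> s' ps'; rewrite scalerBr scalerA => h.
  apply: (nYx (s' * s)); first exact: primeMn.
  rewrite -(subrK (s' *: y) (_ *: x)); apply: isubD => //; exact: isubZ.
by apply: chain_mono cb => z [/YX].
Qed.

Section Additivity.
Variables (M : lmodType R) (W V U : set M).
Hypotheses (sW : isub W) (sV : isub V) (sU : isub U).
Hypotheses (WV : W `<=` V) (VU : V `<=` U).

Lemma len_add a b : len V U a -> len W V b -> len W U (a + b).
Proof.
move=> [ca na] [cb nb]; split; first exact: chain_glue ca cb.
move=> c; have [a' [b' [ab]]] := chain_split sW sV sU WV c.
rewrite sadd_idl // => ca' cb'.
have cb2 : chain b' W V by apply: chain_mono cb' => x [].
have [h|h] := leqP a'  a; last by apply: na; apply: chain_le ca'.
apply: nb; apply: chain_le cb2; lia.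
Qed.

Lemma chain_max n (X Y : set M) : X `<=` Y -> ~ chain n.+1 X Y ->
  exists2 m, (m <= n)%N & len X Y m.
Proof.
move=> XY; elim: n => [|n IHn] nc; first by exists 0%N.
have [c|/IHn[m mn lm]] := pselect (chain n.+1 X Y); first by exists n.+1.
by exists m => //; apply: leqW.
Qed.

Lemma len_split n : len W U n ->
  exists a b, [/\ (a + b = n)%N, len V U a & len W V b].
Proof.
move=> ln; have [c nc] := ln.
have [a _ la] : exists2 m, (m <= n)%N & len V U m.
  apply: chain_max => // c'; apply: nc.
  by rewrite -[n.+1]addn0; apply: chain_glue c' _ .
have [b _ lb] : exists2 m, (m <= n)%N & len W V m.
  apply: chain_max => // c'; apply: nc.
  by rewrite -[n.+1]add0n; apply: chain_glue c'.
exists a, b; split=> //; exact: len_uniq (len_add la lb) ln.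
Qed.
End Additivity.

Lemma len_id M (W : set M) : isub W -> len W W 0.
Proof.
move=> sW; split=> // -[V [x [sV VW Wx nVx /= WV]]].
by apply: (nVx 1); rewrite ?primeN1 // scale1r; apply: WV.
Qed.

Lemma len0P M (W U : set M) : isub W -> W `<=` U ->
  len W U 0 <-> forall x, U x -> exists2 s, s \notin p & W (s *: x).
Proof.
move=> sW WU; split=> [[_ nc] x Ux|h].
  apply: contrapT => nex; apply: nc; exists W, x; split=> //= s ps Wx.
  by apply: nex; exists s.
split=> // -[V [x [sV VU Ux nVx /= WV]]].
by have [s /nVx ps /WV] := h x Ux.
Qed.

(** The quotient is R / p, locally a line over the residue field. In a chain of two steps the lower
    witness is b x modulo [W] with b outside p, so it generates everything locally and draws the
    upper witness into [V]. *)
Lemma len_cyclic M (W : set M) x : isub W -> colon W x = [set a | a \in p] ->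
  len W (sadd W (span [:: x])) 1.
Proof.
move=> sW eI; have Ie a : W (a *: x) <-> a \in p.
  by rewrite -[W _]/(colon W x a) eI.
have sS := isub_sadd sW (isub_span [:: x]).
have US y : sadd W (span [:: x]) y -> exists2 b, W (y - b *: x) & True.
  move=> [w Ww [b yb]]; exists b => //.
  by have -> : y - b *: x = w by apply/eqP; rewrite -subr_eq0 addrAC; apply/eqP.
split.
  exists W, x; split=> //.
  - exact: sadd_subl (isub_span _).
  - by apply: sadd_subr => //; apply: mem_span; apply: mem_head.
  by move=> s /negP ps /Ie.
move=> [V [y [sV VS /US[c yc _] nVy [Y [z [sY YV Vz nYz /= WY]]]]]].
have [b zb _] := US z (VS _ Vz).
have pb : b \notin p.
  apply/negP => /Ie Wb; apply: (nYz 1); first exact: primeN1.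
  by rewrite scale1r; apply: WY; rewrite -(subrK (b *: x) z); apply: isubD.
apply: (nVy _ pb).
have -> : b *: y = b *: (y - c *: x) - c *: (z - b *: x) + c *: z.
  rewrite !scalerBr !scalerA opprB [c * b]mulrC addrA subrK subrK //.
apply: isubD => //; last exact: isubZ.
by apply/YV/WY; apply: isubB => //; apply: isubZ.
Qed.

End Chains.

Section DomainRing.
Variable R : idomainType.
Definition radd (x y : R) : R := x + y.
Definition rmul (x y : R) : R := x * y.
Definition ropp (x : R) : R := - x.
Definition rsub (x y : R) : R := x - y.

Lemma domain_ring_theory : @ring_theory R 0 1 radd rmul rsub ropp eq.
Proof.
split=> //; [exact: add0r|exact: addrC|exact: addrA|exact: mul1r|exact: mulrC
            |exact: mulrA|exact: mulrDl|exact: subrr].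
Qed.
End DomainRing.

(* [ring] matches operators syntactically, hence the folding into constants. *)
Ltac ring_in R :=
  match goal with |- @eq _ ?a ?b => change (@eq (GRing.IntegralDomain.sort R) a b) end;
  repeat change (?x + ?y) with (@radd R x y);
  repeat change (?x * ?y) with (@rmul R x y);
  repeat change (- ?x) with (@ropp R x);
  repeat change (?x *: ?y) with (@rmul R x y);
  ring.

(** * Valuations at height 1 primes *)

Section Height.
Variables (R : idomainType).
Implicit Types (p q : {pred R}).

Lemma prime_pred1 : prime_ideal (pred1 (0 : R)).
Proof.
split=> [|u v]; last by rewrite !inE mulf_eq0.
split=> [||a u v]; rewrite ?inE ?oner_eq0 //.
by move=> /eqP-> /eqP->; rewrite mulr0 addr0.
Qed.

Lemma height_ge_prime n p : height_ge n p -> prime_ideal p.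
Proof. by case: n => [|n] []. Qed.

Lemma height1_prime p : height1 p -> prime_ideal p.
Proof. by case=> /height_ge_prime. Qed.

Lemma height_ge1P p : height_ge 1 p <->
  prime_ideal p /\ exists2 x, x \in p & x != 0.
Proof.
split=> [[pp [q [qp pq [pq' _]]]]|[pp [x px x0]]]; split=> //.
  apply: contrapT => nex; apply: pq => x px.
  apply: contrapT => qx; apply: nex; exists x => //.
  by apply/eqP => x0; apply: qx; rewrite x0; case: pq' => -[].
exists (pred1 (0 : R) : pred R); split=> [y /[!inE] /eqP->|sp|]; first by case: pp => -[].
  by have := sp x px; rewrite inE (negPf x0).
by split=> //; apply: prime_pred1.
Qed.

Lemma height1_neq0 p : height1 p -> exists2 x, x \in p & x != 0.
Proof. by case=> /height_ge1P[]. Qed.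

Lemma height_dichotomy p x : prime_ideal p -> x \in p -> x != 0 ->
  height1 p \/ height_ge 2 p.
Proof.
move=> pp px x0; have [|h2] := pselect (height_ge 2 p); first by right.
by left; split=> //; apply/height_ge1P; split=> //; exists x.
Qed.

Lemma height1_max p q x : height1 p -> prime_ideal q -> x \in q -> x != 0 ->
  {subset q <= p} -> q = p.
Proof.
move=> [h1 h2] pq qx x0 qp; have pp := height_ge_prime h1.
have pq' : {subset p <= q}.
  apply: contrapT => npq; apply: h2; split=> //; exists q; split=> //.
  by apply/height_ge1P; split=> //; exists x.
by apply/funext => y; apply/idP/idP => [/qp|/pq'].
Qed.

End Height.

Section CommonDenominator.
Variables (R : comNzRingType) (M : lmodType R) (p : {pred R}).
Hypothesis pp : prime_ideal p.

Lemma common_denominator (U V : set M) : sub_fg U -> isub V ->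
    (forall x, U x -> exists2 s, s \notin p & V (s *: x)) ->
  exists2 s, s \notin p & forall x, U x -> V (s *: x).
Proof.
move=> [l ->] sV h.
have {h} : forall x, x \in l -> exists2 s, s \notin p & V (s *: x).
  by move=> x /mem_span/h.
elim: l => [|g l IHl] h.
  by exists 1; [exact: primeN1|move=> x /= ->; rewrite scaler0; apply: isub0].
have [|s ps sl] := IHl; first by move=> x xl; apply: h; rewrite inE xl orbT.
have [s' ps' s'g] := h g (mem_head _ _).
exists (s' * s); first exact: primeMn.
move=> x [a xa]; rewrite -(subrK (a *: g) x) scalerDr; apply: isubD => //.
  by rewrite -scalerA; apply: isubZ => //; apply: sl.
by rewrite scalerA -mulrA mulrC -scalerA; apply: isubZ.
Qed.

End CommonDenominator.

(** Almost integral fractions f / g belong to the ring, with [d] a common denominator of all powers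
    of f / g. Denominators are cleared so that no fraction field appears. *)
Definition completely_integrally_closed (R : idomainType) := forall d f g : R,
  d != 0 -> g != 0 -> (forall n, exists h, d * f ^+ n = g ^+ n * h) ->
  exists h, f = g * h.

Section Valuations.
Variables (R : idomainType) (noethR : noetherian R).
Implicit Types (p : {pred R}) (x y z s u : R).

Add Ring R_ring : (domain_ring_theory R).
Local Ltac rring := ring_in R.

(* Local form of Krull's intersection theorem. *)
Lemma no_infinite_divisibility p c (Q : set R) : prime_ideal p -> c \in p ->
    (forall g, Q g -> g != 0) ->
    (forall g, Q g -> exists s h, [/\ s \notin p, Q h & s * g = c * h]) ->
  forall g, ~ Q g.
Proof.
move=> pp pc Q0 Qdiv g.
pose sat g : set R^o := [set y | exists s b, s \notin p /\ s * y = b * g].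
have satP h : isub (sat h).
  split=> [|a y y' [s [b [ps sy]]] [s' [b' [ps' sy']]]].
    by exists 1, 0; rewrite (primeN1 pp) mulr0 mul0r.
  exists (s * s'), (a * b * s' + s * b'); split; first exact: primeMn.
  have -> : a *: y + y' = a * y + y' by [].
  have -> : s * s' * (a * y + y') = a * s' * (s * y) + s * (s' * y') by rring.
  by rewrite sy sy'; rring.
have [I eI] : exists I, sat g = I by exists (sat g).
have sI : isub I by rewrite -eI; apply: satP.
elim/(noeth_ind noethR): I / sI g eI => I sI IH g eI Qg.
have [s [h [ps Qh sg]]] := Qdiv g Qg.
apply: (IH (sat h) (satP h) _ _ h) => //.
  rewrite -eI => y [s' [b [ps' sy]]]; exists (s' * s), (b * c).
  rewrite primeMn //; split=> //.
  have -> : s' * s * y = s * (s' * y) by rring.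
  by rewrite sy -mulrA -sg; rring.
(* The saturation of h strictly contains that of g: otherwise h would be locally a multiple of g,
   hence of c h, and cancelling h would place an element outside p into p. *)
rewrite -eI => eq; have : sat h h by exists 1, 1; rewrite primeN1.
rewrite -eq => -[s' [b [ps' s'h]]].
have : s * s' * h = b * c * h by rewrite -!mulrA s'h -sg; rring.
move/(mulIf (Q0 _ Qh)) => ss'.
by have := primeMn pp ps ps'; rewrite ss' primeMl.
Qed.

Hypothesis cicR : completely_integrally_closed R.

(* Locally at p, p = (aR : b) for some a in p and b. If (b / a) p were contained
   in p, then b / a would be almost integral; so it contains a unit. *)
Lemma uniformizer p : height1 p -> exists2 c, c \in p &
  forall y, y \in p -> exists u z, u \notin p /\ u * y = c * z.
Proof.
move=> hp; have pp := height1_prime hp; have [a pa a0] := height1_neq0 hp.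
pose sat b : set R^o := [set y | exists s z, s \notin p /\ s * (y * b) = a * z].
have satP b : isub (sat b).
  split=> [|e y y' [s [z [ps sy]]] [s' [z' [ps' sy']]]].
    by exists 1, 0; rewrite (primeN1 pp) !mul0r !mulr0.
  exists (s * s'), (e * s' * z + s * z'); split; first exact: primeMn.
  have -> : e *: y + y' = e * y + y' by [].
  have -> : s * s' * ((e * y + y') * b) =
    e * s' * (s * (y * b)) + s * (s' * (y' * b)) by rring.
  by rewrite sy sy'; rring.
(* A maximal proper [sat b] is prime: if x y lies in it but x and y do not, then [sat (y * b)] is
   proper, contains it, and also contains x. *)
have [b [nb1 pb]] : exists b, ~ sat b 1 /\ prime_ideal (pred_of (sat b)).
  suff max b : ~ sat b 1 -> exists b, ~ sat b 1 /\ prime_ideal (pred_of (sat b)).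
    apply: (max 1) => -[s [z [ps]]]; rewrite !mulr1 => sz.
    by move: ps; rewrite sz primeMr.
  have [I eI] : exists I, sat b = I by exists (sat b).
  have sI : isub I by rewrite -eI; apply: satP.
  elim/(noeth_ind noethR): I / sI b eI => I sI IH b eI nb1.
  have [pb|npb] := pselect (prime_ideal (pred_of (sat b))); first by exists b.
  have [x [y [Ixy [nIx nIy]]]] : exists x y,
      sat b (x * y) /\ ~ sat b x /\ ~ sat b y.
    apply: contrapT => nex; apply: npb; split; first split.
    - by apply/pred_ofP; case: (satP b).
    - by apply/pred_ofP.
    - by move=> e u v /pred_ofP Iu /pred_ofP Iv; apply/pred_ofP; case: (satP b) => _; apply.
    move=> u v /pred_ofP Iuv; apply: contrapT => /negP.
    by rewrite negb_or => /andP[/pred_ofP Iu /pred_ofP Iv]; apply: nex; exists u, v.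
  apply: (IH (sat (y * b)) _ _ _ (y * b)) => //.
  - rewrite -eI => w [s [z [ps sw]]]; exists s, (y * z).
    split=> //; have -> : a * (y * z) = y * (a * z) by rring.
    by rewrite -sw; rring.
  - rewrite -eI => eq; apply: nIx; rewrite eq.
    by case: Ixy => s [z [ps]]; rewrite -mulrA; exists s, z.
  by case=> s [z [ps]]; rewrite mul1r => sz; apply: nIy; exists s, z.
have eP : pred_of (sat b) = p.
  apply: (height1_max hp pb _ a0).
    by apply/pred_ofP; exists 1, b; rewrite mul1r primeN1.
  move=> y /pred_ofP[s [z [ps sy]]]; apply: contraPT isT => py.
  case: nb1; exists (s * y), z; rewrite mul1r -mulrA sy; split=> //.
  exact: primeMn.
have [s ps sb] : exists2 s, s \notin p & forall y, y \in p ->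
    exists z, (s * y) * b = a * z.
  have [||y py|s ps sP] := @common_denominator _ _ p pp
     ([set y | y \in p] : set R^o) ([set y | exists z, y * b = a * z] : set R^o).
  - exact (noeth_fg noethR (prime_isub pp)).
  - split=> [|e y y' [z yz] [z' yz']]; first by exists 0; rewrite mul0r mulr0.
    exists (e * z + z'); rewrite mulrDr -yz' mulrCA -yz mulrA.
    by rewrite -mulrDl.
  - have : y \in pred_of (sat b) by rewrite eP.
    by move=> /pred_ofP[s [z [ps sz]]]; exists s => //; exists z; rewrite -mulrA.
  by exists s.
have sb0 : s * b != 0.
  rewrite mulf_neq0 ?(prime_neq0 pp ps) //.
  apply/eqP => b0; apply: nb1; exists 1, 0; rewrite b0 !mulr0; split=> //.
  exact: primeN1.
have [[c [u [pc pu cu]]]|nex] := pselect (exists c u,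
    [/\ c \in p, u \notin p & (s * c) * b = a * u]).
  exists c => // y /sb[z yz]; exists u, z; split=> //.
  apply: (mulfI a0); apply: (mulfI sb0).
  have -> : s * b * (a * (u * y)) = (s * y * b) * (a * u) by rring.
  by rewrite yz -cu; rring.
case: nb1; have [] := cicR (d := a) (f := s * b) (g := a) a0 a0; last first.
  by move=> h sbh; exists s, h; rewrite mul1r.
(* Multiplication by s b / a now maps p into p. Since the stable object is p itself, the induction
   on n ranges over all y in p; y = a then gives almost integrality with denominator a. *)
move=> n; suff : forall y, y \in p -> exists2 h, h \in p & y * (s * b) ^+ n = a ^+ n * h.
  by case/(_ a pa) => h _ ah; exists h.
elim: n => [|n IHn] y py; first by exists y; rewrite // !expr0 mulr1 mul1r.
have [z yz] := sb y py; have pz : z \in p.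
  by apply: contrapT => /negP npz; apply: nex; exists y, z.
have [h ph zh] := IHn z pz; exists h => //.
have -> : a ^+ n.+1 * h = a * (a ^+ n * h) by rewrite exprS mulrA.
rewrite -zh exprS; move: (_ ^+ n) => e.
have -> : y * (s * b * e) = s * y * b * e by rring.
by rewrite yz; rring.
Qed.

(** The valuation of the local ring at [p], restricted to nonzero elements of [R]. The third clause
    says that it decides divisibility in the local ring; the ultrametric inequality is derived from
    it. *)
Definition is_val p (v : R -> nat) := [/\
  forall x y, x != 0 -> y != 0 -> v (x * y) = (v x + v y)%N,
  forall x, x != 0 -> (v x == 0)%N = (x \notin p),
  forall x y, x != 0 -> y != 0 -> (v x <= v y)%N ->
    exists s a, s \notin p /\ s * y = a * x
  & exists2 c, c != 0 & v c = 1%N].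

Lemma pval_exists p : height1 p -> exists v, is_val p v.
Proof.
move=> hp; have pp := height1_prime hp; have [c pc cP] := uniformizer hp.
have [a pa a0] := height1_neq0 hp.
have c0 : c != 0.
  apply/eqP => c0; have [u [z [pu]]] := cP a pa; rewrite c0 mul0r => /eqP.
  by rewrite mulf_eq0 (negPf a0) (negPf (prime_neq0 pp pu)).
pose ord x n := exists u z, [/\ u \notin p, z \notin p & u * x = c ^+ n * z].
have ex_ord x : x != 0 -> exists n, ord x n.
  move=> x0; apply: contrapT => nx.
  (* An element without an order lies in p and is locally c times another such element, so it could
     be divided by c forever. *)
  apply: (@no_infinite_divisibility p c [set x | x != 0 /\ ~ exists n, ord x n]
     pp pc _ _ x) => // [y []//|y [y0 ny]].
  have py : y \in p.
    apply: contrapT => /negP py; apply: ny; exists 0%N, 1, y.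
    by rewrite primeN1 // expr0.
  have [u [z [pu uy]]] := cP y py; exists u, z; split=> //; split.
    apply/eqP => z0; move/eqP: uy; rewrite z0 mulr0 mulf_eq0 (negPf y0).
    by rewrite (negPf (prime_neq0 pp pu)).
  move=> [n [u' [z' [pu' pz' uz]]]]; apply: ny; exists n.+1, (u' * u), z'.
  by split=> //; [exact: primeMn|rewrite exprS -!mulrA -uz uy mulrCA].
have ord_le x m n : ord x m -> ord x n -> (m <= n)%N.
  move=> [u [z [pu pz ux]]] [u' [z' [pu' pz' ux']]].
  rewrite leqNgt; apply/negP => /subnKC; set k := (m - n.+1)%N => mE.
  have : u * z' * c ^+ n = u' * c * c ^+ k * z * c ^+ n.
    have -> : u * z' * c ^+ n = u * (c ^+ n * z') by rring.
    rewrite -ux' mulrCA ux -mE addSn exprS exprD.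
    by move: (c ^+ n) (c ^+ k) => e1 e2; rring.
  move/(mulIf (expf_neq0 _ c0)) => uz.
  have := primeMn pp pu pz'; rewrite uz.
  by rewrite !(primeM pp) pc !orbT.
pose v x := xget 0%N (ord x).
have vP x : x != 0 -> ord x (v x) by move=> /ex_ord; apply: xgetPex.
have vE x n : x != 0 -> ord x n -> v x = n.
  move=> x0 on; apply/eqP; rewrite eqn_leq; apply/andP.
  by have vx := vP x x0; split; apply: (@ord_le x).
exists v; split.
- move=> x y x0 y0; apply: vE; first exact: mulf_neq0.
  have [u [z [pu pz ux]]] := vP x x0; have [u' [z' [pu' pz' uy]]] := vP y y0.
  exists (u * u'), (z * z'); rewrite !primeMn //; split=> //.
  by rewrite mulrACA ux uy exprD mulrACA.
- move=> x x0; have [u [z [pu pz ux]]] := vP x x0; apply/eqP/idP => [v0|px].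
    move: ux; rewrite v0 expr0 mul1r => ux; apply: contra pz.
    by rewrite -ux; apply: primeMl.
  by apply: vE => //; exists 1, x; rewrite primeN1 // expr0.
- move=> x y x0 y0 lev.
  have [u [z [pu pz ux]]] := vP x x0; have [u' [z' [pu' pz' uy]]] := vP y y0.
  exists (z * u'), (c ^+ (v y - v x) * z' * u); split; first exact: primeMn.
  rewrite -!mulrA uy ux -{1}(subnK lev) exprD.
  by move: (c ^+ _) (c ^+ _) => e1 e2; rring.
- exists c => //; apply: vE => //; exists 1, 1.
  by rewrite primeN1 // mul1r mulr1 expr1.
Qed.

Definition pval p : R -> nat := xget (fun=> 0%N) (is_val p).

Lemma pvalP p : height1 p -> is_val p (pval p).
Proof. by move=> /pval_exists; apply: xgetPex. Qed.

(* [pval p 0] is meaningless; 0 counts as having infinite valuation. *)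
Definition vge p n : set R^o := [set x | x != 0 -> (n <= pval p x)%N].

Section FixedPrime.
Variable p : {pred R}.
Hypothesis hp : height1 p.
Let pp := height1_prime hp.

Lemma pvalM x y : x != 0 -> y != 0 -> pval p (x * y) = (pval p x + pval p y)%N.
Proof. by case: (pvalP hp) => h _ _ _; apply: h. Qed.

Lemma pval_eq0 x : x != 0 -> (pval p x == 0)%N = (x \notin p).
Proof. by case: (pvalP hp) => _ h _ _; apply: h. Qed.

Lemma pval_div x y : x != 0 -> vge p (pval p x) y ->
  exists s a, s \notin p /\ s * y = a * x.
Proof.
move=> x0; have [->|y0 h] := eqVneq y 0.
  by exists 1, 0; rewrite mulr0 mul0r primeN1.
by case: (pvalP hp) => _ _ h' _; apply: h' => //; apply: h.
Qed.

Lemma pval_uniformizer : exists2 c, c != 0 & forall n, pval p (c ^+ n) = n.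
Proof.
have [_ _ _ [c c0 c1]] := pvalP hp; exists c => //; elim=> [|n IHn].
  by apply/eqP; rewrite expr0 pval_eq0 ?oner_eq0 ?primeN1.
by rewrite exprS pvalM ?expf_neq0 // c1 IHn.
Qed.

Lemma vge_unit n s x : s \notin p -> vge p n (s * x) -> vge p n x.
Proof.
move=> ps h x0; have s0 := prime_neq0 pp ps.
have := h (mulf_neq0 s0 x0); rewrite pvalM //.
by have /eqP-> : (pval p s == 0)%N by rewrite pval_eq0.
Qed.

Lemma vgeMl n a x : vge p n x -> vge p n (a * x).
Proof.
move=> h; rewrite /vge /= mulf_eq0 negb_or => /andP[a0 x0].
by rewrite pvalM // (leq_trans (h x0)) ?leq_addl.
Qed.

Lemma vgeM m n x y : vge p m x -> vge p n y -> vge p (m + n) (x * y).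
Proof.
move=> hx hy; rewrite /vge /= mulf_eq0 negb_or => /andP[x0 y0].
by rewrite pvalM // leq_add ?hx ?hy.
Qed.

Lemma vge_le m n x : (m <= n)%N -> vge p n x -> vge p m x.
Proof. by move=> mn h x0; apply: leq_trans mn (h x0). Qed.

(** The ultrametric inequality: the summand of smaller valuation locally divides the other one,
    hence the sum. *)
Lemma isub_vge n : isub (vge p n).
Proof.
split=> [|a x y vx vy]; first by rewrite /vge /= eqxx.
have {a vx x} [x ->] : exists2 z, a *: x = z & vge p n z.
  by exists (a * x) => //; apply: vgeMl.
move=> vx; have [->|x0] := eqVneq x 0; first by rewrite add0r.
have [->|y0] := eqVneq y 0; first by rewrite addr0.
wlog lexy : x y x0 y0 vx vy / (pval p x <= pval p y)%N.
  move=> h; have [/h|/ltnW/h] := leqP (pval p x) (pval p y); first exact.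
  by rewrite addrC; apply.
have [s [b [ps sy]]] := pval_div x0 (fun=> lexy).
apply: (@vge_unit _ s) => //.
have -> : s * (x + y) = (s + b) * x by rewrite mulrDr sy mulrDl.
exact: vgeMl.
Qed.

End FixedPrime.

(** The valuation of an ideal at [p], as an attained minimum over its nonzero elements. *)
Definition vmin p (I : {pred R}) n :=
  (exists x, [/\ x \in I, x != 0 & pval p x = n]) /\
  (forall x, x \in I -> vge p n x).

Lemma vmin_uniq p I m n : vmin p I m -> vmin p I n -> m = n.
Proof.
move=> [[x [Ix x0 vx]] Im] [[y [Iy y0 vy]] In].
apply/eqP; rewrite eqn_leq -{1}vy -{2}vx; apply/andP.
by split; [apply: Im|apply: In].
Qed.

Lemma vmin_exists p (I : {pred R}) x : x \in I -> x != 0 -> exists n, vmin p I n.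
Proof.
move=> Ix x0.
have ex : exists n, `[< exists y, [/\ y \in I, y != 0 & pval p y = n] >].
  by exists (pval p x); apply/asboolP; exists x.
exists (ex_minn ex); case: ex_minnP => n /asboolP nP nmin; split=> // y Iy y0.
by apply: nmin; apply/asboolP; exists y.
Qed.

Lemma vmin_predT p : height1 p -> vmin p predT 0.
Proof.
move=> hp; split=> [|x _ //]; exists 1; rewrite oner_eq0; split=> //.
by apply/eqP; rewrite pval_eq0 ?oner_eq0 ?primeN1 //; apply: height1_prime.
Qed.

Lemma vmin_mul p I J m n : height1 p -> vmin p I m -> vmin p J n ->
  vmin p (ideal_mul I J) (m + n).
Proof.
move=> hp [[x [Ix x0 vx]] Im] [[y [Iy y0 vy]] Jn]; split.
  exists (x * y); rewrite mulf_neq0 // pvalM // vx vy; split=> //.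
  apply/asboolP; exists 1%N, (fun=> 1), (fun=> x), (fun=> y).
  by rewrite big_ord1 mul1r.
move=> _ /asboolP[k [r [a [b [ab ->]]]]].
apply: (isub_sum (M := R^o)) => [|i _]; first exact: isub_vge.
have [Ia Jb] := ab i.
by apply: vgeMl => //; apply: vgeM => //; [apply: Im|apply: Jn].
Qed.

Lemma vmin_height1 p q : height1 p -> height1 q -> vmin p q (q == p).
Proof.
move=> hp hq; have pp := height1_prime hp; have pq := height1_prime hq.
have [->|qp] := eqVneq q p.
  have [c c0 vc] := pval_uniformizer hp; split.
    exists c; rewrite c0; split=> //; last by have := vc 1%N; rewrite expr1.
    have := vc 1%N; rewrite expr1 => vc1; apply: contraTT isT => pc.
    by have := pval_eq0 hp c0; rewrite pc vc1.
  move=> x px x0; rewrite lt0n.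
  by rewrite pval_eq0 // px.
have [x qx px] : exists2 x, x \in q & x \notin p.
  apply: contrapT => nex; move/eqP: qp; apply.
  have [x qx x0] := height1_neq0 hq; apply: (height1_max hp pq qx x0) => y qy.
  by apply: contrapT => /negP py; apply: nex; exists y.
split=> //; exists x; rewrite (prime_neq0 pp px); split=> //; apply/eqP.
by rewrite pval_eq0 ?(prime_neq0 pp px).
Qed.

(** For the lower bound, the ideals [vge p k] form a chain whose steps are witnessed by powers of a
    uniformizer. For the upper bound, every nonzero element below a strict step has larger valuation
    than its witness, which it would otherwise divide locally; so the least valuation grows at each
    step, and it stops at n. *)
Lemma len_vmin p (I : {pred R}) n : height1 p -> isub ([set x | x \in I] : set R^o) ->
  vmin p I n -> len p ([set x | x \in I] : set R^o) setT n.
Proof.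
move=> hp sI [[x [Ix x0 vx]] In]; have pp := height1_prime hp.
split.
  have [c c0 vc] := pval_uniformizer hp.
  suff h m k : (m + k)%N = n -> chain p m ([set x | x \in I] : set R^o) (vge p k).
    by apply: chain_mono (h n 0%N _); rewrite ?addn0.
  elim: m k => [k kn|m IHm k mkn]; first by move: In; rewrite -kn.
  rewrite -/(chain p _ _ _).
  exists (vge p k.+1), (c ^+ k); split.
  - exact: isub_vge.
  - by move=> y; apply: vge_le.
  - by rewrite /vge /= vc.
  - move=> s ps h; have := vge_unit hp ps h (expf_neq0 _ c0).
    by rewrite vc ltnn.
  by apply: IHm; rewrite addnS.
suff h m k (U : set R^o) : U `<=` vge p k ->
    chain p m ([set x | x \in I] : set R^o) U -> (m + k <= n)%N.
  by move=> c; have := h n.+1 0%N setT (fun _ _ _ => isT) c; rewrite addn0 ltnn.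
elim: m k U => [k U Uk IU|m IHm k U Uk [V [y [sV VU Uy nVy cV]]]].
  by rewrite -vx; apply: (Uk x) => //; apply: IU.
have y0 : y != 0.
  apply/eqP => y0; apply: (nVy 1); first exact: primeN1.
  by rewrite y0 scaler0; apply: isub0.
have := IHm (pval p y).+1 V _ cV; rewrite addnS addSn => h.
apply: leq_trans (h _); first by rewrite ltnS leq_add2l; apply: Uk.
move=> z Vz z0; rewrite ltnNge; apply/negP => vzy.
have [s [a [ps sz]]] := pval_div hp z0 (fun=> vzy).
apply: (nVy s) => //; have -> : s *: y = a * z by [].
by apply: (isubZ (M := R^o)).
Qed.

End Valuations.

(** * Characteristic ideals and lengths *)

Section IdealProducts.
Variable R : comNzRingType.
Implicit Types (I J K p q : {pred R}) (l : seq {pred R}).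

Lemma isub_ideal_mul I J : isub ([set x | x \in ideal_mul I J] : set R^o).
Proof.
split=> [|c x y].
  apply/asboolP; exists 0%N, (fun=> 0), (fun=> 0), (fun=> 0).
  by rewrite big_ord0; split=> // -[].
move=> /asboolP[n [r [a [b [ab ->]]]]] /asboolP[m [s [u [v [uv ->]]]]].
apply/asboolP; pose g (w : 'I_n -> R) (z : 'I_m -> R) k :=
  match split k with inl i => w i | inr j => z j end.
exists (n + m)%N, (g (fun i => c * r i) s), (g a u), (g b v); split=> [k|].
  by rewrite /g; case: split.
rewrite big_split_ord /= scaler_sumr; congr (_ + _); apply: eq_bigr => i _.
  by rewrite /g (unsplitK (inl i)) /GRing.scale /= !mulrA.
by rewrite /g (unsplitK (inr i)).
Qed.

Lemma mem_ideal_mul I J a b : a \in I -> b \in J -> a * b \in ideal_mul I J.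
Proof.
move=> Ia Jb; apply/asboolP; exists 1%N, (fun=> 1), (fun=> a), (fun=> b).
by rewrite big_ord1 mul1r.
Qed.

Lemma ideal_mul_min I J (U : set R^o) : isub U ->
    (forall a b, a \in I -> b \in J -> U (a * b)) ->
  forall x, x \in ideal_mul I J -> U x.
Proof.
move=> sU h x /asboolP[n [r [a [b [ab ->]]]]]; apply: (isub_sum (M := R^o)) => // i _.
by have [Ia Jb] := ab i; apply: (isubZ (r i) sU (h _ _ Ia Jb)).
Qed.

Lemma pred_eqP I J : (forall x, x \in I -> x \in J) ->
  (forall x, x \in J -> x \in I) -> I = J.
Proof. by move=> IJ JI; apply/funext => x; apply/idP/idP => [/IJ|/JI]. Qed.

Lemma ideal_mulC I J : ideal_mul I J = ideal_mul J I.
Proof.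
by apply: pred_eqP; apply: ideal_mul_min; try exact: isub_ideal_mul;
  move=> a b Ia Jb /=; rewrite mulrC mem_ideal_mul.
Qed.

Lemma ideal_mulA I J K : ideal_mul I (ideal_mul J K) = ideal_mul (ideal_mul I J) K.
Proof.
apply: pred_eqP; apply: ideal_mul_min; try exact: isub_ideal_mul.
  move=> a b Ia Jb.
  apply: (@ideal_mul_min J K [set b | a * b \in ideal_mul (ideal_mul I J) K]) Jb.
    have [h0 hP] := isub_ideal_mul (ideal_mul I J) K.
    split=> [|c x y hx hy] /=; first by rewrite mulr0.
    by have := hP c _ _ hx hy; rewrite /= mulrDr mulrCA.
  by move=> x y Jx Ky /=; rewrite mulrA !mem_ideal_mul.
move=> a b Ia Kb.
apply: (@ideal_mul_min I J [set a | a * b \in ideal_mul I (ideal_mul J K)]) Ia.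
  have [h0 hP] := isub_ideal_mul I (ideal_mul J K).
  split=> [|c x y hx hy] /=; first by rewrite mul0r.
  by have := hP c _ _ hx hy; rewrite /GRing.scale /= mulrDl mulrA.
by move=> x y Jx Ky /=; rewrite -mulrA !mem_ideal_mul.
Qed.

Lemma ideal_mulT I : isub ([set x | x \in I] : set R^o) -> ideal_mul predT I = I.
Proof.
move=> sI; apply: pred_eqP => [|x Ix]; last by rewrite -[x]mul1r mem_ideal_mul.
by apply: (ideal_mul_min sI) => a b _ Ib; apply: (isubZ a sI Ib).
Qed.

(** Writing characteristic ideals as products over lists of primes reduces their equality to a
    comparison of multiplicities. *)
Definition iprod l : {pred R} := foldr (@ideal_mul R) predT l.

Lemma isub_iprod l : isub ([set x | x \in iprod l] : set R^o).
Proof. by case: l => [|p l]; [|apply: isub_ideal_mul]. Qed.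

Lemma iprod_cat l l' : iprod (l ++ l') = ideal_mul (iprod l) (iprod l').
Proof.
elim: l => /= [|p l ->]; first by rewrite ideal_mulT //; apply: isub_iprod.
by rewrite ideal_mulA.
Qed.

Lemma iprod_perm l l' : perm_eq l l' -> iprod l = iprod l'.
Proof.
elim: l l' => [|p l IHl] l' ll'.
  by move: ll'; rewrite perm_sym => /perm_nilP->.
have pl' : p \in l' by rewrite -(perm_mem ll') mem_head.
case/splitPr: pl' ll' => l1 l2; rewrite perm_sym perm_catC /= perm_cons => ll'.
rewrite iprod_cat [LHS]/= [iprod (p :: l2)]/= (IHl (l2 ++ l1)) 1?perm_sym //.
by rewrite iprod_cat ideal_mulA ideal_mulC.
Qed.

Definition prime_list n (p : 'I_n -> {pred R}) (e : 'I_n -> nat) : seq {pred R} :=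
  \big[cat/[::]]_(i < n) nseq (e i) (p i).

Lemma ideal_exp_iprod p e : ideal_exp p e = iprod (nseq e p).
Proof. by elim: e => //= e ->. Qed.

Lemma isub_ideal_exp p e : isub ([set x | x \in ideal_exp p e] : set R^o).
Proof. by rewrite ideal_exp_iprod; apply: isub_iprod. Qed.

Lemma ideal_expMl p e a x : x \in ideal_exp p e -> a * x \in ideal_exp p e.
Proof. exact: (isubZ a (isub_ideal_exp p e)). Qed.

Lemma ideal_prod_iprod n (p : 'I_n -> {pred R}) e :
  ideal_prod (fun i => ideal_exp (p i) (e i)) = iprod (prime_list p e).
Proof.
rewrite /ideal_prod /prime_list; elim: n p e => [|n IHn] p e.
  by rewrite !big_ord0.
by rewrite !big_ord_recl iprod_cat -ideal_exp_iprod IHn.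
Qed.

Lemma count_prime_list n (p : 'I_n -> {pred R}) e q :
  count_mem q (prime_list p e) = (\sum_(i < n) (p i == q) * e i)%N.
Proof.
rewrite /prime_list (@big_morph _ _ (count_mem q) 0%N addn [::] cat) => [|s s'|//].
2: by rewrite count_cat.
by apply: eq_bigr => i _; rewrite count_nseq.
Qed.

Lemma mem_prime_list n (p : 'I_n -> {pred R}) e q :
  q \in prime_list p e -> exists i, q = p i.
Proof.
rewrite -has_pred1 has_count count_prime_list => h; apply: contrapT => nex.
move: h; rewrite big1 // => i _; case: eqP => // piq; case: nex.
by exists i.
Qed.

End IdealProducts.

Lemma submod_ann (R : comNzRingType) (M : lmodType R) (U : submodClosed M) r x :
  x \in U -> (forall m : submod U, r *: m = 0) -> r *: x = 0.
Proof. by move=> Ux h; have := congr1 val (h (SubMod Ux)); rewrite linearZ. Qed.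

Section Lengths.
Variables (R : idomainType) (noethR : noetherian R).
Implicit Types (M N : lmodType R) (p q : {pred R}).

Lemma fin_gen_ann M : fin_gen M -> torsion M ->
  exists2 r : R, r != 0 & forall m : M, r *: m = 0.
Proof.
move=> /fin_genP[l lE] tM.
have [r r0 rl] : exists2 r : R, r != 0 & forall m : M, span l m -> r *: m = 0.
  elim: {lE} l => [|g l [r r0 rl]].
    by exists 1; [exact: oner_neq0|move=> m ->; rewrite scaler0].
  have [s s0 sg] := tM g; exists (r * s); first exact: mulf_neq0.
  move=> m [a /rl ra]; rewrite -(subrK (a *: g) m) scalerDr [r * s]mulrC -scalerA ra.
  by rewrite scaler0 add0r scalerA -mulrA mulrC -scalerA sg scaler0.
by exists r => // m; apply: rl; rewrite -lE.
Qed.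

Lemma pseudo_null_local M q : pseudo_null M -> height1 q ->
  exists2 r, r \notin q & forall m : M, r *: m = 0.
Proof.
move=> [_ _ hM] hq; apply: contrapT => nex; case: (hq) => _; apply.
apply: hM; first exact: height1_prime.
move=> r /asboolP rM; apply: contrapT => /negP rq; apply: nex; by exists r.
Qed.

(** A prime containing the annihilator is nonzero, so it has height 1 or at least 2. In the first
    case a common denominator kills [M] and lies outside the prime, a contradiction. *)
Lemma pseudo_nullI M : fin_gen M -> torsion M ->
    (forall q, height1 q -> forall m : M, exists2 s, s \notin q & s *: m = 0) ->
  pseudo_null M.
Proof.
move=> fgM tM loc; split=> // q pq Aq.
have [r r0 rM] := fin_gen_ann fgM tM.
have qr : r \in q by apply: Aq; apply/asboolP.
have [hq|//] := height_dichotomy pq qr r0.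
have [m _|s qs sM] := common_denominator pq ((fin_genP M).1 fgM) (isub_zero M).
  by have [s qs sm] := loc q hq m; exists s.
by move: qs; rewrite Aq //; apply/asboolP => m; apply: sM.
Qed.

(** Kernel and cokernel have length 0 at [q], and the quotient by the kernel is isomorphic to the
    image. *)
Lemma pseudo_iso_len M N (f : {linear M -> N}) q n : pseudo_iso f -> height1 q ->
  len q [set 0 : M] setT n -> len q [set 0 : N] setT n.
Proof.
move=> [kf cf] hq; have pq := height1_prime hq.
have [r qr rk] := pseudo_null_local kf hq.
have [s qs sc] := pseudo_null_local cf hq.
pose K : set M := [set x | f x = 0]; pose I : set N := [set y | exists x, f x = y].
have sK : isub K.
  by split=> [|a x y]; rewrite /K /= ?linear0 // linearP => -> ->; rewrite scaler0 addr0.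
have sI : isub I.
  split=> [|a _ _ [x <-] [y <-]]; first by exists 0; rewrite linear0.
  by exists (a *: x + y); rewrite linearP.
move=> /(len_split pq (isub_zero M) sK (isubT M)) [].
- by move=> x ->; apply: isub0.
- by [].
move=> a [b [<- la lb]]; rewrite addnC.
have -> : b = 0%N.
  apply: len_uniq lb _; apply/len0P => //; [exact: isub_zero|by move=> x ->; apply: isub0|].
  move=> x Kx; exists r => //.
  by apply: (submod_ann _ rk); apply/eqP.
apply: (len_add pq (isub_zero N) sI (isubT N)) => //.
- by move=> x ->; apply: isub0.
- apply/len0P => // y _; exists s => //.
  have := sc (quotmod_proj (imm f) y); rewrite -linearZ -[0](linear0 (quotmod_proj (imm f))).
  by move=> /quotmod_projP; rewrite subr0 => /asboolP.
apply: (len_corr (G := fun x y => f x = y)) la => //.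
- by move=> c x x' y y' <- <-; rewrite linearP.
- exact: isub_zero.
- by move=> x ->; apply: isub0.
- by move=> x _; exists (f x) => //; exists x.
- by move=> y [x <-]; exists x.
- by move=> x y _ _ <-.
Qed.

(** A nonzero prime other than [q] is not contained in [q], so some element of it is invertible at
    [q] and kills the quotient locally. The boolean is read as the length 0 or 1. *)
Lemma len_prime_cyclic M (W : set M) x (r : R) q : isub W ->
    prime_ideal (pred_of (colon W x)) -> r != 0 -> W (r *: x) -> height1 q ->
  len q W (sadd W (span [:: x])) (pred_of (colon W x) == q).
Proof.
move=> sW pI r0 Wr hq; have pq := height1_prime hq.
have [eI|nI] := eqVneq (pred_of (colon W x)) q.
  apply: len_cyclic => //; apply/seteqP; split=> a.
    by move=> Wa; rewrite /= -eI; apply/pred_ofP.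
  by rewrite /= -eI => /pred_ofP.
have [s Is qs] : exists2 s, W (s *: x) & s \notin q.
  apply: contrapT => nex; move/eqP: nI; apply.
  apply: (height1_max (x := r) hq pI) => //; first exact/pred_ofP.
  by move=> s /pred_ofP Is; apply: contrapT => /negP qs; apply: nex; exists s.
apply/len0P => //; first exact: sadd_subl (isub_span _).
move=> y [w Ww [a ya]]; exists s => //.
have -> : y = w + a *: x by apply/eqP; rewrite -subr_eq0 opprD addrA; apply/eqP.
by rewrite scalerDr scalerA mulrC -scalerA; apply: isubD => //; apply: isubZ.
Qed.

(** The list collects the height 1 primes among the factors of a devissage. It shows that the
    lengths at height 1 primes are finite and that almost all of them vanish. *)
Lemma support_list M : fin_gen M -> torsion M -> exists L : seq {pred R},
  (forall q, q \in L -> height1 q) /\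
  (forall q, height1 q -> len q [set 0 : M] setT (count_mem q L)).
Proof.
move=> fgM tM; have [r r0 rM] := fin_gen_ann fgM tM.
move/fin_genP: fgM => [l lE].
pose P (W U : set M) := exists L : seq {pred R},
  (forall q, q \in L -> height1 q) /\
  (forall q, height1 q -> len q W U (count_mem q L)).
suff : P [set 0] (sadd [set 0] (span l)).
  have -> // : sadd [set 0] (span l) = [set: M].
  by apply/seteqP; split=> // x _; apply: sadd_subr => //; [exact: isub_zero|rewrite -lE].
apply: (devissage noethR); last exact: isub_zero.
- by move=> W sW; exists [::]; split=> // q hq; apply: len_id; first exact: height1_prime.
- move=> W V U sW sV sU WV VU [L [hL lL]] [L' [hL' lL']]; exists (L' ++ L); split.
    by move=> q; rewrite mem_cat => /orP[/hL'|/hL].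
  move=> q hq; rewrite count_cat; apply: (len_add _ sW sV sU) => //.
  + exact: height1_prime.
  + exact: lL'.
  + exact: lL.
move=> W x sW pI.
have Wr : W (r *: x) by rewrite rM; apply: isub0.
have Ir : r \in pred_of (colon W x) by apply/pred_ofP.
have [h1|h2] := height_dichotomy pI Ir r0.
  exists [:: pred_of (colon W x)]; split=> [q|q hq]; first by rewrite inE => /eqP->.
  by rewrite /= addn0; apply: len_prime_cyclic r0 _ _.
exists [::]; split=> // q hq; rewrite [count_mem _ _]/=.
have := len_prime_cyclic sW pI r0 Wr hq; case: eqP => // eq.
by case: hq => _; rewrite -eq.
Qed.

Hypothesis cicR : completely_integrally_closed R.

Lemma vmin_iprod p l : height1 p -> (forall q, q \in l -> height1 q) ->
  vmin p (iprod l) (count_mem p l).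
Proof.
move=> hp; elim: l => [|q l IHl] hl; first exact: vmin_predT.
rewrite /=; apply: vmin_mul => //; last first.
  by apply: IHl => q' q'l; apply: hl; rewrite inE q'l orbT.
by apply: vmin_height1 => //; apply: hl; apply: mem_head.
Qed.

(** The vectors supported on the first k coordinates filter the module. The successive quotients are
    R / p^e, whose length at [q] is the valuation of p^e. *)
Lemma len_elementary n (p : 'I_n -> {pred R}) (e : 'I_n -> nat) q :
    (forall i, height1 (p i)) -> height1 q ->
  len q [set 0 : elementary p e] setT (count_mem q (prime_list p e)).
Proof.
move=> hp hq; have pq := height1_prime hq.
pose U k : set (elementary p e) := [set x | forall i : 'I_n, (k <= i)%N -> dsum_proj x i = 0].
have sU k : isub (U k).
  split=> [i //|a x y xk yk i ki] /=.
  by rewrite -[LHS]/(a *: dsum_proj x i + dsum_proj y i) xk // yk // scaler0 addr0.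
have U0 : U 0%N = [set 0].
  apply/seteqP; split=> [x xU|_ -> i //]; apply: dsumP => i; exact: xU.
have Un : U n = setT.
  by apply/seteqP; split=> // x _ i; rewrite leqNgt ltn_ord.
rewrite count_prime_list -Un -U0.
suff h k : (k <= n)%N -> len q (U 0%N) (U k) (\sum_(i < n | (i < k)%N) (p i == q) * e i)%N.
  have := h n (leqnn n); rewrite (eq_bigl xpredT) // => i; exact: ltn_ord.
elim: k => [_|k IHk kn]; first by rewrite big1 //; apply: len_id.
have US : U k `<=` U k.+1 by move=> x xk i ki; apply: xk; apply: ltnW.
have U0k : U 0%N `<=` U k by move=> x xk i ki; apply: xk.
pose i0 := Ordinal kn.
have -> : (\sum_(i < n | (i < k.+1)%N) (p i == q) * e i =
    (p i0 == q) * e i0 + \sum_(i < n | (i < k)%N) (p i == q) * e i)%N.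
  rewrite (bigD1 i0) //=; congr (_ + _)%N; apply: eq_bigl => i.
  by rewrite ltnS -val_eqE /= andbC -ltn_neqAle.
apply: (len_add pq (sU _) (sU k) (sU _)) => //; last exact/IHk/ltnW.
have li : len q ([set x | x \in ideal_exp (p i0) (e i0)] : set R^o) setT ((p i0 == q) * e i0)%N.
  apply: len_vmin => //.
    by rewrite ideal_exp_iprod; apply: isub_iprod.
  have -> : ((p i0 == q) * e i0)%N = count_mem q (nseq (e i0) (p i0)).
    by rewrite count_nseq.
  rewrite ideal_exp_iprod.
  by apply: vmin_iprod => // q'; rewrite mem_nseq => /andP[_ /eqP->].
pose pr := quotmod_proj (ideal_exp (p i0) (e i0) : {pred R^o}).
apply: (len_corr (G := fun (a : R^o) x => dsum_proj x i0 = pr a)) li => //.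
- move=> a x x' y y' yx yx'.
  by rewrite -[LHS]/(a *: dsum_proj y i0 + dsum_proj y' i0) yx yx' /pr linearP.
- by rewrite ideal_exp_iprod; apply: isub_iprod.
- move=> a _.
  pose x : elementary p e := DSum (fun i =>
    if i == i0 then quotmod_proj (ideal_exp (p i) (e i) : {pred R^o}) a else 0).
  exists x => /=; last by rewrite eqxx.
  by move=> i ki /=; case: eqP => // ii; move: ki; rewrite ii /= ltnn.
- move=> x Ux; exists (repr (dsum_proj x i0)) => //.
  by rewrite /pr quotmod_projK.
- move=> a x _ Ux xa; split=> [Ia i ki|/(_ i0 (leqnn _))].
    have [ii|ii] := eqVneq i i0.
      rewrite ii xa -(linear0 (quotmod_proj (ideal_exp (p i0) (e i0) : {pred R^o}))).
      by apply/quotmod_projP; rewrite subr0.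
    apply: Ux; rewrite ltn_neqAle ki andbT; apply: contra ii => /eqP ki'.
    by apply/eqP/val_inj.
  rewrite xa -(linear0 (quotmod_proj (ideal_exp (p i0) (e i0) : {pred R^o}))).
  by move=> /quotmod_projP; rewrite subr0.
Qed.

(** A pseudo-isomorphism preserves lengths, so the multiplicities of the primes are forced; this
    gives the uniqueness half of the structure theorem. *)
Lemma char_ideal_iprod M I : is_char_ideal M I -> exists L : seq {pred R},
  [/\ forall q, q \in L -> height1 q, I = iprod L &
    forall q n, height1 q -> len q [set 0 : M] setT n -> n = count_mem q L].
Proof.
move=> [n [p [e [f [hp _ isof ->]]]]]; exists (prime_list p e); split.
- by move=> q /mem_prime_list[i ->].
- exact: ideal_prod_iprod.
move=> q m hq lm; apply: (len_uniq (pseudo_iso_len isof hq lm)).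
exact: len_elementary.
Qed.

End Lengths.

(** * Structure theorem *)

Lemma choice2 (T U : Type) (P Q : T -> U -> Prop) :
  (forall x, exists2 y, P x y & Q x y) ->
  exists2 f, forall x, P x (f x) & forall x, Q x (f x).
Proof.
move=> h; have /choice[f fP] : forall x, exists y, P x y /\ Q x y.
  by move=> x; have [y] := h x; exists y.
by exists f => x; case: (fP x).
Qed.

Lemma common_multiplier (R : comNzRingType) (p : {pred R}) n (P : 'I_n -> R -> Prop) :
    prime_ideal p -> (forall i s a, P i s -> P i (a * s)) ->
    (forall i, exists2 s, s \notin p & P i s) ->
  exists2 s, s \notin p & forall i, P i s.
Proof.
move=> pp PM /choice2[s ps Ps]; exists (\prod_i s i).
  by apply: prime_prodn => // i _; apply: ps.
by move=> i; rewrite (bigD1 i) //= mulrC; apply: PM.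
Qed.

Section LocalDiagonal.
Variables (R : idomainType) (noethR : noetherian R).
Hypothesis cicR : completely_integrally_closed R.
Variable p : {pred R}.
Hypothesis hp : height1 p.
Let pp : prime_ideal p := height1_prime hp.

(* Column operations, invertible at p, bring a row of minimal valuation to the
   form (c, 0, ..., 0). *)
Lemma clear_row n (x : 'rV[R]_(1 + n)) j : x 0 j != 0 ->
    (forall i, vge p (pval p (x 0 j)) (x 0 i)) ->
  exists2 Q : 'M[R]_(1 + n), \det Q \notin p & x *m Q = row_mx (x 0 j)%:M 0.
Proof.
move=> xj0 xmin.
have [s ps sx] : exists2 s, s \notin p & forall i, exists a, s * x 0 i = a * x 0 j.
  apply: (common_multiplier pp) => [i s a [b sb]|i].
    by exists (a * b); rewrite -!mulrA sb.
  by have [s [a [ps sa]]] := pval_div noethR cicR hp xj0 (xmin i); exists s => //; exists a.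
have [x' x'def x'E] : exists2 x', x' = x *m perm_mx (tperm (lshift n ord0) j) &
    forall i, x' 0 i = x 0 (tperm (lshift n ord0) j i).
  eexists; [reflexivity|move=> i].
  by rewrite -[in LHS]tpermV -col_permE mxE.
have /choice[a aE] : forall i : 'I_n, exists a, s * x' 0 (rshift 1 i) = a * x 0 j.
  by move=> i; rewrite x'E; apply: sx.
have x'E2 : x' = row_mx (x 0 j)%:M (rsubmx x').
  rewrite -[LHS]hsubmxK; congr row_mx; apply/rowP => i.
  by rewrite !mxE !ord1 x'E tpermL mulr1n.
(* The transposition moves the pivot to the front; the block matrix multiplies the other columns by
   s and subtracts [a i] times the pivot column. The determinant is s ^+ n up to sign. *)
exists (perm_mx (tperm (lshift n ord0) j) *m
   block_mx 1%:M (- \row_i a i) 0 s%:M).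
  rewrite det_mulmx det_perm det_ublock det1 mul1r det_scalar.
  apply: primeMn; [exact: pp| |exact: prime_expn].
  rewrite -signr_odd; case: (odd _); rewrite ?expr0 ?expr1; last exact: primeN1.
  by apply/negP => /(primeMl pp (-1)); rewrite mulrNN mulr1; apply/negP/primeN1.
rewrite mulmxA -x'def x'E2 mul_row_block mulmx1 mulmx0 addr0; congr row_mx.
apply/rowP => i; rewrite mulmxN mul_mx_scalar mul_scalar_mx !mxE aE.
by rewrite mulrC addNr.
Qed.

(* Elementary divisors of the cokernel of S, up to elements prime to p. *)
Lemma local_diagonal n (S : set 'rV[R]_n) r : isub S -> r != 0 ->
    (forall x, S (r *: x)) ->
  exists (Q : 'M[R]_n) (d : 'I_n -> R), [/\ \det Q \notin p, forall i, d i != 0 &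
    forall x, (exists2 s, s \notin p & S (s *: x)) <->
              (forall i, vge p (pval p (d i)) ((x *m Q) 0 i))].
Proof.
move=> + r0; elim: n S => [|n IHn] S sS Sr.
  exists 1%:M, (fun=> 1); split=> [|i|x]; rewrite ?det1 ?oner_eq0 //.
    exact: primeN1.
  split=> [_ []|_] //; exists 1; first exact: primeN1.
  by rewrite [x]thinmx0 scaler0; apply: isub0.
rewrite -[n.+1]/(1 + n)%N in S sS Sr *.
(* The pivot has least valuation among all nonzero entries of all vectors of [S]; the multiples of r
   provide such entries. *)
have [x [j [Sx xj0 xmin]]] : exists x j, [/\ S x, x 0 j != 0 &
    forall y i, S y -> vge p (pval p (x 0 j)) (y 0 i)].
  pose P m := `[< exists x j, [/\ S x, x 0 j != 0 & pval p (x 0 j) = m] >].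
  have ex : exists m, P m.
    exists (pval p r); apply/asboolP; exists (r *: delta_mx 0 0), 0; split=> //.
      by rewrite !mxE mulr1.
    by rewrite !mxE mulr1.
  case: (ex_minnP ex) => m /asboolP[x [j [Sx xj0 xm]]] mmin.
  exists x, j; split=> // y i Sy yi0; rewrite xm; apply: mmin.
  by apply/asboolP; exists y, i.
have [//|i|Q1 pQ1 xQ1] := @clear_row n x j; first exact: xmin.
set c := x 0 j in xQ1 xj0 xmin.
(* [S] in the new coordinates. The adjugate replaces the inverse of [Q1], at the price of the factor
   \det Q1, which is prime to p. *)
pose S2 (z : 'rV[R]_(1 + n)) := S (z *m \adj Q1).
have sS2 : isub S2.
  split=> [|a z z' h h']; first by rewrite /S2 mul0mx; apply: isub0.
  by rewrite /S2 mulmxDl -scalemxAl; apply: isubP.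
have S2Q y : S2 (y *m Q1) = S (\det Q1 *: y).
  by rewrite /S2 -mulmxA mul_mx_adj mul_mx_scalar.
have S2x : S2 (row_mx c%:M 0) by rewrite -xQ1 S2Q; apply: isubZ.
pose S' : set 'rV[R]_n := [set z | S2 (row_mx 0 z)].
have sS' : isub S'.
  split=> [|a z z' Sz Sz']; first by rewrite /S' /= row_mx0; apply: isub0.
  have := isubP a sS2 Sz Sz'; rewrite scale_row_mx add_row_mx scaler0 addr0.
  exact.
have [|Q' [d' [pQ' d'0 Q'P]]] := IHn S' sS'.
  move=> z; rewrite /S' /=.
  have -> : row_mx 0 (r *: z) = r *: row_mx 0 z :> 'rV_(1 + n).
    by rewrite scale_row_mx scaler0.
  by rewrite /S2 -scalemxAl; apply: Sr.
exists (Q1 *m (@block_mx R 1 n 1 n 1%:M 0 0 Q')),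
  (fun i => match split (i : 'I_(1 + n)) with inl _ => c | inr k => d' k end).
split.
- by rewrite det_mulmx det_ublock det1 mul1r; apply: primeMn.
- by move=> i; case: split.
move=> y.
have [z0 [z' zE]] : exists z0 z', y *m Q1 = row_mx z0%:M z'.
  exists ((y *m Q1) 0 (lshift n 0)), (rsubmx (y *m Q1)).
  rewrite -[LHS]hsubmxK; congr row_mx.
  by apply/rowP => i; rewrite ord1 [LHS]mxE [RHS]mxE mulr1n.
have yQE : y *m (Q1 *m (@block_mx R 1 n 1 n 1%:M 0 0 Q')) = row_mx z0%:M (z' *m Q').
  by rewrite mulmxA zE mul_row_block mulmx1 !mulmx0 addr0 add0r.
have yQl : (y *m (Q1 *m (@block_mx R 1 n 1 n 1%:M 0 0 Q'))) 0 (lshift n 0) = z0.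
  by rewrite yQE row_mxEl mxE mulr1n.
have yQr k : (y *m (Q1 *m (@block_mx R 1 n 1 n 1%:M 0 0 Q'))) 0 (rshift 1 k) = (z' *m Q') 0 k.
  by rewrite yQE row_mxEr.
(* Going back to the old coordinates expresses \det Q1 * (s * z0) through entries of a vector of
   [S], where the pivot is minimal. *)
have minS2 s : S2 (s *: row_mx z0%:M z') -> vge p (pval p c) (s * z0).
  move=> h; apply: (@vge_unit _ noethR cicR p hp _ (\det Q1)) => //.
  have -> : \det Q1 * (s * z0) = ((s *: row_mx z0%:M z') *m \adj Q1 *m Q1) 0 (lshift n 0).
    rewrite -mulmxA mul_adj_mx mul_mx_scalar scalerA scale_row_mx row_mxEl.
    by rewrite !mxE mulr1n mulrA.
  rewrite mxE; apply: (isub_sum (M := R^o)) => [|i _]; first exact: isub_vge.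
  by rewrite mulrC; apply: vgeMl => //; apply: xmin.
split.
  move=> [s ps Ssy].
  have S2s : S2 (s *: row_mx z0%:M z').
    by rewrite -zE scalemxAl S2Q; apply: isubZ.
  have vz0 : vge p (pval p c) z0 by apply: vge_unit (minS2 _ S2s).
  have [s' [a [ps' sa]]] := pval_div noethR cicR hp xj0 vz0.
  have /Q'P h : exists2 s, s \notin p & S' (s *: z').
    exists (s' * s); first exact: primeMn.
    rewrite /S' /=.
    have -> : row_mx 0 ((s' * s) *: z') =
       s' *: (s *: row_mx z0%:M z') + (- (s * a)) *: row_mx c%:M 0.
      rewrite !scale_row_mx !scalerA add_row_mx scaler0 addr0; congr row_mx.
      apply/rowP => i; rewrite !ord1 !mxE !mulr1n mulNr -[s * a * c]mulrA -sa.
      by rewrite mulrCA mulrA subrr.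
    by apply: isubD => //; apply: isubZ.
  move=> i; rewrite -[i]splitK; case: (split i) => k; rewrite [unsplit _]/=.
    by rewrite ord1 yQl (unsplitK (inl 0)).
  by rewrite yQr (unsplitK (inr k)).
move=> h.
have vz0 : vge p (pval p c) z0.
  by have := h (lshift n 0); rewrite (unsplitK (inl 0)) yQl.
have [s' [a [ps' sa]]] := pval_div noethR cicR hp xj0 vz0.
have [s ps Ss] : exists2 s, s \notin p & S' (s *: z').
  by apply/Q'P => k; have := h (rshift 1 k); rewrite (unsplitK (inr k)) yQr.
exists (\det Q1 * (s * s')); first by do !apply: primeMn.
rewrite -scalerA -S2Q -scalemxAl zE.
have -> : (s * s') *: row_mx z0%:M z' =
    s' *: row_mx 0 (s *: z') + (s * a) *: row_mx c%:M 0.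
  rewrite !scale_row_mx !scalerA add_row_mx !scaler0 addr0 add0r; congr row_mx.
    by apply/rowP => i; rewrite !ord1 !mxE !mulr1n -!mulrA sa.
  by rewrite mulrC.
by apply: isubD => //; apply: isubZ.
Qed.

(** The ideal [vge p e] is the symbolic power of [p]. It is locally generated by c ^+ e with c in
    [p], and being finitely generated it is carried by a single multiplier into the ordinary power,
    the one that occurs in elementary modules. *)
Lemma symbolic_power e : exists2 u, u \notin p &
  forall x, vge p e x -> u * x \in ideal_exp p e.
Proof.
have sI := isub_ideal_exp p e.
have [c c0 vc] := pval_uniformizer noethR cicR hp.
have pc : c \in p.
  have := pval_eq0 noethR cicR hp c0; have := vc 1%N; rewrite expr1 => ->.
  by move/esym/negbFE.
have ce : c ^+ e \in ideal_exp p e.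
  by elim: e {sI} => // e IHe; rewrite exprS; apply: mem_ideal_mul.
have fg := noeth_fg noethR (isub_vge noethR cicR hp e).
have [x vx|u pu uP] := common_denominator pp fg sI; last by exists u; [|exact: uP].
have [||s [a [ps sa]]] := @pval_div _ noethR cicR p hp (c ^+ e) x.
- exact: expf_neq0.
- by rewrite vc.
exists s => //; have := isubZ a sI ce.
by rewrite /= -[a *: _]/(a * c ^+ e) -sa.
Qed.

(** A pair (e, h) of the list stands for the linear map from [M] to R / p^e represented by h. The
    three clauses say that these maps are linear and that jointly they are injective and surjective
    at [p]. Representatives in [R] give all of them the same type. *)
Lemma local_structure (M : lmodType R) : fin_gen M -> torsion M ->
  exists l : seq (nat * (M -> R)), [/\
    forall t, t \in l -> (0 < t.1)%N /\ forall a x y,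
      t.2 (a *: x + y) - (a * t.2 x + t.2 y) \in ideal_exp p t.1,
    forall m, (forall t, t \in l -> t.2 m \in ideal_exp p t.1) ->
      exists2 s, s \notin p & s *: m = 0 &
    forall c : nat * (M -> R) -> R, exists s m, s \notin p /\
      forall t, t \in l -> t.2 m - s * c t \in ideal_exp p t.1].
Proof.
move=> fgM tM; have [r r0 rM] := fin_gen_ann fgM tM.
have [n [g gP]] := fgM.
pose cmb (x : 'rV[R]_n) := \sum_i x 0 i *: g i.
have cmbP a x y : cmb (a *: x + y) = a *: cmb x + cmb y.
  rewrite /cmb scaler_sumr -big_split; apply: eq_bigr => i _.
  by rewrite !mxE scalerDl scalerA.
have /choice[co coK] : forall m, exists x, cmb x = m.
  move=> m; have [c ->] := gP m; exists (\row_i c i).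
  by apply: eq_bigr => i _; rewrite mxE.
pose S : set 'rV[R]_n := [set x | cmb x = 0].
have cmb0 : cmb 0 = 0 by rewrite /cmb big1 // => i _; rewrite mxE scale0r.
have sS : isub S by split=> // a x y; rewrite /S /= cmbP => -> ->; rewrite scaler0 addr0.
have Sr x : S (r *: x) by rewrite /S /= -[_ *: _]addr0 cmbP rM cmb0 addr0.
have [Q [d [pQ d0 QP]]] := local_diagonal sS r0 Sr.
have /choice2[u pu uP] := symbolic_power.
pose e i := pval p (d i).
(* The choice [co] of coordinates is linear only modulo the relations [S]; the factor [u (e i)]
   turns the resulting congruences modulo the symbolic power into congruences modulo p^e. *)
pose t i : nat * (M -> R) := (e i, fun m => u (e i) * (co m *m Q) 0 i).
exists [seq t i | i <- enum 'I_n & (0 < e i)%N]; split.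
- move=> ? /mapP[i]; rewrite mem_filter => /andP[ei _] ->; split=> //= a x y.
  set z := co (a *: x + y) - (a *: co x + co y).
  have -> : u (e i) * (co (a *: x + y) *m Q) 0 i -
    (a * (u (e i) * (co x *m Q) 0 i) + u (e i) * (co y *m Q) 0 i) =
    u (e i) * (z *m Q) 0 i.
    rewrite /z mulmxBl mulmxDl -scalemxAl !mxE mulrBr mulrDr.
    by rewrite [in RHS]mulrCA.
  apply: uP; apply: (proj1 (QP _)); exists 1; first exact: primeN1.
  rewrite scale1r /S /= /z -scaleN1r addrC cmbP cmbP !coK scaleN1r addNr //.
- move=> m hm; have /QP[s ps Ss] : forall i, vge p (e i) ((co m *m Q) 0 i).
    move=> i; have [ei0|ei] := posnP (e i); first by rewrite ei0.
    have /hm /= h : t i \in [seq t i | i <- enum 'I_n & (0 < e i)%N].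
      by apply: map_f; rewrite mem_filter ei mem_enum.
    apply: (vge_unit noethR cicR hp (pu (e i))).
    move: h; rewrite ideal_exp_iprod.
    have hN q : q \in nseq (e i) p -> height1 q.
      by rewrite mem_nseq => /andP[_ /eqP->].
    have [_] := vmin_iprod noethR cicR hp hN.
    by rewrite count_nseq /= eqxx mul1n; apply.
  exists s => //.
  by move: Ss; rewrite /S /= -[s *: co m]addr0 cmbP coK cmb0 addr0.
move=> c.
(* The i-th map carries the factor [u (e i)]; a common multiple s of these factors makes the
   prescribed values agree up to one multiplier. *)
have [s ps sP] : exists2 s, s \notin p & forall i : 'I_n, exists w, s = u (e i) * w.
  apply: (common_multiplier pp) => [i s a [w ->]|i]; first by exists (a * w); rewrite mulrCA.
  by exists (u (e i)) => //; exists 1; rewrite mulr1.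
have /choice[w wE] := sP.
pose y := \row_i (w i * c (t i)) *m \adj Q.
exists (\det Q * s), (cmb y); split; first exact: primeMn.
move=> ? /mapP[i]; rewrite mem_filter => /andP[ei _] ->.
have -> : (t i).2 (cmb y) - \det Q * s * c (t i) =
    u (e i) * ((co (cmb y) - y) *m Q) 0 i.
  have yQ : (y *m Q) 0 i = \det Q * (w i * c (t i)).
    by rewrite /y -mulmxA mul_adj_mx mul_mx_scalar !mxE.
  have -> : ((co (cmb y) - y) *m Q) 0 i = (co (cmb y) *m Q) 0 i - (y *m Q) 0 i.
    by rewrite mulmxBl mxE; congr (_ + _); rewrite mxE.
  rewrite yQ mulrBr {1}(wE i) /=.
  by congr (_ - _); rewrite [RHS]mulrCA -!mulrA.
apply: uP; apply: (proj1 (QP _)); exists 1; first exact: primeN1.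
by rewrite scale1r /S /= -scaleN1r addrC cmbP coK scaleN1r addNr.
Qed.

End LocalDiagonal.

Section Existence.
Variables (R : idomainType) (noethR : noetherian R).
Implicit Types (M N : lmodType R) (p q : {pred R}).

Lemma fin_gen_inj M N (f : {linear N -> M}) : injective f -> fin_gen M -> fin_gen N.
Proof.
move=> finj /fin_genP[l lE]; pose I : set M := [set y | exists x, f x = y].
have sI : isub I.
  split=> [|a _ _ [x <-] [y <-]]; first by exists 0; rewrite linear0.
  by exists (a *: x + y); rewrite linearP.
have [|l' l'E] := noeth_sub noethR (l := l) sI; first by rewrite -lE.
have [k kE] : exists k, [seq f u | u <- k] = l'.
  have : forall x, x \in l' -> I x by move=> x /mem_span; rewrite l'E.
  elim: (l') => [|x l0 IHl] lI; first by exists [::].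
  have [|k kE] := IHl; first by move=> y yl; apply: lI; rewrite inE yl orbT.
  have [u ux] := lI x (mem_head _ _).
  by exists (u :: k); rewrite /= kE ux.
apply/fin_genP; exists k; apply/seteqP; split=> // u _.
have : span l' (f u) by rewrite -l'E; exists u.
rewrite -kE; elim: (k) u => [|v k0 IHk] u /=.
  by move=> u0; apply: finj; rewrite linear0.
by move=> [a ua]; exists a; apply: IHk; rewrite linearB linearZ.
Qed.

Lemma fin_gen_submod M (U : submodClosed M) : fin_gen M -> fin_gen (submod U).
Proof. exact: (@fin_gen_inj M _ (\val : {linear submod U -> M}) val_inj). Qed.

Lemma fin_gen_surj M N (f : {linear M -> N}) : (forall y, exists x, f x = y) ->
  fin_gen M -> fin_gen N.
Proof.
move=> fs [n [g gP]]; exists n, (fun i => f (g i)) => y.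
have [x <-] := fs y; have [c ->] := gP x; exists c.
by rewrite linear_sum; apply: eq_bigr => i _; rewrite linearZ.
Qed.

Lemma pseudo_null_kernel M N (f : {linear M -> N}) : fin_gen M -> torsion M ->
    (forall q, height1 q -> forall x, f x = 0 -> exists2 s, s \notin q & s *: x = 0) ->
  pseudo_null (submod (kerm f)).
Proof.
move=> fgM tM h; apply: pseudo_nullI; first exact: fin_gen_submod.
  move=> x; have [r r0 rx] := tM (val x); exists r => //.
  by apply: val_inj; rewrite linearZ [RHS]linear0; apply: rx.
move=> q hq x; have [|s qs sx] := h q hq (val x).
  by apply/eqP; apply: (valP x).
by exists s => //; apply: val_inj; rewrite linearZ [RHS]linear0; apply: sx.
Qed.

Lemma pseudo_null_cokernel M N (f : {linear M -> N}) : fin_gen N -> torsion N ->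
    (forall q, height1 q -> forall y, exists2 s, s \notin q & exists x, f x = s *: y) ->
  pseudo_null (quotmod (imm f)).
Proof.
move=> fgN tN h; have surj y : exists x, quotmod_proj (imm f) x = y.
  by exists (repr y); apply: quotmod_projK.
apply: pseudo_nullI.
- exact: fin_gen_surj surj fgN.
- move=> y; have [x <-] := surj y; have [r r0 rx] := tN x; exists r => //.
  by rewrite -linearZ /= rx linear0.
move=> q hq y; have [z <-] := surj y; have [s qs [x fx]] := h q hq z.
exists s => //; rewrite -linearZ -[RHS](linear0 (quotmod_proj (imm f))).
by apply/quotmod_projP; rewrite subr0; apply/asboolP; exists x.
Qed.

Hypothesis cicR : completely_integrally_closed R.

Lemma ideal_exp_notin p q e : height1 p -> height1 q -> p <> q ->
  exists2 s, s \in ideal_exp p e & s \notin q.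
Proof.
move=> hp hq pq.
have hN q' : q' \in nseq e p -> height1 q' by rewrite mem_nseq => /andP[_ /eqP->].
have [[s [Is s0 vs]] _] := vmin_iprod noethR cicR hq hN.
exists s; first by rewrite ideal_exp_iprod.
rewrite -(pval_eq0 noethR cicR hq s0) vs count_nseq /=.
by rewrite (introF eqP pq).
Qed.

Lemma ideal_exp_neq0 p e : height1 p -> exists2 s, s \in ideal_exp p e & s != 0.
Proof.
move=> hp; have hN q : q \in nseq e p -> height1 q.
  by rewrite mem_nseq => /andP[_ /eqP->].
have [[s [Is s0 _]] _] := vmin_iprod noethR cicR hp hN.
by exists s => //; rewrite ideal_exp_iprod.
Qed.

Lemma quotmod_proj_eq0 M (U : submodClosed M) x :
  x \in U <-> quotmod_proj U x = 0.
Proof.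
split=> [Ux|]; last by rewrite -(linear0 (quotmod_proj U)) => /quotmod_projP; rewrite subr0.
by rewrite -(linear0 (quotmod_proj U)); apply/quotmod_projP; rewrite subr0.
Qed.

Section Elementary.
Variables (n : nat) (p : 'I_n -> {pred R}) (e : 'I_n -> nat).
Hypothesis hp : forall i, height1 (p i).

Lemma elementary_lift (y : elementary p e) : exists c : 'I_n -> R,
  forall i, dsum_proj y i = quotmod_proj (ideal_exp (p i) (e i) : {pred R^o}) (c i).
Proof.
by exists (fun i => repr (dsum_proj y i)) => i; rewrite quotmod_projK.
Qed.

Lemma elementary_torsion : torsion (elementary p e).
Proof.
have [r r0 rI] : exists2 r : R, r \notin pred1 (0 : R) &
    forall i, r \in ideal_exp (p i) (e i).
  apply: (common_multiplier (@prime_pred1 R)) => [i s a Is|i].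
    exact: ideal_expMl.
  by have [s Is s0] := ideal_exp_neq0 (e i) (hp i); exists s.
move=> y; exists r => //; apply: dsumP => i.
have [c cE] := elementary_lift y.
rewrite -[LHS]/(r *: dsum_proj y i) cE -linearZ.
by apply/quotmod_proj_eq0; rewrite [r *: _]mulrC; apply: ideal_expMl.
Qed.

Lemma elementary_fin_gen : fin_gen (elementary p e).
Proof.
pose pr i := quotmod_proj (ideal_exp (p i) (e i) : {pred R^o}).
exists n, (fun i => DSum (fun j => if j == i then pr j 1 else 0) : elementary p e).
move=> y; have [c cE] := elementary_lift y; exists c; apply: dsumP => i.
have projS (F : 'I_n -> elementary p e) :
    dsum_proj (\sum_j F j) i = \sum_j dsum_proj (F j) i.
  by elim/big_ind2: _ => // x1 x2 y1 y2 <- <-.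
rewrite projS (bigD1 i) //= big1 => [|j ji].
  rewrite addr0 cE -[RHS]/(c i *: (if i == i then pr i 1 else 0)) eqxx.
  by rewrite /pr -linearZ /= [_ *: _]mulr1.
rewrite -[LHS]/(c j *: (if i == j then pr i 1 else 0)).
by rewrite eq_sym (negPf ji) scaler0.
Qed.

End Elementary.

(** The local maps at the primes of [L] are assembled into one map. At a height 1 prime q, the
    summands R / p^e with p different from q vanish locally, because p^e contains an element outside
    q; and if q is not in [L], then [M] vanishes there as well. *)
Lemma char_ideal_exists M : fin_gen M -> torsion M -> exists I, is_char_ideal M I.
Proof.
move=> fgM tM; have [L [hL lenL]] := support_list noethR fgM tM.
have /choice[ls lsP] : forall q : {pred R}, exists l : seq (nat * (M -> R)), height1 q -> [/\
    forall t, t \in l -> (0 < t.1)%N /\ forall a x y,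
      t.2 (a *: x + y) - (a * t.2 x + t.2 y) \in ideal_exp q t.1,
    forall m, (forall t, t \in l -> t.2 m \in ideal_exp q t.1) ->
      exists2 s, s \notin q & s *: m = 0 &
    forall c : nat * (M -> R) -> R, exists s m, s \notin q /\
      forall t, t \in l -> t.2 m - s * c t \in ideal_exp q t.1].
  move=> q; have [hq|nq] := pselect (height1 q); last by exists [::].
  by have [l lP] := local_structure noethR cicR hq fgM tM; exists l.
(* Without repetitions, [index] recovers the summand belonging to a pair, so a target vector can be
   passed to the local surjectivity as a function of pairs. *)
pose T := undup [seq (q, t) | q <- L, t <- ls q].
have TP q t : (q, t) \in T <-> q \in L /\ t \in ls q.
  rewrite mem_undup; split=> [/allpairsPdep[q' [t' [q'L t'l [-> ->]]]] //|[qL tl]].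
  by apply/allpairsPdep; exists q, t.
pose n := size T.
pose tn (i : 'I_n) := tnth (in_tuple T) i.
have tnT i : tn i \in T by apply: mem_tnth.
pose p i := (tn i).1; pose e i := (tn i).2.1.
have [pL tls] : (forall i, p i \in L) /\ (forall i, (tn i).2 \in ls (p i)).
  by split=> i; have := tnT i; rewrite [tn i]surjective_pairing => /TP[].
have hp i : height1 (p i) by apply: hL.
pose f m : elementary p e := DSum (fun i =>
   quotmod_proj (ideal_exp (p i) (e i) : {pred R^o}) ((tn i).2.2 m)).
have flin : linear f.
  move=> a x y; apply: dsumP => i; rewrite /= -[RHS]linearP.
  apply/quotmod_projP; have [h _ _] := lsP _ (hp i).
  by have [_] := h _ (tls i); apply.
pose fL : {linear M -> elementary p e} := HB.pack f (GRing.isLinear.Build R M _ _ f flin).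
have fE m i : dsum_proj (fL m) i = 0 <-> (tn i).2.2 m \in ideal_exp (p i) (e i).
  by split=> /quotmod_proj_eq0.
exists (ideal_prod (fun i => ideal_exp (p i) (e i))), n, p, e, fL; split=> //.
  by move=> i; have [h _ _] := lsP _ (hp i); have [] := h _ (tls i).
split.
  apply: pseudo_null_kernel => // q hq m fm0.
  have pq := height1_prime hq.
  have [qL|qL] := boolP (q \in L); last first.
    have := lenL q hq; rewrite (count_memPn qL) => l0.
    have W0 : [set 0 : M] `<=` setT by [].
    by have [s qs sm] := (len0P q (isub_zero M) W0).1 l0 m Logic.I; exists s.
  have [_ kerP _] := lsP _ hq; apply: kerP => t tl.
  have /tnthP[i iE] : (q, t) \in in_tuple T by apply/TP.
  have Ii : (tn i).2.2 m \in ideal_exp (p i) (e i) by apply/fE; rewrite fm0.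
  by move: Ii; rewrite /p /e /tn -iE.
apply: pseudo_null_cokernel; [exact: elementary_fin_gen|exact: elementary_torsion|].
move=> q hq y; have pq := height1_prime hq.
have [c cE] := elementary_lift y.
have [s [m [qs sm]]] : exists s m, s \notin q /\ forall i, p i = q ->
    (tn i).2.2 m - s * c i \in ideal_exp (p i) (e i).
  have [qL|qL] := boolP (q \in L); last first.
    exists 1, 0; rewrite primeN1 //; split=> // i piq.
    by move: qL; rewrite -piq pL.
  have [_ _ cokP] := lsP _ hq.
  have [s [m [qs smP]]] := cokP (fun t => if insub (index (q, t) T) is Some i then c i else 0).
  exists s, m; split=> // i piq.
  have := smP (tn i).2; rewrite -piq => /(_ (tls i)).
  have -> : index (p i, (tn i).2) T = i.
    by rewrite -surjective_pairing /tn (tnth_nth (tn i)) index_uniq ?undup_uniq.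
  by rewrite valK.
(* The multiplier u is outside q and kills all summands at primes other than q. *)
have [u qu uP] : exists2 u, u \notin q & forall i, p i <> q -> u \in ideal_exp (p i) (e i).
  apply: (common_multiplier pq) => [i u a h /h Iu|i].
    exact: ideal_expMl.
  have [piq|piq] := pselect (p i = q).
    by exists 1; [exact: primeN1|].
  by have [s' Is qs'] := ideal_exp_notin (e i) (hp i) hq piq; exists s'.
exists (u * s); first exact: primeMn.
exists (u *: m); rewrite linearZ; apply: dsumP => i.
rewrite -[LHS]/(u *: dsum_proj (f m) i) -[RHS]/((u * s) *: dsum_proj y i) cE.
rewrite -[LHS]linearZ -[RHS]linearZ; apply/quotmod_projP.
have -> : u * (tn i).2.2 m - (u * s) * c i = u * ((tn i).2.2 m - s * c i).
  by rewrite mulrBr mulrA.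
have [piq|piq] := pselect (p i = q); first exact/ideal_expMl/sm.
by rewrite mulrC; apply/ideal_expMl/uP.
Qed.

End Existence.

(** * Power series rings *)

(** The sequence [x] holds successive remainders under an invariant; the [c] recorded along the way
    become the coefficients of a power series. *)
Lemma dependent_choice_nat (T C : Type) (P : nat -> T -> Prop)
    (Q : nat -> T -> C -> T -> Prop) (x0 : T) :
    (forall m x, P m x -> exists c y, P m.+1 y /\ Q m x c y) -> P 0%N x0 ->
  exists (x : nat -> T) (c : nat -> C),
    x 0%N = x0 /\ forall m, P m (x m) /\ Q m (x m) (c m) (x m.+1).
Proof.
move=> h P0.
have next m (x : {x | P m x}) :
    {cy : C * T | P m.+1 cy.2 /\ Q m (sval x) cy.1 cy.2}.
  by apply: cid; case: x => x /= /h[c [y cy]]; exists (c, y).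
pose X := nat_rect (fun m => {x | P m x}) (exist _ x0 P0)
  (fun m x => exist _ _ (svalP (next m x)).1).
exists (fun m => sval (X m)), (fun m => (sval (next m (X m))).1).
by split=> // m; split; [exact: svalP|have [] := svalP (next m (X m))].
Qed.

Section PowerSeries.
Variable A : comNzRingType.
Implicit Types (f g : fps A).
Local Notation t := (fps_t A).

Lemma fps_coefM f g n : fps_coef (f * g) n = \sum_(i < n.+1) fps_coef f i * fps_coef g (n - i).
Proof. by []. Qed.
Lemma fps_coefD f g n : fps_coef (f + g) n = fps_coef f n + fps_coef g n.
Proof. by []. Qed.
Lemma fps_coefB f g n : fps_coef (f - g) n = fps_coef f n - fps_coef g n.
Proof. by []. Qed.
Lemma fps_coef_sum I (r : seq I) (P : pred I) (F : I -> fps A) n :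
  fps_coef (\sum_(i <- r | P i) F i) n = \sum_(i <- r | P i) fps_coef (F i) n.
Proof. by elim/big_ind2: _ => // x1 x2 y1 y2 <- <-. Qed.

Lemma fps_pi_is_zmod_morphism : zmod_morphism (@fps_pi A). Proof. by []. Qed.
Lemma fps_pi_is_monoid_morphism : monoid_morphism (@fps_pi A).
Proof. by split=> // f g; rewrite /fps_pi fps_coefM big_ord1. Qed.
HB.instance Definition _ :=
  GRing.isZmodMorphism.Build (fps A) A (@fps_pi A) fps_pi_is_zmod_morphism.
HB.instance Definition _ :=
  GRing.isMonoidMorphism.Build (fps A) A (@fps_pi A) fps_pi_is_monoid_morphism.

Lemma fps_pi_tM f : fps_pi (t * f) = 0.
Proof. by rewrite rmorphM; apply: mul0r. Qed.

Definition fps_shift f : fps A := FPS (fun n => fps_coef f n.+1).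

Lemma fps_coef_tM f n : fps_coef (t * f) n = if n is n'.+1 then fps_coef f n' else 0.
Proof.
rewrite fps_coefM; case: n => [|n]; first by rewrite big_ord1 mul0r.
rewrite big_ord_recl mul0r add0r big_ord_recl /= mul1r subn1 big1 ?addr0 // => i _.
by rewrite /= mul0r.
Qed.

Lemma fps_shiftE f : f = fps_const (fps_pi f) + t * fps_shift f.
Proof.
by apply: fpsP => n; rewrite fps_coefD fps_coef_tM; case: n => [|n] /=; rewrite ?addr0 ?add0r.
Qed.

Lemma fps_pi_eq0 f : fps_pi f = 0 -> f = t * fps_shift f.
Proof. by move=> f0; rewrite {1}[f]fps_shiftE f0 rmorph0 add0r. Qed.

Lemma fps_coef_constM (a : A) f n : fps_coef (fps_const a * f) n = a * fps_coef f n.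
Proof.
rewrite fps_coefM big_ord_recl /= subn0 big1 ?addr0 // => i _.
by rewrite mul0r.
Qed.

Definition ord_ge k f := forall i, (i < k)%N -> fps_coef f i = 0.

Lemma ord_geP k f : ord_ge k f <-> exists g, f = t ^+ k * g.
Proof.
elim: k f => [|k IHk] f.
  by split=> // _; exists f; rewrite expr0 mul1r.
split=> [fk|[g ->] i ik].
  have [|g gE] := (IHk (fps_shift f)).1; first by move=> i ik; apply: fk.
  by exists g; rewrite exprS -mulrA -gE -fps_pi_eq0 //; apply: fk.
rewrite exprS -mulrA fps_coef_tM; case: i ik => // i ik.
by apply: (IHk _).2 => //; exists g.
Qed.

Lemma ord_geW k f : ord_ge k.+1 f -> ord_ge k f.
Proof. by move=> h i ik; apply: h; apply: leqW. Qed.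

Lemma ord_geS k f : ord_ge k f -> fps_coef f k = 0 -> ord_ge k.+1 f.
Proof.
by move=> fk f0 i; rewrite ltnS leq_eqVlt => /predU1P[->|/fk].
Qed.

Lemma coef_tXnM k f n : fps_coef (t ^+ k * f) n = if (n < k)%N then 0 else fps_coef f (n - k).
Proof.
elim: k n => [|k IHk] n; first by rewrite expr0 mul1r subn0.
by rewrite exprS -mulrA fps_coef_tM; case: n => // n; rewrite IHk subSS.
Qed.

Lemma ord_geM k f g : ord_ge k f -> ord_ge k (f * g).
Proof.
by move=> /ord_geP[h ->]; apply/ord_geP; exists (h * g); rewrite mulrA.
Qed.

Definition fps_trunc M (c : nat -> A) : fps A :=
  FPS (fun m => if (m < M)%N then c m else 0).

Lemma fps_truncS M c :
  fps_trunc M.+1 c = fps_trunc M c + fps_const (c M) * t ^+ M.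
Proof.
apply: fpsP => n; rewrite fps_coefD fps_coef_constM -[t ^+ M]mulr1 coef_tXnM /=.
rewrite ltnS; have [nM|nM|->] := ltngtP n M; rewrite ?mulr0 ?addr0 //.
  by rewrite subn_eq0 leqNgt nM mulr0 addr0.
by rewrite subnn mulr1 add0r.
Qed.

(** Passage to the t-adic limit: the coefficient of index n is already decided by the truncation at
    n.+1. *)
Lemma fps_limit k (F : fps A) (G : 'I_k -> fps A) (c : nat -> 'I_k -> A) :
    (forall M, ord_ge M (F - \sum_j fps_trunc M (c^~ j) * G j)) ->
  F = \sum_j FPS (c^~ j) * G j.
Proof.
move=> h; apply: fpsP => n; apply/eqP; rewrite -subr_eq0 -fps_coefB.
rewrite -(subrK (\sum_j fps_trunc n.+1 (c^~ j) * G j) F) -addrA fps_coefD h // add0r.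
rewrite -sumrB fps_coef_sum big1 // => j _; rewrite -mulrBl.
apply: (@ord_geM n.+1) => // i im /=.
by rewrite im subrr.
Qed.

Hypothesis noethA : noetherian A.

Section IdealGenerators.
Variables (I : set (fps A)^o) (sI : isub I).

Let Iord n : set (fps A)^o := [set f | I f /\ ord_ge n f].
Let Lead n : set A^o := [set a | exists2 f, Iord n f & fps_coef f n = a].

Let isub_Iord n : isub (Iord n).
Proof.
split=> [|a f g [If fn] [Ig gn]]; first by split=> //; apply: isub0.
split; first exact: isubP.
move=> i ik; rewrite fps_coefD gn // addr0.
by rewrite [a *: f]mulrC; apply: (ord_geM _ fn).
Qed.

Let isub_Lead n : isub (Lead n).
Proof.
split=> [|a _ _ [f If <-] [g Ig <-]]; first by exists 0; [apply: isub0|].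
exists (fps_const a * f + g); first exact: (isubP (fps_const a) (isub_Iord n)).
by rewrite fps_coefD fps_coef_constM.
Qed.

Let Lead_mono m n : (m <= n)%N -> Lead m `<=` Lead n.
Proof.
move=> /subnKC<-; elim: (n - m)%N => [|k IHk]; first by rewrite addn0.
move=> a /IHk[f [If fn] <-]; rewrite addnS; exists (t * f).
  split; first exact: (isubZ t sI If).
  by move=> [|i] ik; rewrite fps_coef_tM // fn.
by rewrite fps_coef_tM.
Qed.

(** Series lifting generators of the ideal of leading coefficients suffice to cancel the coefficient
    of index n. *)
Let Iord_span n (l : seq A^o) : span l = Lead n -> exists2 lf : seq (fps A)^o,
  (forall f, f \in lf -> Iord n f) &
  forall g, Iord n g -> exists2 f, span lf f & Iord n.+1 (g - f).
Proof.
move=> lE.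
have [lf lfI lfP] : exists2 lf : seq (fps A)^o, (forall f, f \in lf -> Iord n f) &
    forall a, span (M := A^o) l a -> exists2 f, span lf f & fps_coef f n = a.
  have : forall a, a \in l -> Lead n a.
    by move=> a al; rewrite -lE; apply: (mem_span (M := A^o)).
  elim: (l) => [|a l0 IHl] lL.
    by exists [::] => // a ->; exists 0.
  have [|lf lfI lfP] := IHl; first by move=> b bl; apply: lL; rewrite inE bl orbT.
  have [f If fa] := lL a (mem_head _ _).
  exists (f :: lf) => [g|b [c /lfP[g lg gb]]]; first by rewrite inE => /predU1P[->|/lfI].
  exists (fps_const c * f + g).
    by exists (fps_const c); rewrite [_ *: _]/(_ * _) addrC addKr.
  by rewrite fps_coefD fps_coef_constM gb fa addrC subrK.
exists lf => // g Ig.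
have [|f lf_f fg] := lfP (fps_coef g n); first by rewrite lE; exists g.
exists f => //; have If := span_min (isub_Iord n) lfI lf_f.
have [Igf gfn] := isubB (isub_Iord n) Ig If.
by split=> //; apply: ord_geS => //; rewrite fps_coefB fg subrr.
Qed.

(* The ideals of leading coefficients of order n are stationary from N on; then
   Iord N is generated by successive approximation, and Iord n from Iord n.+1. *)
Lemma fps_ideal_fg : sub_fg I.
Proof.
pose L : set A^o := [set a | exists n, Lead n a].
have sL : isub L.
  split=> [|a x y [m xm] [n yn]]; first by exists 0%N; apply: isub0.
  exists (maxn m n); apply: isubP => //.
    exact: Lead_mono (leq_maxl _ _) _ xm.
  exact: Lead_mono (leq_maxr _ _) _ yn.
have [l lE] := noeth_fg noethA sL.
have [N lN] : exists N, span l = Lead N.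
  have [N lN] : exists N, forall a, a \in l -> Lead N a.
    have : forall a, a \in l -> L a.
      by move=> a al; rewrite lE; apply: (mem_span (M := A^o)).
    elim: (l) => [|a l0 IHl] lL; first by exists 0%N.
    have [|N lN] := IHl; first by move=> b bl; apply: lL; rewrite inE bl orbT.
    have [m am] := lL a (mem_head _ _).
    exists (maxn m N) => b; rewrite inE => /predU1P[->|/lN].
      exact: Lead_mono (leq_maxl _ _) _ am.
    exact: Lead_mono (leq_maxr _ _) _.
  exists N; apply/seteqP; split; first exact: span_min.
  by rewrite -lE => a La; exists N.
have fgN : sub_fg (Iord N).
  have [lf lfI lfP] := Iord_span lN.
  exists lf; apply/seteqP; split; last exact: span_min.
  pose G := tnth (in_tuple lf).
  have lfG f : span lf f <-> exists c : 'I_(size lf) -> fps A, f = \sum_i c i * G i.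
    by have := span_codomP (M := (fps A)^o) G f; rewrite codomE map_tnth_enum.
  have shiftI m g : Iord (m + N) g ->
      exists c : 'I_(size lf) -> A,
        Iord (m + N).+1 (g - \sum_i (fps_const (c i) * t ^+ m) * G i).
    move=> Ig.
    (* Stationarity: the coefficient of index m + N is already a leading coefficient of order N. *)
    have : Lead N (fps_coef g (m + N)).
      rewrite -lN -lE; exists (m + N)%N; by exists g.
    move=> [h Ih hE]; have [f /lfG[c fE] [Ihf hf0]] := lfP h Ih.
    (* Since every [G i] has order at least N, only the constant terms of [c] affect the coefficient
       to be cancelled. *)
    exists (fun i => fps_pi (c i)).
    set S := \sum_i _.
    have IS : Iord (m + N) S.
      apply: (isub_sum (M := (fps A)^o)) => // i _.
      have [IG GN] := lfI (G i) (mem_tnth _ _).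
      split; first exact: (isubZ _ sI IG).
      have [u uE] := (ord_geP N (G i)).1 GN; apply/ord_geP.
      exists (fps_const (fps_pi (c i)) * u); rewrite uE exprD.
      by rewrite -!mulrA mulrCA; congr (_ * _); rewrite mulrCA.
    have [IgS gS] := isubB (isub_Iord _) Ig IS.
    split=> //; apply: ord_geS => //.
    rewrite fps_coefB -hE; apply/eqP; rewrite subr_eq0; apply/eqP.
    have : fps_coef (h - f) N = 0 by apply: hf0.
    rewrite fps_coefB => /eqP; rewrite subr_eq0 => /eqP ->.
    rewrite fE /S !fps_coef_sum; apply: eq_bigr => i _.
    have [_ GN] := lfI (G i) (mem_tnth _ _).
    have [u ->] := (ord_geP N (G i)).1 GN.
    rewrite -mulrA fps_coef_constM [t ^+ N * u]mulrC !mulrA [_ * t ^+ N]mulrC.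
    rewrite [t ^+ m * u * _]mulrAC -exprD !coef_tXnM ltnn ltnNge leqnn /=.
    by rewrite !subnn -[LHS]/(fps_pi (c i * u)) rmorphM.
  move=> g Ig; apply/lfG.
  have [x [c [x0 xP]]] := dependent_choice_nat
    (Q := fun m x c y => y = x - \sum_i (fps_const (c i) * t ^+ m) * G i)
    (fun m x Ix => let: ex_intro c Ic := shiftI m x Ix in
       ex_intro _ c (ex_intro _ _ (conj Ic erefl))) Ig.
  have xS m := (xP m).2.
  exists (fun i => FPS (c^~ i)); apply: fps_limit => M.
  suff -> : g - \sum_i fps_trunc M (c^~ i) * G i = x M.
    by have [[_ h] _] := xP M => i iM; apply: h; rewrite ltn_addr.
  elim: M => [|M IHM].
    rewrite x0 big1 ?subr0 // => i _.
    by have -> : fps_trunc 0 (c^~ i) = 0 by []; rewrite mul0r.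
  rewrite xS -IHM -addrA -opprD -big_split /=.
  by congr (_ - _); apply: eq_bigr => i _; rewrite fps_truncS mulrDl.
have down n : sub_fg (Iord n.+1) -> sub_fg (Iord n).
  move=> [l1 l1E]; have [l2 l2E] := noeth_fg noethA (isub_Lead n).
  have [lf lfI lfP] := Iord_span (esym l2E).
  exists (lf ++ l1); rewrite span_cat -l1E; apply/seteqP; split.
    by move=> g /lfP[f lf_f Igf]; exists f.
  apply: sadd_min => //; first exact: span_min.
  by move=> f [If fn]; split=> //; apply: ord_geW.
have fg0 : sub_fg (Iord 0).
  by elim: (N) fgN => // n IHn /down.
have -> // : I = Iord 0 by apply/seteqP; split=> // f [].
Qed.

End IdealGenerators.

Lemma fps_noetherian : noetherian (fps A).
Proof.
move=> I [I0 IP]; pose J : set (fps A)^o := [set f | f \in I].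
have [l lE] : sub_fg J by apply: fps_ideal_fg; split=> // a x y; apply: IP.
exists (size l), (tnth (in_tuple l)) => f.
have := span_codomP (M := (fps A)^o) (tnth (in_tuple l)) f.
by rewrite codomE map_tnth_enum -lE.
Qed.

End PowerSeries.

(** * Krull domains are completely integrally closed *)

Section KrullDomain.
Variables (A : idomainType) (krullA : krull_domain A).
Local Notation tofrac := (@FracField.tofrac A).

(** At each height 1 prime the hypothesis gives v(d) + n v(f / g) >= 0 for all n, so v(f / g) cannot
    be negative, and f / g lies in every localization. *)
Lemma krull_completely_integrally_closed : completely_integrally_closed A.
Proof.
have [capA dvrA _] := krullA => d f g d0 g0 h.
have frac0 (x : A) : x != 0 -> tofrac x != 0 by rewrite tofrac_eq0.
have [->|f0] := eqVneq f 0; first by exists 0; rewrite mulr0.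
suff [r rE] : exists r, tofrac f / tofrac g = tofrac r.
  exists r; apply/eqP; rewrite -tofrac_eq; apply/eqP; rewrite rmorphM /= -rE mulrC divfK //.
  exact: frac0.
apply: capA => p hp; have [v [vM _ _ vV]] := dvrA p hp.
set x := tofrac f / tofrac g.
have x0 : x != 0 by rewrite mulf_neq0 ?invr_eq0 ?frac0.
apply/vV; right; rewrite leNgt; apply/negP => vx.
have pp := height1_prime hp.
have v1 : v 1 = 0.
  by have := vM 1 1 (oner_neq0 _) (oner_neq0 _); rewrite mulr1 -{1}[v 1]addr0 => /addrI.
have vX n : v (x ^+ n) = v x *+ n.
  elim: n => [|n IHn]; first by rewrite expr0 v1 mulr0n.
  by rewrite exprS vM ?expf_neq0 // IHn mulrS.
have vA (a : A) : a != 0 -> 0 <= v (tofrac a).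
  move=> a0; have : tofrac a = 0 \/ 0 <= v (tofrac a).
    apply/vV/asboolP; exists a, 1; rewrite primeN1 //; split=> //.
    by rewrite rmorph1 divr1.
  by case=> // /eqP; rewrite tofrac_eq0 (negPf a0).
pose n := `|v (tofrac d)|%N.+1.
have [k kE] := h n.
have k0 : k != 0.
  apply/eqP => k0; move/eqP: kE; rewrite k0 mulr0 mulf_eq0 (negPf d0).
  by rewrite expf_eq0 (negPf f0) andbF.
have : tofrac k = tofrac d * x ^+ n.
  rewrite /x expr_div_n mulrA -rmorphXn -rmorphM kE rmorphM rmorphXn /=.
  by rewrite mulrAC mulfV ?mul1r // expf_neq0 // frac0.
move=> kE'; have := vA k k0; rewrite kE' vM ?frac0 ?expf_neq0 // vX.
have hx : v x *+ n <= (-1) *+ n by apply: ler_wMn2r; move: vx; lia.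
have := vA d d0; move: hx; rewrite mulNrn /n; lia.
Qed.

(** The intersection property without fractions; it turns inequalities between valuations back into
    divisibility. *)
Lemma krull_dvd (a b : A) : b != 0 ->
    (forall p, height1 p -> exists s c, s \notin p /\ s * a = c * b) ->
  exists c, a = b * c.
Proof.
move=> b0 h; have [capA _ _] := krullA.
have frac0 (x : A) : x != 0 -> tofrac x != 0 by rewrite tofrac_eq0.
have [|r rE] := capA (tofrac a / tofrac b).
  move=> p hp; have [s [c [ps sa]]] := h p hp; have pp := height1_prime hp.
  have s0 := frac0 _ (prime_neq0 pp ps).
  apply/asboolP; exists c, s; split=> //.
  have b0F := frac0 _ b0; apply/eqP; rewrite eqr_div //.
  by rewrite mulrC -!rmorphM sa.
exists r; apply/eqP; rewrite -tofrac_eq; apply/eqP; rewrite rmorphM /= -rE mulrC divfK //.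
exact: frac0.
Qed.

End KrullDomain.

(** * The prime (t) and complete integral closedness of A[[t]] *)

Section FpsDomain.
Variable A : idomainType.
Implicit Types (f g : fps A) (p : {pred A}) (q : {pred fps A}).
Local Notation t := (fps_t A).

Let fps_domain : idomainType := fps A.
Add Ring fps_ring : (domain_ring_theory fps_domain).
Local Ltac bring := ring_in fps_domain.

Lemma fps_t_neq0 : t != 0.
Proof. by apply/eqP => /(congr1 (fun f => fps_coef f 1)) /eqP; rewrite /= oner_eq0. Qed.

Definition t_ideal : {pred fps A} := [pred f | fps_pi f == 0].

Lemma t_idealP f : f \in t_ideal <-> exists g, f = t * g.
Proof.
split=> [/eqP/fps_pi_eq0|[g ->]]; first by exists (fps_shift f).
by apply/eqP; rewrite fps_pi_tM.
Qed.

Lemma prime_t_ideal : prime_ideal t_ideal.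
Proof.
split; first split=> [||a u v /eqP u0 /eqP v0]; rewrite ?inE.
- by rewrite rmorph0.
- by rewrite rmorph1 oner_eq0.
- by rewrite rmorphD rmorphM /= u0 v0 mulr0 addr0.
by move=> u v; rewrite !inE rmorphM mulf_eq0.
Qed.

Lemma fps_ord_exists f : f != 0 -> exists n g, f = t ^+ n * g /\ fps_pi g != 0.
Proof.
move=> f0; have ex : exists n, fps_coef f n != 0.
  apply: contra_notP (negP f0) => nex; apply/eqP/fpsP => n /=.
  by apply: contra_notP nex => /eqP; exists n.
case: (ex_minnP ex) => n fn nmin.
have [g fE] : exists g, f = t ^+ n * g.
  apply/ord_geP => m mn; apply/eqP; apply: contraTT mn => /nmin; rewrite -leqNgt.
  exact.
exists n, g; split=> //; move: fn; rewrite fE -[X in fps_coef _ X]addn0 coef_tXnM.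
by rewrite addn0 ltnn subnn.
Qed.

Lemma t_pow_dvd k f g : fps_pi g != 0 -> (exists h, g * f = t ^+ k * h) ->
  exists h, f = t ^+ k * h.
Proof.
move=> g0; elim: k f => [|k IHk] f [h fE]; first by exists f; rewrite expr0 mul1r.
have /t_idealP[f' f'E] : f \in t_ideal.
  have : g * f \in t_ideal by apply/t_idealP; exists (t ^+ k * h); rewrite fE exprS mulrA.
  by rewrite (primeM prime_t_ideal) [g \in _](negPf g0).
have [|h' h'E] := IHk f'.
  exists h; apply: (mulfI fps_t_neq0).
  by rewrite mulrCA -f'E fE exprS mulrA.
by exists h'; rewrite f'E h'E exprS mulrA.
Qed.

Lemma t_ideal_inf f : f != 0 -> (forall k, exists h, f = t ^+ k * h) -> False.
Proof.
move=> f0 h; have [n [g [fE g0]]] := fps_ord_exists f0.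
have [h' hE] := h n.+1; move: g0; have -> : g = t * h'.
  by apply: (mulfI (expf_neq0 n fps_t_neq0)); rewrite -fE hE exprSr mulrA.
by rewrite fps_pi_tM eqxx.
Qed.

(* Otherwise q is contained in (t), so q = t q, and q = 0. *)
Lemma prime_not_sub_t q f : prime_ideal q -> f \in q -> f != 0 -> t \notin q ->
  exists2 g, g \in q & fps_pi g != 0.
Proof.
move=> pq qf f0 qt; apply: contrapT => nex.
apply: (t_ideal_inf f0) => k; elim: k f qf f0 => [|k IHk] f qf f0.
  by exists f; rewrite expr0 mul1r.
have /t_idealP[g fE] : f \in t_ideal.
  by apply: contrapT => /negP; rewrite inE => fn; apply: nex; exists f.
have qg : g \in q by move: qf; rewrite fE (primeM pq) (negPf qt).
have [||h gE] := IHk g => //; first by apply: contraNneq f0 => g0; rewrite fE g0 mulr0.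
by exists h; rewrite exprS -mulrA -gE.
Qed.

(** A nonzero prime strictly inside (t) cannot contain t, and then it has an element with nonzero
    constant term. Consequently a pseudo-null module is killed by such a series. *)
Lemma height1_t_ideal : height1 t_ideal.
Proof.
have tt : t \in t_ideal by apply/t_idealP; exists 1; rewrite mulr1.
split; first by apply/height_ge1P; split; [exact: prime_t_ideal|exists t; [|exact: fps_t_neq0]].
move=> [_ [q [qt tq /height_ge1P[pq [f qf f0]]]]].
have [tq'|qt'] := boolP (t \in q).
  by apply: tq => g /t_idealP[h ->]; apply: primeMr.
have [g qg g0] := prime_not_sub_t pq qf f0 qt'.
by move: (qt g qg); rewrite inE (negPf g0).
Qed.

(** Binomial expansion of the powers of f / g + a: the same denominator [d] works. *)
Lemma almost_integral_shift (R : idomainType) (d f g a : R) :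
    (forall n, exists h, d * f ^+ n = g ^+ n * h) ->
  forall n, exists h, d * (f + a * g) ^+ n = g ^+ n * h.
Proof.
move=> h n; have /choice[k kE] := h.
exists (\sum_(i < n.+1) (k (n - i)%N * a ^+ i) *+ 'C(n, i)).
rewrite exprDn !mulr_sumr; apply: eq_bigr => i _.
rewrite !mulrnAr; congr (_ *+ _).
have -> : g ^+ n = g ^+ (n - i) * g ^+ i by rewrite -exprD subnK // leq_ord.
rewrite [LHS]mulrA kE exprMn -!mulrA; congr (_ * _).
by rewrite [RHS]mulrC -mulrA.
Qed.

(** The quotient f / g is computed one coefficient at a time. Subtracting a multiple of g keeps the
    remainder almost integral over g, and its leading coefficient is then divisible by that of g
    because [A] is completely integrally closed. *)
Lemma fps_completely_integrally_closed :
  completely_integrally_closed A -> completely_integrally_closed (fps A).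
Proof.
move=> cicA d f g d0 g0 h.
have [e [d' [dE d'0]]] := fps_ord_exists d0.
have [l [g' [gE g'0]]] := fps_ord_exists g0.
have t0 k : t ^+ k != 0 by rewrite expf_neq0 ?fps_t_neq0.
have gXE n : g ^+ n = t ^+ (l * n) * g' ^+ n by rewrite gE exprMn -exprM.
(* After division by powers of t, the constant terms of d', f' and g' satisfy the almost integrality
   condition in [A]. *)
have lead m f' : (forall n, exists h, d * (t ^+ (l + m) * f') ^+ n = g ^+ n * h) ->
    exists c, fps_pi f' = fps_pi g' * c.
  move=> hf'; apply: (cicA (fps_pi d')) => // n.
  have [k kE] := hf' n.
  have fXE : (t ^+ (l + m) * f') ^+ n = t ^+ (l * n) * t ^+ (m * n) * f' ^+ n.
    by rewrite exprMn -exprM mulnDl exprD.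
  have [||k' k'E] := @t_pow_dvd (e + m * n) k (g' ^+ n).
  - by rewrite rmorphXn expf_neq0.
  - exists (d' * f' ^+ n); apply: (mulfI (t0 (l * n)%N)).
    rewrite [LHS]mulrA -gXE -kE dE fXE exprD.
    by move: (t ^+ e) (f' ^+ n) (t ^+ (l * n)) (t ^+ (m * n)) => x1 x2 x3 x4; bring.
  exists (fps_pi k'); rewrite -!rmorphXn -!rmorphM; congr fps_pi.
  apply: (mulfI (t0 (e + (l + m) * n)%N)).
  transitivity (g ^+ n * k).
    rewrite -kE dE fXE mulnDl !exprD.
    by move: (t ^+ e) (f' ^+ n) (t ^+ (l * n)) (t ^+ (m * n)) => x1 x2 x3 x4; bring.
  rewrite k'E gXE mulnDl !exprD.
  by move: (t ^+ e) (g' ^+ n) (t ^+ (l * n)) (t ^+ (m * n)) => x1 x2 x3 x4; bring.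
have ordf : exists f', f = t ^+ l * f'.
  have [->|f0] := eqVneq f 0; first by exists 0; rewrite mulr0.
  have [k [f' [fE f'0]]] := fps_ord_exists f0.
  have [lk|kl] := leqP l k.
    by exists (t ^+ (k - l) * f'); rewrite mulrA -exprD subnKC.
  (* If f has order k < l, the exponent e.+1 outweighs the order e of d: the two sides would have
     orders e + k (e + 1) and at least l (e + 1), which is larger. *)
  have [k' k'E] := h e.+1.
  suff : fps_pi (d' * f' ^+ e.+1) = 0.
    by move=> /eqP; rewrite rmorphM rmorphXn mulf_eq0 expf_eq0 (negPf d'0) (negPf f'0) andbF.
  have -> : d' * f' ^+ e.+1 = t * (t ^+ ((l - k.+1) * e.+1) * g' ^+ e.+1 * k').
    apply: (mulfI (t0 (e + k * e.+1)%N)).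
    transitivity (d * f ^+ e.+1).
      rewrite dE fE exprMn exprD -exprM.
      by move: (t ^+ e) (f' ^+ e.+1) (t ^+ (k * e.+1)) => x1 x2 x3; bring.
    rewrite k'E gXE.
    have -> : (l * e.+1 = 1 + (e + k * e.+1) + (l - k.+1) * e.+1)%N.
      have {1}-> : l = ((l - k.+1) + k.+1)%N by rewrite subnK.
      by rewrite mulnDl addnC; congr (_ + _)%N; rewrite mulSn; lia.
    rewrite !exprD expr1.
    move: (t ^+ e) (g' ^+ e.+1) (t ^+ (k * e.+1)) (t ^+ ((l - k.+1) * e.+1)).
    by move=> x1 x2 x3 x4; bring.
  exact: fps_pi_tM.
(* The invariant of the coefficientwise division of f by g. *)
pose good m f' := (forall n, exists h, d * (t ^+ (l + m) * f') ^+ n = g ^+ n * h).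
have step m f' : good m f' ->
    exists c f'', good m.+1 f'' /\
      t ^+ (l + m) * f' - fps_const c * t ^+ m * g = t ^+ (l + m.+1) * f''.
  move=> gf; have [c cE] := lead m f' gf.
  have : fps_pi (f' - fps_const c * g') = 0.
    have -> : fps_pi (f' - fps_const c * g') = fps_pi f' - c * fps_pi g'.
      by rewrite rmorphB rmorphM.
    by rewrite cE [c * _]mulrC subrr.
  move=> /fps_pi_eq0 fE; exists c, (fps_shift (f' - fps_const c * g')).
  have E : t ^+ (l + m) * f' - fps_const c * t ^+ m * g =
      t ^+ (l + m.+1) * fps_shift (f' - fps_const c * g').
    rewrite addnS exprSr -[RHS]mulrA -fE gE exprD.
    by move: (t ^+ l) (t ^+ m) => x1 x2; bring.
  split=> //; rewrite /good -E => n.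
  by rewrite -mulNr; apply: almost_integral_shift.
have [f0 f0E] := ordf.
have good0 : good 0%N f0 by rewrite /good addn0 -f0E.
have [x [c [x0 xP]]] := dependent_choice_nat step good0.
have xS m := (xP m).2.
exists (FPS c); rewrite mulrC.
have := @fps_limit A 1 f (fun=> g) (fun n _ => c n).
rewrite big_ord1; apply=> M; rewrite big_ord1.
suff -> : f - fps_trunc M c * g = t ^+ (l + M) * x M.
  by apply/ord_geP; exists (t ^+ l * x M); rewrite mulrA -exprD addnC.
elim: M => [|M IHM].
  have -> : fps_trunc 0 c = 0 by [].
  by rewrite mul0r subr0 addn0 x0.
by rewrite -xS -IHM fps_truncS mulrDl opprD addrA.
Qed.

End FpsDomain.

(** * The defect of multiplication by t *)

(** Multiplication by the adjugate of [Y]; this is the determinant trick behind Nakayama's lemma. *)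
Lemma cramer (R : comNzRingType) (M : lmodType R) (W : set M) k (Y : 'M[R]_k) (G : 'I_k -> M) :
  isub W -> (forall i, W (\sum_j Y i j *: G j)) -> forall i, W (\det Y *: G i).
Proof.
move=> sW WY i.
have -> : \det Y *: G i = \sum_j (\adj Y *m Y) i j *: G j.
  rewrite mul_adj_mx (bigD1 i) //= big1 => [|j ji]; rewrite mxE.
    by rewrite eqxx mulr1n addr0.
  by rewrite eq_sym (negPf ji) mulr0n scale0r.
have -> : \sum_j (\adj Y *m Y) i j *: G j = \sum_l \adj Y i l *: \sum_j Y l j *: G j.
  under eq_bigr do rewrite mxE scaler_suml.
  rewrite exchange_big; apply: eq_bigr => l _; rewrite scaler_sumr.
  by apply: eq_bigr => j _; rewrite scalerA.
by apply: isub_sum => // l _; apply: isubZ.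
Qed.

Section Herbrand.
Variables (R : comNzRingType) (p : {pred R}) (pp : prime_ideal p).
Variables (M : lmodType R) (th : {linear M -> M}).
Implicit Types (U V W : set M).

Definition himage U : set M := [set y | exists2 x, U x & th x = y].
Definition hpreim U : set M := [set x | U (th x)].
(* The pair (a, b) of lengths at p of Q / th Q and of ker th on Q, for the
   subquotient Q = U / W. *)
Definition herbrand W U a b :=
  len p (sadd W (himage U)) U a /\ len p W (U `&` hpreim W) b.

Lemma isub_himage U : isub U -> isub (himage U).
Proof.
move=> sU; split=> [|a _ _ [x Ux <-] [y Uy <-]].
  by exists 0; rewrite ?linear0 //; apply: isub0.
by exists (a *: x + y); rewrite ?linearP //; apply: isubP.
Qed.

Lemma isub_hpreim U : isub U -> isub (hpreim U).
Proof.
move=> sU; split=> [|a x y]; rewrite /hpreim /= ?linear0 ?linearP; first exact: isub0.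
exact: isubP.
Qed.

(* The snake lemma without its connecting map: a - b is additive in U / W. *)
Lemma herbrand_add W V U a b a' b' : isub W -> isub V -> isub U ->
    W `<=` V -> V `<=` U ->
    W `<=` hpreim W -> V `<=` hpreim V -> U `<=` hpreim U ->
    herbrand W V a b -> herbrand V U a' b' ->
  exists a'' b'', herbrand W U a'' b'' /\ (a'' + (b + b') = b'' + (a + a'))%N.
Proof.
move=> sW sV sU WV VU hW hV hU [la lb] [la' lb'].
have siU := isub_himage sU; have siV := isub_himage sV.
have spW := isub_hpreim sW; have spV := isub_hpreim sV.
pose C := sadd W (himage U); have sC : isub C by apply: isub_sadd.
have WC : W `<=` C by apply: sadd_subl.
have iVV : himage V `<=` V by move=> _ [x /hV Vx <-].
have CU : C `<=` U.
  by apply: sadd_min => // [x /WV/VU|_ [x /hU Ux <-]].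
have VC : sadd V C = sadd V (himage U).
  apply/seteqP; split.
    apply: sadd_min; first exact: isub_sadd.
      exact: sadd_subl.
    exact: saddS.
  by apply: saddS => //; apply: sadd_subr.
have iVC : sadd W (himage V) `<=` V `&` C.
  apply: sadd_min; first exact: isubI.
    by move=> x Wx; split; [apply: WV|apply: WC].
  move=> _ [x Vx <-]; split; first exact: hV.
  by apply: sadd_subr => //; exists x => //; apply: VU.
have VCV : V `&` C `<=` V by move=> x [].
(* The cokernel on V / W is cut at the image of the connecting map: [a1] survives in the cokernel on
   U / W, and [a2] is the length of that image. *)
have [a1 [a2 [ea la1 la2]]] :=
  len_split pp (isub_sadd sW siV) (isubI sV sC) sV iVC VCV la.
have VCU : sadd V C `<=` U by apply: sadd_min.
have la'' : len p C U (a' + a1).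
  apply: (len_add pp sC (isub_sadd sV sC) sU) => //.
  - exact: sadd_subr.
  - by rewrite VC.
  exact/len_sadd.
pose T := U `&` hpreim W; have sT : isub T by apply: isubI.
pose T' := U `&` hpreim V; have sT' : isub T' by apply: isubI.
pose Z := sadd T V; have sZ : isub Z by apply: isub_sadd.
have VZ : V `<=` Z by apply: sadd_subr.
have ZT : Z `<=` T'.
  apply: sadd_min => // x.
    by move=> [Ux Wx]; split=> //; apply: WV.
  by move=> Vx; split; [apply: VU|apply: hV].
have [b1 [b2 [eb lb1 lb2]]] := len_split pp sV sZ sT' VZ ZT lb'.
have TV : T `&` V = V `&` hpreim W.
  apply/seteqP; split=> x; first by move=> [[_ Wx] Vx].
  by move=> [Vx Wx]; split=> //; split=> //; apply: VU.
have lb'' : len p W T (b2 + b).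
  apply: (len_add pp sW (isubI sT sV) sT).
  - by move=> x Wx; split; [split; [apply/VU/WV|apply: hW]|apply: WV].
  - by move=> x [].
  - exact/len_sadd.
  by rewrite TV.
exists (a' + a1)%N, (b2 + b)%N; split=> //.
(* [b1] is the length of T' / Z, the coimage of the connecting map, and [th] identifies it with the
   image, of length [a2]. *)
suff eab : a2 = b1 by lia.
apply: len_uniq la2 _.
apply: (len_corr (G := fun x y => W (y - th x))) lb1 => //.
- move=> c x x' y y' h h'.
  have -> : c *: y + y' - th (c *: x + x') = c *: (y - th x) + (y' - th x').
    by rewrite linearP scalerBr opprD addrACA.
  exact: isubP.
- exact: isub_sadd.
- exact: isubI.
- move=> x [Ux Vx]; exists (th x); last by rewrite subrr; apply: isub0.
  by split=> //; apply: sadd_subr => //; exists x.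
- move=> y [Vy [w Ww [u Uu uE]]]; exists u.
    split=> //; rewrite /hpreim /= uE; apply: isubB => //; exact: WV.
  by rewrite uE subKr.
move=> x y [Ux Vx] _ Wxy; split.
  move=> [z [Uz Wz] Vxz]; exists (y - th (x - z)).
    by rewrite linearB opprB addrCA addrC; apply: isubD.
  by rewrite subKr; exists (x - z).
move=> [w Ww [v Vv vE]]; exists (x - v); last by rewrite subKr.
split; first by apply: isubB => //; apply: VU.
rewrite /hpreim /= linearB vE.
have -> : th x - (y - w) = w - (y - th x) by rewrite !opprB addrCA.
exact: isubB.
Qed.

Lemma herbrand_id W : isub W -> W `<=` hpreim W -> herbrand W W 0 0.
Proof.
move=> sW hW; have sWi := isub_himage sW; split.
  have -> : sadd W (himage W) = W; last exact: len_id.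
  by apply: sadd_idl => // _ [x /hW ? <-].
have -> : W `&` hpreim W = W; last exact: len_id.
by apply/seteqP; split=> x; [case|split=> //; apply: hW].
Qed.

End Herbrand.

(** * Primes of height at least 2 in A[[t]] *)

Section HeightTwo.
Variables (A : idomainType) (noethA : noetherian A).
Hypothesis cicA : completely_integrally_closed A.
Local Notation t := (fps_t A).

Lemma prime_preim_pi (p : {pred A}) : prime_ideal p ->
  prime_ideal [pred f : fps A | fps_pi f \in p].
Proof.
move=> pp; split; first split=> [||a u v]; rewrite ?inE.
- by rewrite rmorph0 prime0.
- by rewrite rmorph1 primeN1.
- by move=> pu pv; rewrite rmorphD rmorphM primeP.
by move=> u v; rewrite !inE rmorphM primeM.
Qed.

(* Locally at P = (p, t), a prime q inside P without t is generated by an element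
   f with f(0) of minimal valuation (Nakayama), so it contains no smaller
   nonzero prime. *)
Lemma height2_pi (p : {pred A}) (q : {pred fps A}) : height1 p -> t \notin q ->
  height_ge 2 q -> exists2 f, f \in q & fps_pi f \notin p.
Proof.
move=> hp qt [pq [q1 [q1q qq1 /height_ge1P[pq1 [g1 qg1 g10]]]]].
have pp := height1_prime hp; have pP := prime_preim_pi pp.
set P : {pred fps A} := [pred f | fps_pi f \in p] in pP.
apply: contrapT => nex.
have qP g : g \in q -> fps_pi g \in p.
  by move=> qg; apply: contrapT => /negP pg; apply: nex; exists g.
have [f [qf f0 fmin]] : exists f, [/\ f \in q, fps_pi f != 0 &
    forall g, g \in q -> vge p (pval p (fps_pi f)) (fps_pi g)].
  pose D m := `[< exists f, [/\ f \in q, fps_pi f != 0 & pval p (fps_pi f) = m] >].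
  have ex : exists m, D m.
    have [f qf f0] := prime_not_sub_t pq (q1q _ qg1) g10 qt.
    by exists (pval p (fps_pi f)); apply/asboolP; exists f.
  case: (ex_minnP ex) => m /asboolP[f [qf f0 fm]] mmin; exists f; split=> //.
  by move=> g qg g0; rewrite fm; apply: mmin; apply/asboolP; exists g.
have [l lE] := noeth_fg (fps_noetherian noethA) (prime_isub pq).
pose G := tnth (in_tuple l).
have lG g : g \in q <-> exists c, g = \sum_i c i * G i.
  have := span_codomP (M := (fps A)^o) G g.
  by rewrite codomE map_tnth_enum -lE.
have qG i : G i \in q.
  apply/lG; exists (fun j => (j == i)%:R); rewrite (bigD1 i) //= eqxx mul1r big1 ?addr0 //.
  by move=> j /negPf->; rewrite mul0r.
have principal g : g \in q -> exists S h, S \notin P /\ S * g = f * h.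
  have /choice[s /choice[a sa]] : forall i, exists s a,
      s \notin p /\ s * fps_pi (G i) = a * fps_pi f.
    by move=> i; apply: (pval_div noethA cicA hp f0); apply: fmin.
  have /choice[X XE] : forall i, exists x : 'I_(size l) -> fps A,
      fps_const (s i) * G i - fps_const (a i) * f = t * \sum_j x j * G j.
    move=> i; set d := _ - _.
    have d0 : fps_pi d = 0.
      rewrite /d rmorphB !rmorphM.
      rewrite -[LHS]/(s i * fps_pi (G i) - a i * fps_pi f).
      by rewrite (sa i).2 subrr.
    have qd : d \in q by apply: primeB => //; apply: primeMl.
    have dE := fps_pi_eq0 d0.
    have /lG[x xE] : fps_shift d \in q.
      have : t * fps_shift d \in q by rewrite -dE.
      by rewrite (primeM pq) (negPf qt).
    by exists x; rewrite -xE.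
  (* By the relations just found, [Y] sends the vector of generators into multiples of f. Modulo t
     its determinant is the product of the [s i], so it lies outside P. *)
  pose Y := diag_mx (\row_i fps_const (s i)) - t *: \matrix_(i, j) X i j.
  have piY : fps_pi (\det Y) \notin p.
    rewrite -det_map_mx.
    have -> : map_mx (@fps_pi A) Y = diag_mx (\row_i s i).
      apply/matrixP => i j; rewrite !mxE rmorphB rmorphM rmorphMn.
      by rewrite -[LHS]/(s i *+ (i == j) - 0 * fps_pi (X i j)) mul0r subr0.
    rewrite det_diag; apply: prime_prodn => // i _; rewrite mxE.
    exact: (sa i).1.
  pose W : set (fps A)^o := [set x | exists h, x = f * h].
  have sW : isub W.
    split=> [|b x y [h ->] [h' ->]]; first by exists 0; rewrite mulr0.
    by exists (b * h + h'); rewrite mulrDr; congr (_ + _); rewrite mulrCA.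
  have WY i : W (\sum_j Y i j *: (G j : (fps A)^o)).
    have -> : \sum_j Y i j *: (G j : (fps A)^o) =
        fps_const (s i) * G i - t * \sum_j X i j * G j.
      have E j : Y i j *: (G j : (fps A)^o) =
          (fps_const (s i) *+ (i == j)) * G j - t * (X i j * G j).
        by rewrite !mxE -[LHS]/(_ * _) mulrBl mulrA.
      rewrite (eq_bigr _ (fun j _ => E j)) sumrB -mulr_sumr; congr (_ - _).
      rewrite (bigD1 i) //= eqxx mulr1n big1 ?addr0 // => j ji.
      by rewrite eq_sym (negPf ji) mulr0n mul0r.
    by rewrite -XE subKr; exists (fps_const (a i)); rewrite mulrC.
  have detG := cramer sW WY.
  move=> /lG[c ->]; exists (\det Y).
  have [h hE] : W (\det Y * \sum_i c i * G i).
    rewrite mulr_sumr; apply: (isub_sum (M := (fps A)^o)) => // i _.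
    by rewrite mulrCA; apply: (isubZ (c i) sW (detG i)).
  by exists h.
(* Otherwise q, locally generated by f, would lie in [q1]. Hence an element of [q1] is locally f
   times an element which is again in [q1], and this can be repeated forever. *)
have q1f : f \notin q1.
  apply/negP => q1f; apply: qq1 => g /principal[S [h [PS Sg]]].
  have : S * g \in q1 by rewrite Sg primeMr.
  by rewrite (primeM pq1) => /orP[/q1q/qP|//]; rewrite -[_ \in p]/(S \in P) (negPf PS).
apply: (@no_infinite_divisibility _ (fps_noetherian noethA) P f
  [set g | g \in q1 /\ g != 0] pP (qP f qf) _ _ g1) => // [g [] //|g [q1g g0]].
have [S [h [PS Sg]]] := principal g (q1q _ q1g).
exists S, h; split=> //; split.
  by have : S * g \in q1; [exact: primeMl|rewrite Sg (primeM pq1) (negPf q1f)].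
apply: contraNneq (mulf_neq0 (prime_neq0 pP PS) g0) => h0.
by rewrite Sg h0 mulr0.
Qed.

End HeightTwo.

(* Junk value when I contains no nonzero element. *)
Definition ival (A : idomainType) (p I : {pred A}) : nat := xget 0%N (vmin p I).

Lemma vmin_ival (A : idomainType) (p I : {pred A}) x : x \in I -> x != 0 ->
  vmin p I (ival p I).
Proof. by move=> Ix x0; apply: xgetPex; apply: vmin_exists Ix x0. Qed.

Section PiIdeal.
Variable A : idomainType.
Implicit Types I J : {pred fps A}.

Lemma mem_pi_ideal I a : a \in pi_ideal I <-> exists2 f, f \in I & fps_pi f = a.
Proof. by split=> [/asboolP|h]; last exact/asboolP. Qed.

Lemma isub_pi_ideal I : isub ([set f | f \in I] : set (fps A)^o) ->
  isub ([set a | a \in pi_ideal I] : set A^o).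
Proof.
move=> sI; split=> [|a _ _ /mem_pi_ideal[f If <-] /mem_pi_ideal[g Ig <-]].
  by apply/mem_pi_ideal; exists 0; [exact: (isub0 sI)|exact: rmorph0].
apply/mem_pi_ideal; exists (fps_const a * f + g).
  exact: (isubP (fps_const a) sI If Ig).
by rewrite rmorphD rmorphM.
Qed.

Lemma pi_ideal_mul I J : pi_ideal (ideal_mul I J) = ideal_mul (pi_ideal I) (pi_ideal J).
Proof.
apply: pred_eqP => [_ /mem_pi_ideal[f IJf <-]|].
  apply: (ideal_mul_min (U := [set f | fps_pi f \in ideal_mul (pi_ideal I) (pi_ideal J)])) IJf.
    have sIJ := isub_ideal_mul (pi_ideal I) (pi_ideal J).
    split=> [|a x y hx hy]; first exact: (isub0 sIJ).
    change (fps_pi ((a : fps A) * x + y) \in ideal_mul (pi_ideal I) (pi_ideal J)).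
    by rewrite rmorphD rmorphM; apply: (isubP (fps_pi a) sIJ hx hy).
  move=> a b Ia Jb; change (fps_pi (a * b) \in ideal_mul (pi_ideal I) (pi_ideal J)).
  rewrite rmorphM; apply: mem_ideal_mul.
    by apply/mem_pi_ideal; exists a.
  by apply/mem_pi_ideal; exists b.
apply: ideal_mul_min; first exact/isub_pi_ideal/isub_ideal_mul.
move=> _ _ /mem_pi_ideal[f If <-] /mem_pi_ideal[g Jg <-].
by apply/mem_pi_ideal; exists (f * g); rewrite ?mem_ideal_mul // rmorphM.
Qed.

Lemma pi_idealT : pi_ideal predT = predT :> {pred A}.
Proof. by apply: pred_eqP => // a _; apply/mem_pi_ideal; exists (fps_const a). Qed.

End PiIdeal.

(** * Kernel and cokernel of t on a module killed by f with f(0) nonzero *)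

Section Formula.
Variables (A : idomainType) (noethA : noetherian A).
Hypothesis cicA : completely_integrally_closed A.
Local Notation t := (fps_t A).

Lemma isub_restr (M : lmodType (fps A)) (U : set M) : isub U -> isub (U : set (restr M)).
Proof. by move=> [U0 UP]; split=> // a x y; apply: (UP (fps_const a)). Qed.

Section FixedModule.
Variables (M : lmodType (fps A)) (f : fps A).
Hypotheses (f0 : fps_pi f != 0) (fM : forall m : M, f *: m = 0).
Let th : {linear restr M -> restr M} := @tmul A M.

Lemma hpreim_sub (W : set M) : isub W -> (W : set (restr M)) `<=` hpreim th W.
Proof. by move=> sW x Wx; apply: (isubZ t sW). Qed.

(** With B = A[[t]], the quotient U / W is B / q, and its cokernel under t is B / (q + tB), which is
    A / pi(q) through the constant term. The value of [ival] is meaningful because pi(q) contains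
    f(0). *)
Lemma len_base (p : {pred A}) (W : set M) x : height1 p -> isub W ->
  let q := pred_of (colon W x) in prime_ideal q ->
  len p (sadd W (himage th (sadd W (span [:: x]))) : set (restr M))
    (sadd W (span [:: x])) (ival p (pi_ideal q)).
Proof.
move=> hp sW q pq; set U := sadd W (span [:: x]).
have sU : isub U by apply: isub_sadd => //; apply: isub_span.
have sWr := isub_restr sW; have sUr := isub_restr sU.
have siU := isub_himage th sUr.
have sC := isub_sadd sWr siU; set C := sadd (W : set (restr M)) (himage th U) in sC *.
have WU : W `<=` U by apply: sadd_subl; apply: isub_span.
have CU : C `<=` U by apply: sadd_min => // _ [y Uy <-]; apply: (isubZ t sU Uy).
have WC : (W : set (restr M)) `<=` C by apply: sadd_subl.
have qW g : g \in q <-> W (g *: x) by split=> [/pred_ofP|h]; last exact/pred_ofP.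
have Ux : U x by apply: sadd_subr => //; apply: mem_span; apply: mem_head.
have Uinv y : U y -> exists w b, W w /\ y = w + b *: x.
  move=> [w Ww [b yb]]; exists w, b; split=> //.
  by apply/eqP; rewrite -subr_eq0 opprD addrA; apply/eqP.
have Ct b : C (t *: (b *: x)).
  by apply: sadd_subr => //; exists (b *: x) => //; apply: isubZ.
have qf : f \in q by apply/qW; rewrite fM; apply: isub0.
have pif : fps_pi f \in pi_ideal q by apply/mem_pi_ideal; exists f.
have spq : isub ([set a | a \in pi_ideal q] : set A^o).
  exact/isub_pi_ideal/prime_isub.
have := len_vmin noethA cicA hp spq (vmin_ival p pif f0).
apply: (len_corr (G := fun (a : A^o) (y : restr M) =>
   C ((y : M) - fps_const a *: x))) => //.
- move=> c a a' y y' h h'.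
  have -> : ((c *: y + y' : restr M) : M) - fps_const (c *: a + a') *: x =
     (c *: ((y - fps_const a *: x : M) : restr M) + (y' - fps_const a' *: x : M) : restr M).
    rewrite -[LHS]/(fps_const c *: (y : M) + (y' : M) - fps_const (c * a + a') *: x).
    rewrite -[RHS]/(fps_const c *: ((y : M) - fps_const a *: x) + ((y' : M) - fps_const a' *: x)).
    by rewrite rmorphD rmorphM scalerDl scalerBr scalerA opprD addrACA.
  exact: isubP.
- move=> a _; exists (fps_const a *: x); first exact: isubZ.
  by rewrite subrr; apply: (isub0 sC).
- move=> y /Uinv[w [b [Ww ->]]]; exists (fps_pi b) => //.
  have -> : w + b *: x - fps_const (fps_pi b) *: x = t *: (fps_shift b *: x) + w.
    by rewrite {1}[b]fps_shiftE scalerDl scalerA -addrA [X in w + X]addrAC subrr add0r addrC.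
  exact: (isubD sC (Ct _) (WC _ Ww)).
have Cx a : a \in pi_ideal q <-> C (fps_const a *: x).
  split=> [/mem_pi_ideal[g /qW Wg <-]|].
    have -> : fps_const (fps_pi g) *: x = g *: x - t *: (fps_shift g *: x).
      by rewrite {2}[g]fps_shiftE scalerDl scalerA addrK.
    exact: (isubB sC (WC _ Wg) (Ct _)).
  move=> [w Ww [u /Uinv[w' [b [Ww' uE]]] tuE]].
  apply/mem_pi_ideal; exists (fps_const a - t * b).
    apply/qW; rewrite scalerBl -scalerA.
    have -> : b *: x = u - w' by rewrite uE addrC addKr.
    have -> : fps_const a *: x - t *: (u - w') = w + t *: w'.
      have : t *: u = fps_const a *: x - w := tuE.
      by rewrite scalerBr => ->; rewrite -addrA -opprD subKr.
    by apply: isubD => //; apply: isubZ.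
  rewrite rmorphB rmorphM -[LHS]/(a - 0 * fps_pi b) mul0r subr0 //.
move=> a y _ _ Cya; split=> [/Cx Ca|Cy].
  by have := isubD sC Cya Ca; rewrite [X in C X -> _](subrK (fps_const a *: x : M)).
by apply/Cx; have := isubB sC Cy Cya; rewrite [X in C X -> _](subKr (y : M)).
Qed.

(** A single list [L] serves all p and also gives the lengths over A[[t]], which is what ties the
    defect of t to the characteristic ideal. Its primes have nonzero image under pi because each of
    them contains f. *)
Lemma herbrand_formula : fin_gen M -> exists L : seq {pred fps A},
  [/\ forall q, q \in L -> height1 q /\ exists2 g, g \in q & fps_pi g != 0,
      forall q, height1 q -> len q [set 0 : M] setT (count_mem q L) &
      forall p, height1 p -> exists a b, herbrand p th [set 0] setT a b /\
        a = (b + \sum_(q <- L) ival p (pi_ideal q))%N].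
Proof.
have noethB := fps_noetherian noethA.
move=> /fin_genP[l lE].
pose P (W U : set M) := exists L : seq {pred fps A},
  [/\ forall q, q \in L -> height1 q /\ exists2 g, g \in q & fps_pi g != 0,
      forall q, height1 q -> len q W U (count_mem q L) &
      forall p, height1 p -> exists a b, herbrand p th W U a b /\
        a = (b + \sum_(q <- L) ival p (pi_ideal q))%N].
suff : P [set 0] (sadd [set 0] (span l)).
  have -> // : sadd [set 0] (span l) = [set: M].
  by apply/seteqP; split=> // x _; apply: sadd_subr => //; [exact: isub_zero|rewrite -lE].
apply: (devissage noethB); last exact: isub_zero.
- move=> W sW; exists [::]; split=> // [q hq|p hp].
    by apply: len_id => //; apply: height1_prime.
  exists 0%N, 0%N; rewrite big_nil; split=> //.
  by apply: herbrand_id; [exact: height1_prime|exact: isub_restr|exact: hpreim_sub].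
- move=> W V U sW sV sU WV VU [L [hL lL cL]] [L' [hL' lL' cL']].
  exists (L' ++ L); split=> [q|q hq|p hp].
  + by rewrite mem_cat => /orP[/hL'|/hL].
  + rewrite count_cat; apply: (len_add _ sW sV sU) => //; first exact: height1_prime.
      exact: lL'.
    exact: lL.
  have [a [b [ab eab]]] := cL p hp; have [a' [b' [ab' eab']]] := cL' p hp.
  have [a'' [b'' [ab'' e'']]] := herbrand_add (height1_prime hp) (isub_restr sW)
    (isub_restr sV) (isub_restr sU) WV VU (hpreim_sub sW) (hpreim_sub sV)
    (hpreim_sub sU) ab ab'.
  exists a'', b''; split=> //; rewrite big_cat; move: eab eab' e''.
  move: (bigop.body _ _ _) (bigop.body _ _ _) => s s' /=; lia.
move=> W x sW pq; set q := pred_of (colon W x) in pq.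
set U := sadd W (span [:: x]).
have sU : isub U by apply: isub_sadd => //; apply: isub_span.
have WU : W `<=` U by apply: sadd_subl (isub_span _).
have qW g : g \in q <-> W (g *: x) by split=> [/pred_ofP|h]; last exact/pred_ofP.
have qf : f \in q by apply/qW; rewrite fM; apply: isub0.
have fn0 : f != 0 by apply: contraNneq f0 => ->; rewrite rmorph0.
have lq q' : height1 q' -> len q' W U (q == q').
  by apply: (len_prime_cyclic sW pq fn0); rewrite fM; apply: isub0.
have Uinv y : U y -> exists w b, W w /\ y = w + b *: x.
  move=> [w Ww [b yb]]; exists w, b; split=> //.
  by apply/eqP; rewrite -subr_eq0 opprD addrA; apply/eqP.
have no_height1 : ~ height1 q -> forall q', height1 q' -> len q' W U 0.
  by move=> nq q' hq'; have := lq q' hq'; case: eqP => // eq; rewrite eq in nq.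
(* If t is in q, it kills U / W, so kernel and cokernel coincide. Such a q is not of height 1, for
   it would equal (t), which does not contain f. *)
have [qt|qt] := boolP (t \in q).
  have nq : ~ height1 q.
    move=> hq; have eq : @t_ideal A = q.
      apply: (height1_max hq (prime_t_ideal A) (x := t)).
      - by apply/t_idealP; exists 1; rewrite mulr1.
      - exact: fps_t_neq0.
      - by move=> g /t_idealP[h ->]; apply: primeMr.
    by move: qf; rewrite -eq inE (negPf f0).
  have tU y : U y -> W (t *: y).
    move=> /Uinv[w [b [Ww ->]]]; rewrite scalerDr; apply: isubD => //.
      exact: isubZ.
    by rewrite scalerA mulrC -scalerA; apply: isubZ => //; apply/qW.
  exists [::]; split=> // [|p hp]; first exact: no_height1.
  exists (ival p (pi_ideal q)), (ival p (pi_ideal q)).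
  rewrite big_nil addn0; split=> //; split; first exact: len_base.
  have -> : (U : set (restr M)) `&` hpreim th W = U.
    by apply/seteqP; split=> y; [case|split=> //; apply: tU].
  have lb : len p (sadd (W : set (restr M)) (himage th U)) U (ival p (pi_ideal q)).
    exact: len_base.
  rewrite (sadd_idl (isub_restr sW) (isub_himage th (isub_restr sU))) // in lb.
  by move=> _ [y Uy <-]; apply: tU.
have tT : (U : set (restr M)) `&` hpreim th W = W.
  apply/seteqP; split=> y; last first.
    by move=> Wy; split; [apply: WU|apply: (isubZ t sW)].
  move=> [/Uinv[w [b [Ww ->]]] Wt]; apply: isubD => //.
  have : W (t *: (w + b *: x)) by [].
  rewrite scalerDr => /(isubB sW)/(_ (isubZ t sW Ww)); rewrite addrC addKr scalerA.
  by move=> /qW; rewrite (primeM pq) (negPf qt) => /qW.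
have hT p : height1 p -> len p (W : set (restr M)) ((U : set (restr M)) `&` hpreim th W) 0.
  by move=> hp; rewrite tT; apply: len_id; [exact: height1_prime|exact: isub_restr].
have [hq|hq] := height_dichotomy pq qf fn0.
  exists [:: q]; split=> [q'|q' hq'|p hp].
  - by rewrite inE => /eqP->; split=> //; exists f.
  - by rewrite /= addn0; apply: lq.
  exists (ival p (pi_ideal q)), 0%N; rewrite big_seq1; split=> //.
  by split; [exact: len_base|exact: hT].
(* Here q has height at least 2 and avoids t, so it contains some g with g(0) outside p, and pi(q)
   has valuation 0 at p. *)
exists [::]; split=> // [|p hp]; first by apply: no_height1; case.
exists 0%N, 0%N; rewrite big_nil; split=> //; split; last exact: hT.
have := len_base hp sW pq.
suff -> : ival p (pi_ideal q) = 0%N by [].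
have pif : fps_pi f \in pi_ideal q by apply/mem_pi_ideal; exists f.
apply: vmin_uniq (vmin_ival p pif f0) _.
have [g qg pg] := height2_pi noethA cicA hp qt hq.
have pg0 := prime_neq0 (height1_prime hp) pg.
split=> //; exists (fps_pi g); split=> //.
  by apply/mem_pi_ideal; exists g.
by apply/eqP; rewrite (pval_eq0 noethA cicA hp pg0).
Qed.

(** On the kernel of t a series acts through its constant term, so generators over A[[t]] are
    generators over [A]. *)
Lemma ttorsion_fin_gen : fin_gen M -> fin_gen (ttorsion M).
Proof.
move=> fgM; have [l lE] : sub_fg ([set m | t *: m = 0] : set M).
  move/fin_genP: fgM => [l lE].
  apply: (noeth_sub (fps_noetherian noethA) (l := l)); last by rewrite -lE.
  split=> [|a x y /= tx ty] /=; first by rewrite scaler0.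
  by rewrite scalerDr ty addr0 scalerA mulrC -scalerA tx scaler0.
pose G := tnth (in_tuple l).
have tG i : t *: G i = 0.
  have : span l (G i) by apply: mem_span; apply: mem_tnth.
  by rewrite -lE.
have kG i : (G i : restr M) \in kerm th by apply/eqP/tG.
exists (size l), (fun i => SubMod (kG i) : ttorsion M) => m.
have tm : t *: (\val m : M) = 0 by apply/eqP; apply: (valP m).
have : span l (\val m : M) by rewrite -lE.
have := span_codomP G (\val m : M); rewrite codomE map_tnth_enum => -> [c cE].
exists (fun i => fps_pi (c i)); apply: val_inj.
rewrite linear_sum; apply: (etrans cE); apply: eq_bigr => i _; rewrite linearZ.
rewrite -[RHS]/(fps_const (fps_pi (c i)) *: G i) {1}[c i]fps_shiftE scalerDl.
by rewrite [t * _]mulrC -scalerA tG scaler0 addr0.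
Qed.

Lemma tquotient_fin_gen : fin_gen M -> fin_gen (tquotient M).
Proof.
move=> [n [g gP]]; exists n, (fun i => quotmod_proj (imm th) (g i)) => y.
rewrite -[y]quotmod_projK; set m := repr _.
have [c cE] := gP m; exists (fun i => fps_pi (c i)).
have -> : \sum_i fps_pi (c i) *: quotmod_proj (imm th) (g i) =
    quotmod_proj (imm th) (\sum_i fps_pi (c i) *: (g i : restr M)).
  by rewrite linear_sum; apply: eq_bigr => i _; rewrite linearZ.
apply/quotmod_projP; apply/asboolP; exists (\sum_i fps_shift (c i) *: g i).
rewrite -[LHS]/(t *: (\sum_i fps_shift (c i) *: g i)) cE -[RHS]sumrB scaler_sumr.
apply: eq_bigr => i _.
rewrite -[RHS]/(c i *: g i - fps_const (fps_pi (c i)) *: g i) {2}[c i]fps_shiftE.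
by rewrite scalerDl scalerA addrC addKr.
Qed.

Lemma ttorsion_torsion : torsion (ttorsion M).
Proof.
move=> m; exists (fps_pi f) => //; apply: val_inj; rewrite linearZ [RHS]linear0.
have tm : t *: (\val m : M) = 0 by apply/eqP; apply: (valP m).
rewrite -[LHS]/(fps_const (fps_pi f) *: (\val m : M)).
have := fM (\val m); rewrite {1}[f]fps_shiftE scalerDl [t * _]mulrC -scalerA tm.
by rewrite scaler0 addr0.
Qed.

Lemma tquotient_torsion : torsion (tquotient M).
Proof.
move=> y; exists (fps_pi f) => //; rewrite -[y]quotmod_projK; set m := repr _.
rewrite -linearZ; apply/quotmod_proj_eq0; apply/asboolP.
exists (- (fps_shift f *: (m : M))).
rewrite -[LHS]/(t *: - (fps_shift f *: (m : M))).
rewrite -[RHS]/(fps_const (fps_pi f) *: (m : M)).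
have := fM m; rewrite {1}[f]fps_shiftE scalerDl -scalerA => /eqP.
by rewrite addr_eq0 scalerN => /eqP->.
Qed.

Lemma len_ttorsion p a b : herbrand p th [set 0] setT a b ->
  len p [set 0 : ttorsion M] setT b.
Proof.
move=> [_]; rewrite setTI.
apply: (len_corr (G := fun (x : restr M) (y : ttorsion M) => x = \val y)) => //.
- by move=> c x x' y y' -> ->; rewrite linearP.
- exact: isub_zero.
- exact: (isub_hpreim th (isub_zero _)).
- exact: isub_zero.
- by move=> x ->; exact: (isub0 (isub_hpreim th (isub_zero _))).
- move=> x tx; have kx : x \in kerm th by apply/eqP.
  by exists (SubMod kx).
- by move=> y _; exists (\val y) => //; apply/eqP; apply: (valP y).
move=> x y _ _ ->; split=> [y0|->]; last exact: linear0.
by apply: val_inj; rewrite [RHS]linear0.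
Qed.

Lemma len_tquotient p a b : herbrand p th [set 0] setT a b ->
  len p [set 0 : tquotient M] setT a.
Proof.
have si := isub_himage th (isubT (restr M)); move=> [+ _].
have -> : sadd [set 0] (himage th setT) = himage th setT.
  apply/seteqP; split; last exact: sadd_subr (isub_zero _).
  by apply: sadd_min => // x ->; apply: isub0.
apply: (len_corr (G := fun (x : restr M) y => quotmod_proj (imm th) x = y)) => //.
- by move=> c x x' y y' <- <-; rewrite linearP.
- exact: isub_zero.
- by move=> x _; exists (quotmod_proj (imm th) x).
- by move=> y _; exists (repr y) => //; apply: quotmod_projK.
move=> x y _ _ <-; split=> [[z _ zx]|/= h].
  by apply/quotmod_proj_eq0; apply/asboolP; exists z.
by have /asboolP[z zx] : x \in imm th by [apply/quotmod_proj_eq0]; exists z.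
Qed.

End FixedModule.
End Formula.

(** * Comparison of characteristic ideals *)

Lemma ideal_prod_sub (R : comNzRingType) n (I : 'I_n -> {pred R}) x i :
    (forall j, isub ([set y | y \in I j] : set R^o)) ->
  x \in ideal_prod I -> x \in I i.
Proof.
have isub_prod m (J : 'I_m -> {pred R}) : isub ([set y | y \in ideal_prod J] : set R^o).
  rewrite /ideal_prod; case: m J => [|m] J; first by rewrite big_ord0.
  by rewrite big_ord_recl; apply: isub_ideal_mul.
move=> sI; elim: n I i sI x => [|n IHn] I i sI x; first by case: i.
rewrite /ideal_prod big_ord_recl => Ix.
have [j ->|->] := unliftP ord0 i; last first.
  apply: (ideal_mul_min (sI ord0)) Ix => a b Ia _.
  by rewrite mulrC; apply: (isubZ b (sI ord0) Ia).
apply: (IHn (fun j => I (lift ord0 j))) => [k|]; first exact: sI.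
by apply: (ideal_mul_min (isub_prod _ _)) Ix => a b _ Jb; apply: (isubZ a (isub_prod _ _) Jb).
Qed.

Section CharacteristicIdeals.
Variables (R : idomainType) (noethR : noetherian R).
Hypothesis cicR : completely_integrally_closed R.

Lemma Ch_iprod (M : lmodType R) : fin_gen M -> torsion M -> exists L : seq {pred R},
  [/\ forall q, q \in L -> height1 q, Ch M = iprod L &
    forall q n, height1 q -> len q [set 0 : M] setT n -> n = count_mem q L].
Proof.
move=> fgM tM; apply: char_ideal_iprod => //; rewrite /Ch asboolT //.
exact: (xgetPex _ (char_ideal_exists noethR cicR fgM tM)).
Qed.

Lemma height1_perm (L L' : seq {pred R}) : (forall q, q \in L -> height1 q) ->
    (forall q, q \in L' -> height1 q) ->
    (forall q, height1 q -> count_mem q L = count_mem q L') ->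
  perm_eq L L'.
Proof.
move=> hL hL' eqL; apply/allP => q _; apply/eqP.
have [hq|nq] := pselect (height1 q); first exact: eqL.
by rewrite !(count_memPn _) //; apply/negP; [move/hL'|move/hL].
Qed.

Lemma iprod_neq0 (L : seq {pred R}) : (forall q, q \in L -> height1 q) ->
  exists2 x, x \in iprod L & x != 0.
Proof.
elim: L => [_|q L IHL hL]; first by exists 1; rewrite ?oner_neq0.
have [|x Lx x0] := IHL; first by move=> q' q'L; apply: hL; rewrite inE q'L orbT.
have [y qy y0] := height1_neq0 (hL q (mem_head _ _)).
by exists (y * x); [apply: mem_ideal_mul|apply: mulf_neq0].
Qed.

End CharacteristicIdeals.

Section Divisors.
Variables (A : idomainType) (noethA : noetherian A) (krullA : krull_domain A).
Let cicA := krull_completely_integrally_closed krullA.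
Implicit Types I J : {pred A}.

(** Containment of [I] in the principal fractional ideal (b / a) is an inequality of divisors. The
    condition on b is separate because [pval] is meaningless at 0. *)
Lemma divisor_le I a b : (exists2 x, x \in I & x != 0) -> a != 0 ->
  (forall y, y \in I -> exists c, a * y = b * c) <->
  (b != 0 /\ forall p n, height1 p -> vmin p I n -> (pval p b <= pval p a + n)%N).
Proof.
move=> [x Ix x0] a0; split=> [h|[b0 h] y Iy].
  have b0 : b != 0.
    apply/eqP => b0; have [c] := h x Ix; rewrite b0 mul0r => /eqP.
    by rewrite mulf_eq0 (negPf a0) (negPf x0).
  split=> // p n hp [[y [Iy y0 <-]] _]; have [c cE] := h y Iy.
  have c0 : c != 0.
    by apply: contraNneq (mulf_neq0 a0 y0) => c0; rewrite cE c0 mulr0.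
  by rewrite -(pvalM noethA cicA hp) // cE (pvalM noethA cicA hp) // leq_addr.
apply: (krull_dvd krullA b0) => p hp; apply: (pval_div noethA cicA hp b0).
have [n vn] := vmin_exists p Ix x0.
apply: (vge_le (h p n hp vn)); apply: vgeM => //.
exact: vn.2.
Qed.

Lemma divisorial_closure_eq I J : (exists2 x, x \in I & x != 0) ->
    (exists2 x, x \in J & x != 0) ->
    (forall p, height1 p -> exists2 n, vmin p I n & vmin p J n) ->
  divisorial_closure I =i divisorial_closure J.
Proof.
have sub I' J' : (exists2 x, x \in I' & x != 0) -> (exists2 x, x \in J' & x != 0) ->
    (forall p, height1 p -> exists2 n, vmin p I' n & vmin p J' n) ->
  {subset divisorial_closure I' <= divisorial_closure J'}.
  move=> I0 J0 IJ x /asboolP h; apply/asboolP => a b a0 hab; apply: h => //.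
  have [b0 hb] := (divisor_le b J0 a0).1 hab.
  apply/(divisor_le b I0 a0); split=> // p n hp vn; have [m vI vJ] := IJ p hp.
  by rewrite (vmin_uniq vn vI); apply: hb.
move=> I0 J0 IJ x; apply/idP/idP; apply: sub => // p hp.
by have [n vI vJ] := IJ p hp; exists n.
Qed.

Lemma vmin_pi_iprod p (L : seq {pred fps A}) : height1 p ->
    (forall q, q \in L -> exists2 g, g \in q & fps_pi g != 0) ->
  vmin p (pi_ideal (iprod L)) (\sum_(q <- L) ival p (pi_ideal q)).
Proof.
move=> hp; elim: L => [_|q L IHL hL].
  by rewrite big_nil /= pi_idealT; apply: vmin_predT.
rewrite big_cons /= pi_ideal_mul; apply: (vmin_mul noethA cicA hp).
  have [g qg g0] := hL q (mem_head _ _); apply: vmin_ival g0.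
  by apply/mem_pi_ideal; exists g.
by apply: IHL => q' q'L; apply: hL; rewrite inE q'L orbT.
Qed.

Lemma pi_iprod_neq0 (L : seq {pred fps A}) :
    (forall q, q \in L -> exists2 g, g \in q & fps_pi g != 0) ->
  exists2 x, x \in pi_ideal (iprod L) & x != 0.
Proof.
elim: L => [_|q L IHL hL]; first by exists 1; rewrite ?oner_neq0 //= pi_idealT.
have [|x Lx x0] := IHL; first by move=> q' q'L; apply: hL; rewrite inE q'L orbT.
have [g qg g0] := hL q (mem_head _ _).
exists (fps_pi g * x); last exact: mulf_neq0.
by rewrite /= pi_ideal_mul; apply: mem_ideal_mul => //; apply/mem_pi_ideal; exists g.
Qed.

End Divisors.

(** * Modules whose annihilator lies in (t) *)

Section Degenerate.
Variables (A : idomainType) (noethA : noetherian A) (krullA : krull_domain A).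
Variable N : lmodType (fps A).
Hypotheses (fgN : fin_gen N) (tN : torsion N).
Hypothesis annN : forall f : fps A, (forall m : N, f *: m = 0) -> fps_pi f = 0.
Let cicA := krull_completely_integrally_closed krullA.
Let cicB := fps_completely_integrally_closed cicA.
Let noethB := fps_noetherian noethA.
Local Notation t := (fps_t A).

(* If a N is contained in t N with a != 0, then N is killed by det (a - t X). *)
Lemma tquotient_not_torsion : ~ torsion (tquotient N).
Proof.
move=> tq; have [a a0 aN] := fin_gen_ann (tquotient_fin_gen fgN) tq.
have [n [g gP]] := fgN.
have /choice[X XE] : forall i, exists x : 'I_n -> fps A,
    fps_const a *: g i = t *: \sum_j x j *: g j.
  move=> i; have := aN (quotmod_proj (imm (@tmul A N)) (g i)).
  rewrite -linearZ => /quotmod_proj_eq0/asboolP[y yE]; have [x xE] := gP y.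
  by exists x; rewrite -xE; apply/esym.
pose Y := (fps_const a)%:M - t *: \matrix_(i, j) X i j.
have YN i : [set 0 : N] (\sum_j Y i j *: g j).
  have E j : Y i j *: g j = (fps_const a *+ (i == j)) *: g j - t *: (X i j *: g j).
    by rewrite !mxE scalerBl scalerA.
  rewrite (eq_bigr _ (fun j _ => E j)) sumrB -scaler_sumr -XE.
  rewrite (bigD1 i) //= eqxx mulr1n big1 ?addr0 ?subrr // => j ji.
  by rewrite eq_sym (negPf ji) mulr0n scale0r.
have detN := cramer (isub_zero N) YN.
have : fps_pi (\det Y) = 0.
  apply: annN => m; have [c ->] := gP m; rewrite scaler_sumr big1 // => i _.
  by rewrite scalerA mulrC -scalerA detN scaler0.
rewrite -det_map_mx; have -> : map_mx (@fps_pi A) Y = a%:M.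
  apply/matrixP => i j; rewrite !mxE rmorphB rmorphM rmorphMn.
  by rewrite -[LHS]/(a *+ (i == j) - 0 * fps_pi (X i j)) mul0r subr0.
by rewrite det_scalar => /eqP; rewrite expf_eq0 (negPf a0) andbF.
Qed.

(** An element f of Ch(N) kills the elementary module, so f N lies in the pseudo-null kernel, which
    is killed by some h outside (t). Then h f kills [N], and pi(h) pi(f) = 0 with pi(h) nonzero. *)
Lemma pi_Ch_eq0 a : a \in pi_ideal (Ch N) -> a = 0.
Proof.
move=> /mem_pi_ideal[f Nf <-].
have : is_char_ideal N (Ch N).
  by rewrite /Ch asboolT //; apply: (xgetPex _ (char_ideal_exists noethB cicB fgN tN)).
move=> [n [p [e [F [hp _ [kF _] CE]]]]].
have [h ht hk] := pseudo_null_local kF (height1_t_ideal A).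
suff : fps_pi (h * f) = 0.
  by rewrite rmorphM => /eqP; rewrite mulf_eq0 [_ == 0](negPf ht) => /eqP.
apply: annN => m; rewrite -scalerA.
suff kfm : F (f *: m) = 0.
  by apply: (submod_ann _ hk); apply/eqP.
rewrite linearZ; apply: dsumP => i.
have [c cE] := elementary_lift (F m).
rewrite -[LHS]/(f *: dsum_proj (F m) i) cE -linearZ.
apply/quotmod_proj_eq0; rewrite [f *: _]mulrC; apply: ideal_expMl.
by apply: (@ideal_prod_sub _ n (fun i => ideal_exp (p i) (e i))); rewrite -?CE // => j;
  apply: isub_ideal_exp.
Qed.

End Degenerate.

Theorem proposition1p1 (A : idomainType)
    (A_noeth : noetherian A) (A_krull : krull_domain A) :
  (forall M : lmodType (fps A), pseudo_null M ->
    [/\ fin_gen (ttorsion M) /\ torsion (ttorsion M),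
        fin_gen (tquotient M) /\ torsion (tquotient M)
      & Ch (ttorsion M) =i Ch (tquotient M)]) /\
  (forall N : lmodType (fps A), fin_gen N -> torsion N ->
    divisorial_closure (ideal_mul (Ch (ttorsion N)) (pi_ideal (Ch N)))
      =i divisorial_closure (Ch (tquotient N))).
Proof.
have cicA := krull_completely_integrally_closed A_krull.
have cicB := fps_completely_integrally_closed cicA.
have noethB := fps_noetherian A_noeth.
split=> [M pnM|N fgN tN].
  have [fgM tM _] := pnM.
  have [f f0 fM] := pseudo_null_local pnM (height1_t_ideal A).
  have fgt := ttorsion_fin_gen A_noeth fgM; have fgq := tquotient_fin_gen fgM.
  have tt := ttorsion_torsion f0 fM; have tq := tquotient_torsion f0 fM.
  split=> //.
  have [L [hL lL cL]] := herbrand_formula A_noeth cicA f0 fM fgM.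
  (* Over A[[t]] all lengths of a pseudo-null module at height 1 primes vanish, so [L] is empty and
     the correction term disappears. *)
  have L0 q : height1 q -> count_mem q L = 0%N.
    move=> hq; apply: len_uniq (lL q hq) _.
    apply/len0P => //; first exact: isub_zero.
    by move=> x _; have [s qs sM] := pseudo_null_local pnM hq; exists s => //; apply: sM.
  have Lnil : L = [::].
    case: L hL L0 {lL cL} => // q L hL L0; have [hq _] := hL q (mem_head _ _).
    by have := L0 q hq; rewrite /= eqxx.
  have [Lt [hLt -> lt]] := Ch_iprod A_noeth cicA fgt tt.
  have [Lq [hLq -> lq]] := Ch_iprod A_noeth cicA fgq tq.
  move=> x; rewrite (@iprod_perm _ Lt Lq) //; apply: height1_perm => // p hp.
  have [a [b [hab]]] := cL p hp; rewrite Lnil big_nil addn0 => eab.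
  rewrite -(lt p b hp (len_ttorsion hab)) -(lq p a hp (len_tquotient hab)).
  by rewrite eab.
have [[f f0 fN]|nf] := pselect (exists2 f : fps A, fps_pi f != 0 & forall m : N, f *: m = 0).
  have fgt := ttorsion_fin_gen A_noeth fgN; have fgq := tquotient_fin_gen fgN.
  have tt := ttorsion_torsion f0 fN; have tq := tquotient_torsion f0 fN.
  have [L [hL lL cL]] := herbrand_formula A_noeth cicA f0 fN fgN.
  have [Lt [hLt -> lt]] := Ch_iprod A_noeth cicA fgt tt.
  have [Lq [hLq -> lq]] := Ch_iprod A_noeth cicA fgq tq.
  have [LN [hLN -> lN]] := Ch_iprod noethB cicB fgN tN.
  (* The multiplicities in both lists are the lengths of N at height 1 primes: one list comes from a
     pseudo-isomorphism, the other from the devissage that computed the defect. *)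
  have -> : iprod LN = iprod L.
    apply: iprod_perm; apply: height1_perm => // [q /hL[] //|q hq].
    by rewrite (lN q _ hq (lL q hq)).
  have Lpi q : q \in L -> exists2 g, g \in q & fps_pi g != 0 by case/hL.
  apply: (divisorial_closure_eq A_noeth A_krull).
  - have [x Ix x0] := iprod_neq0 hLt; have [y Jy y0] := pi_iprod_neq0 Lpi.
    by exists (x * y); [apply: mem_ideal_mul|apply: mulf_neq0].
  - exact: iprod_neq0.
  move=> p hp; have [a [b [hab eab]]] := cL p hp.
  exists a; last first.
    by rewrite (lq p a hp (len_tquotient hab)); apply: vmin_iprod.
  rewrite eab; apply: (vmin_mul A_noeth cicA hp).
    by rewrite (lt p b hp (len_ttorsion hab)); apply: vmin_iprod.
  exact: vmin_pi_iprod.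
have annN (f : fps A) : (forall m : N, f *: m = 0) -> fps_pi f = 0.
  by move=> fN; apply: contrapT => /eqP f0; apply: nf; exists f.
have pi0 := pi_Ch_eq0 A_noeth A_krull fgN tN annN.
have -> : Ch (tquotient N) = pred1 0 :> {pred A}.
  by rewrite /Ch asboolF //; apply: tquotient_not_torsion.
suff -> : ideal_mul (Ch (ttorsion N)) (pi_ideal (Ch N)) = pred1 0 by [].
apply: pred_eqP => x; last first.
  by rewrite inE => /eqP->; apply: (isub0 (isub_ideal_mul _ _)).
move=> Ix; apply/eqP.
apply: (ideal_mul_min (isub_zero (A^o)) _ Ix) => a b _ /pi0 ->.
exact: mulr0.
Qed.
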